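(* Fix $1\leqslant p\leqslant\infty$. For any non-empty finite set $\Lambda$, any ordinal $\xi$, and any operators $A_\lambda:X_\lambda\to Y_\lambda$ ($\lambda\in\Lambda$) between Banach spaces, $$\alpha_{\xi,r}\Bigl(\oplus_{\lambda\in\Lambda}A_\lambda:(\oplus_{\lambda\in\Lambda}X_\lambda)_{\ell_p(\Lambda)}\to(\oplus_{\lambda\in\Lambda}Y_\lambda)_{\ell_p(\Lambda)}\Bigr)=\max_{\lambda\in\Lambda}\alpha_{\xi,r}(A_\lambda)$$ if $1\leqslant r\leqslant p$, and $$\alpha_{\xi,r}\Bigl(\oplus_{\lambda\in\Lambda}A_\lambda:(\oplus_{\lambda\in\Lambda}X_\lambda)_{\ell_p(\Lambda)}\to(\oplus_{\lambda\in\Lambda}Y_\lambda)_{\ell_p(\Lambda)}\Bigr)^s=\sum_{\lambda\in\Lambda}\alpha_{\xi,r}(A_\lambda)^s$$ if $p<r\leqslant\infty$, where $1/r+1/s=1/p$. (Both sides may take the value $\infty$.)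
   Context: Conventions. $\mathbb{N}=\{1,2,\ldots\}$; $\mathbb{K}$ is the scalar field ($\mathbb{R}$ or $\mathbb{C}$); $B_X$ is the closed unit ball of $X$; operators are bounded and linear. $\oplus_\lambda A_\lambda$ is the diagonal operator $(x_\lambda)_\lambda\mapsto(A_\lambda x_\lambda)_\lambda$. Trees. Sequences are finite and non-empty; $s\leqslant t$ (resp. $s<t$) means $s$ is an initial segment (resp. proper initial segment) of $t$; $MAX(T)$ is the set of $\leqslant$-maximal members of $T$; $\frown$ is concatenation; for an ordinal $\zeta$ and a sequence of ordinals $t=(\zeta_j)_{j=1}^k$, $\zeta+t=(\zeta+\zeta_j)_{j=1}^k$, and $\zeta+G=\{\zeta+t:t\in G\}$. Define sets $\Gamma_{\xi,n}$ and functions $\mathbb{P}_{\xi,n}:\Gamma_{\xi,n}\to(0,1]$ recursively. $\Gamma_{0,1}=\{(0)\}$, $\mathbb{P}_{0,1}((0))=1$. Given $\Gamma_{\xi,1},\mathbb{P}_{\xi,1}$, for $n\in\mathbb{N}$ and $1\leqslant i\leqslant n$ let $\Lambda_{\xi,n,i}$ be the set of all $(\omega^\xi(n-1)+t_1)\frown\ldots\frown(\omega^\xi(n-i)+t_i)$ with $t_1,\ldots,t_{i-1}\in MAX(\Gamma_{\xi,1})$, $t_i\in\Gamma_{\xi,1}$; let $\Gamma_{\xi,n}=\bigcup_{i=1}^n\Lambda_{\xi,n,i}$, and let $\mathbb{P}_{\xi,n}$ take the value $\mathbb{P}_{\xi,1}(t_i)$ at the displayed sequence. $\Gamma_{\xi+1,1}=\bigcup_{n=1}^\infty\Gamma_{\xi,n}$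 (a disjoint union) and $\mathbb{P}_{\xi+1,1}|_{\Gamma_{\xi,n}}=n^{-1}\mathbb{P}_{\xi,n}$. If $\xi$ is a limit ordinal, $\Gamma_{\xi,1}=\bigcup_{\zeta<\xi}(\omega^\zeta+\Gamma_{\zeta+1,1})$ (a disjoint union) and $\mathbb{P}_{\xi,1}(\omega^\zeta+t)=\mathbb{P}_{\zeta+1,1}(t)$. For a directed set $D$, $\Gamma_{\xi,n}.D$ (resp. $\Lambda_{\xi,n,i}.D$) is the set of sequences $(\zeta_j,u_j)_{j=1}^k$ with $(\zeta_j)_{j=1}^k\in\Gamma_{\xi,n}$ (resp. $\Lambda_{\xi,n,i}$) and $u_j\in D$; put $\mathbb{P}_{\xi,n}((\zeta_j,u_j)_{j=1}^k)=\mathbb{P}_{\xi,n}((\zeta_j)_{j=1}^k)$. A collection $(x_t)_{t\in\Gamma_{\xi,n}.D}$ in a Banach space is weakly null if whenever $s\in\{\varnothing\}\cup\Gamma_{\xi,n}.D$ and an ordinal $\zeta$ are such that $s\frown(\zeta,u)\in\Gamma_{\xi,n}.D$ for $u\in D$, the net $(x_{s\frown(\zeta,u)})_{u\in D}$ is weakly null. For $t\in MAX(\Gamma_{\xi,n}.D)$ and $1\leqslant i\leqslant n$, $z_i^t=\sum_{t\geqslant s\in\Lambda_{\xi,n,i}.D}\mathbb{P}_{\xi,n}(s)x_s$. The quantities $\alpha$. For an operator $A:X\to Y$ and $1\leqslant r\leqslant\infty$, $\alpha_{\xi,r,n}(A)$ is the infimum of those $\alpha>0$ such that for any directed set $D$,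 any $(a_i)_{i=1}^n\in\mathbb{K}^n$ and any weakly null $(x_t)_{t\in\Gamma_{\xi,n}.D}\subset B_X$, $\inf_{t\in MAX(\Gamma_{\xi,n}.D)}\|A\sum_{i=1}^na_iz_i^t\|\leqslant\alpha\|(a_i)_{i=1}^n\|_{\ell_r^n}$; and $\alpha_{\xi,r}(A)=\sup_n\alpha_{\xi,r,n}(A)\in[0,\infty]$. *)

(* Defs.v *)
From HB Require Import structures.
From mathcomp Require Import all_boot all_order all_algebra.
From mathcomp Require Import complex.
From mathcomp Require Import all_classical all_reals all_analysis.
From mathcomp Require Import ring.

Set Implicit Arguments.
Unset Strict Implicit.
Unset Printing Implicit Defensive.

Import Order.TTheory GRing.Theory Num.Theory.
Import numFieldNormedType.Exports.

Local Open Scope classical_set_scope.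
Local Open Scope quotient_scope.
Local Open Scope ring_scope.

(* A term [PSup f] denotes the least ordinal strictly above every [f i];
   ordinals are these terms up to mutual comparison. *)
Inductive preord : Type := PSup (A : Type) (f : A -> preord).

Fixpoint ple (a b : preord) : Prop :=
  match a, b with
  | PSup A f, PSup B g => forall i : A, exists j : B, ple (f i) (g j)
  end.

Definition plt (a b : preord) : Prop :=
  match b with PSup B g => exists j : B, ple a (g j) end.

Definition pzero : preord := PSup (fun e : Empty_set => match e with end).

Definition psucc (a : preord) : preord := PSup (fun _ : unit => a).

(* a + b is the least ordinal that is >= a and > a + c for every c < b *)
Fixpoint padd (a b : preord) : preord :=
  match a, b with
  | PSup A f, PSup B g =>
      PSup (fun k : A + B => match k with inl i => f i | inr j => padd a (g j) end)
  end.

Definition pmuln (a : preord) (m : nat) : preord :=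
  iter m (fun b => padd b a) pzero.

(* omega ^ b is the least ordinal above 0 and all omega ^ c * m with c < b *)
Fixpoint pomega (b : preord) : preord :=
  match b with
  | PSup B g =>
      PSup (fun k : option (B * nat) =>
              match k with
              | None => pzero
              | Some (j, m) => pmuln (pomega (g j)) m
              end)
  end.

Lemma ple_refl a : ple a a.
Proof. by elim: a => A f IH /= i; exists i. Qed.

Lemma ple_trans b a c : ple a b -> ple b c -> ple a c.
Proof.
elim: b a c => B g IH [A f] [C h] /= ab bc i.
have [j fg] := ab i; have [k gh] := bc j.
by exists k; exact: IH fg gh.
Qed.

Lemma ple_plt_trans b a c : ple a b -> plt b c -> plt a c.
Proof. by case: c => C h ab [k bk]; exists k; exact: ple_trans ab bk. Qed.

Lemma plt_ple_trans b a c : plt a b -> ple b c -> plt a c.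
Proof.
case: b c => B g [C h] [j aj] bc; have [k gh] := bc j.
by exists k; exact: ple_trans aj gh.
Qed.

Lemma plt_ple a b : plt a b -> ple a b.
Proof.
elim: b a => B g IH [A f] [j aj] i; exists j => /=.
move: (IH j) aj; case: (g j) => C h IHj aj; apply: IHj.
by have [k fk] := aj i; exists k.
Qed.

Lemma plt_wf : well_founded plt.
Proof.
suff acc b a : ple a b -> Acc plt a by move=> a; exact: acc (ple_refl a).
elim: b a => B g IH [A f] ab; constructor => c [i ci].
by have [j fg] := ab i; exact: IH (ple_trans ci fg).
Qed.

Lemma padd_mono a a' b b' : ple a a' -> ple b b' -> ple (padd a b) (padd a' b').
Proof.
move=> aa'; elim: b b' => B g IH [B' g'].
case: a a' aa' IH => A f [A' f'] aa' IH /= bb' [i|j].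
  by have [i' h] := aa' i; exists (inl i').
by have [j' h] := bb' j; exists (inr j'); exact: IH h.
Qed.

Lemma pmuln_mono a a' m : ple a a' -> ple (pmuln a m) (pmuln a' m).
Proof. by move=> h; elim: m => [|m IH]; [exact: ple_refl|exact: padd_mono]. Qed.

Lemma pomega_mono b b' : ple b b' -> ple (pomega b) (pomega b').
Proof.
elim: b b' => B g IH [B' g'] /= bb' [[j m]|].
  by have [j' h] := bb' j; exists (Some (j', m)); apply/pmuln_mono/IH.
by exists None; case.
Qed.

HB.instance Definition _ := gen_eqMixin preord.
HB.instance Definition _ := gen_choiceMixin preord.

Definition peqv : rel preord := fun a b => `[< ple a b /\ ple b a >].

Lemma peqv_refl : reflexive peqv.
Proof. by move=> a; apply/asboolP; split; exact: ple_refl. Qed.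

Lemma peqv_sym : symmetric peqv.
Proof. by move=> a b; apply/asbool_equiv_eq; split=> -[]. Qed.

Lemma peqv_trans : transitive peqv.
Proof.
move=> b a c /asboolP[ab ba] /asboolP[bc cb].
by apply/asboolP; split; [exact: ple_trans ab bc|exact: ple_trans cb ba].
Qed.

Canonical peqv_equiv := EquivRel peqv peqv_refl peqv_sym peqv_trans.

Definition ord := {eq_quot peqv}%qT.
HB.instance Definition _ : EqQuotient _ peqv ord := EqQuotient.on ord.
HB.instance Definition _ := Choice.on ord.

Definition ole (a b : ord) : Prop := ple (repr a) (repr b).
Definition olt (a b : ord) : Prop := plt (repr a) (repr b).
Definition ozero : ord := \pi_ord pzero.
Definition osucc (a : ord) : ord := \pi_ord (psucc (repr a)).
Definition oadd (a b : ord) : ord := \pi_ord (padd (repr a) (repr b)).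
Definition omuln (a : ord) (m : nat) : ord := \pi_ord (pmuln (repr a) m).
Definition oomega (a : ord) : ord := \pi_ord (pomega (repr a)).

Definition olimit (a : ord) : Prop :=
  a <> ozero /\ forall b, olt b a -> olt (osucc b) a.

Lemma olt_wf : well_founded olt.
Proof.
suff acc b : Acc plt b -> forall a, repr a = b -> Acc olt a.
  by move=> a; exact: acc (plt_wf (repr a)) _ erefl.
by elim=> {}b _ IH a ab; constructor => c ca; apply: IH erefl; rewrite -ab.
Qed.

Lemma olt_trans b a c : olt a b -> olt b c -> olt a c.
Proof. by move=> ab /plt_ple; exact: plt_ple_trans. Qed.

Lemma repr_piK (a : preord) : ple (repr (\pi_ord a)) a /\ ple a (repr (\pi_ord a)).
Proof.
have : repr (\pi_ord a) = a %[mod ord] by rewrite reprK.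
by move/eqmodP => /asboolP.
Qed.

Lemma ord_eqP (a b : ord) : ole a b -> ole b a -> a = b.
Proof.
move=> ab ba; rewrite -[a]reprK -[b]reprK.
by apply/eqmodP/asboolP; split.
Qed.

Section sequences.
Variable T : Type.

Definition init_seg (s t : seq T) : Prop := exists u, t = s ++ u.

Definition MAX (G : set (seq T)) : set (seq T) :=
  [set t | G t /\ forall s, G s -> init_seg t s -> s = t].

End sequences.

Definition oshift (a : ord) (t : seq ord) : seq ord := [seq oadd a b | b <- t].

(* With ts = (t_1, .., t_i), this is
   (omega^xi (n-1) + t_1) ++ .. ++ (omega^xi (n-i) + t_i); the list index j is
   zero-based. *)
Definition blocks (xi : ord) (n : nat) (ts : seq (seq ord)) : seq ord :=
  flatten [seq oshift (omuln (oomega xi) (n - j.+1)) (nth [::] ts j)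
          | j <- iota 0 (size ts)].

(* [block_decomp G xi n i ts t]: t is the member of Lambda_{xi,n,i} displayed
   by ts = (t_1, .., t_i), where G stands for Gamma_{xi,1} *)
Definition block_decomp (G : set (seq ord)) (xi : ord) (n i : nat)
    (ts : seq (seq ord)) (t : seq ord) : Prop :=
  [/\ size ts = i,
      forall j, (j.+1 < i)%N -> MAX G (nth [::] ts j),
      G (nth [::] ts i.-1) &
      t = blocks xi n ts].

Definition Lambda_of (G : set (seq ord)) (xi : ord) (n i : nat) : set (seq ord) :=
  [set t | exists ts, block_decomp G xi n i ts t].

Definition Gamma_of (G : set (seq ord)) (xi : ord) (n : nat) : set (seq ord) :=
  [set t | exists2 i, (1 <= i <= n)%N & Lambda_of G xi n i t].

Definition Gamma1_step (xi : ord) (rec : forall z, olt z xi -> set (seq ord)) :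
    set (seq ord) :=
  [set t |
     [\/ xi = ozero /\ t = [:: ozero],
         exists z (zxi : olt z xi), xi = osucc z /\
           exists2 n, (1 <= n)%N & Gamma_of (rec z zxi) z n t |
         olimit xi /\ exists z (zxi : olt (osucc z) xi),
           exists2 s, rec (osucc z) zxi s & t = oshift (oomega z) s]].

Definition Gamma1 : ord -> set (seq ord) := Fix olt_wf _ Gamma1_step.

Definition Lambda (xi : ord) (n i : nat) := Lambda_of (Gamma1 xi) xi n i.
Definition Gamma (xi : ord) (n : nat) := Gamma_of (Gamma1 xi) xi n.

Section probabilities.
Variable R : realType.

(* The value prescribed by the recursion; it is unique because the unions and
   the displayed decompositions are disjoint. Outside of the tree it is junk. *)
Definition Prob_of (p : seq ord -> R) (xi : ord) (n : nat) (t : seq ord) : R :=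
  xget 0 [set v | exists i ts, [/\ (1 <= i <= n)%N,
    block_decomp (Gamma1 xi) xi n i ts t & v = p (nth [::] ts i.-1)]].

Definition Prob1_step (xi : ord) (rec : forall z, olt z xi -> seq ord -> R)
    (t : seq ord) : R :=
  xget 0 [set v |
     [\/ [/\ xi = ozero, t = [:: ozero] & v = 1],
         exists z (zxi : olt z xi), xi = osucc z /\
           exists n, [/\ (1 <= n)%N, Gamma z n t &
                         v = n%:R^-1 * Prob_of (rec z zxi) z n t] |
         olimit xi /\ exists z (zxi : olt (osucc z) xi) s,
           [/\ Gamma1 (osucc z) s, t = oshift (oomega z) s &
               v = rec (osucc z) zxi s]]].

Definition Prob1 : ord -> seq ord -> R := Fix olt_wf _ Prob1_step.

Definition Prob (xi : ord) (n : nat) : seq ord -> R := Prob_of (Prob1 xi) xi n.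

End probabilities.

Lemma Gamma1E xi : Gamma1 xi = Gamma1_step (fun z (_ : olt z xi) => Gamma1 z).
Proof.
rewrite /Gamma1 Fix_eq// => a f g fg; congr Gamma1_step.
by apply/functional_extensionality_dep => z; apply/funext => za; exact: fg.
Qed.

Lemma Prob1E (R : realType) xi :
  Prob1 R xi = @Prob1_step R xi (fun z (_ : olt z xi) => Prob1 R z).
Proof.
rewrite /Prob1 Fix_eq// => a f g fg; congr Prob1_step.
by apply/functional_extensionality_dep => z; apply/funext => za; exact: fg.
Qed.

Lemma plt_irrefl a : ~ plt a a.
Proof. by elim: (plt_wf a) => {}a _ IH aa; exact: (IH _ aa aa). Qed.

Lemma olt_osucc z : olt z (osucc z).
Proof.
have [_ h] := repr_piK (psucc (repr z)).
by apply: plt_ple_trans h; exists tt; exact: ple_refl.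
Qed.

Lemma osucc_le z a : olt z a -> ole (osucc z) a.
Proof.
move=> za; apply: ple_trans (repr_piK _).1 _.
by move: za; rewrite /olt; case: (repr a) => A f [i zi] /= _; exists i.
Qed.

Lemma lt_osucc a z : olt a (osucc z) -> ole a z.
Proof. by move=> /plt_ple_trans /(_ (repr_piK _).1) []. Qed.

Lemma osucc_inj : injective osucc.
Proof.
by move=> a b ab; apply: ord_eqP; apply: lt_osucc; [rewrite -ab|rewrite ab];
  exact: olt_osucc.
Qed.

Lemma olt0 a : ~ olt a ozero.
Proof. by move=> /plt_ple_trans /(_ (repr_piK _).1) []. Qed.

Lemma osucc_neq0 a : osucc a <> ozero.
Proof. by move=> a0; apply: (@olt0 a); rewrite -a0; exact: olt_osucc. Qed.

Lemma osucc_nlimit a : ~ olimit (osucc a).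
Proof. by move=> [_ /(_ a (olt_osucc a))]; exact: plt_irrefl. Qed.

Lemma Gamma1_0 : Gamma1 ozero = [set [:: ozero]].
Proof.
rewrite Gamma1E; apply/seteqP; split => t /=; last by move=> ->; apply: Or31.
case=> [[//]|[z [zxi _]]|[[]//]].
by have := olt0 zxi.
Qed.

Lemma Gamma1_succ z :
  Gamma1 (osucc z) = [set t | exists2 n, (1 <= n)%N & Gamma z n t].
Proof.
rewrite Gamma1E; apply/seteqP; split => t /=.
  case=> [[/osucc_neq0]|[y [yz [/osucc_inj <-]]]|[/osucc_nlimit]] //.
by move=> h; apply: Or32; exists z, (olt_osucc z).
Qed.

Lemma Gamma1_limit xi : olimit xi ->
  Gamma1 xi = [set t | exists2 z, olt z xi &
    exists2 s, Gamma1 (osucc z) s & t = oshift (oomega z) s].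
Proof.
move=> lxi; rewrite Gamma1E; apply/seteqP; split => t /=.
  case=> [[x0]|[y [yz [xy _]]]|[_ [z [zxi h]]]].
  - by case: lxi.
  - by rewrite xy in lxi; case: (osucc_nlimit lxi).
  - by exists z => //; exact: olt_trans (olt_osucc z) zxi.
by move=> [z zxi h]; apply: Or33; split => //; exists z, (lxi.2 _ zxi).
Qed.

Inductive scalar_kind := RealScalars | ComplexScalars.

Section lp.
Variable R : realType.

Definition scalars (k : scalar_kind) : numFieldType :=
  match k with RealScalars => R | ComplexScalars => R[i] end.

Definition to_real (k : scalar_kind) : scalars k -> R :=
  match k with RealScalars => id | ComplexScalars => @complex.Re R end.

Definition of_real (k : scalar_kind) : R -> scalars k :=
  match k with RealScalars => id | ComplexScalars => fun x => real_complex R x end.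

(* norms in a normed module over [scalars k] are (nonnegative real) elements of
   [scalars k] *)
Definition rnorm (k : scalar_kind) (V : normedZmodType (scalars k)) (v : V) : R :=
  to_real `|v|.

Definition lp_norm (I : finType) (p : \bar R) (v : I -> R) : R :=
  match p with
  | q%:E => (\sum_i `|v i| `^ q) `^ q^-1
  | +oo%E => \big[Num.max/0]_i `|v i|
  | -oo%E => 0
  end.

End lp.
Arguments of_real {R} k _.

Section scalar_theory.
Variables (R : realType) (k : scalar_kind).
Local Notation K := (scalars R k).
Local Notation of_real := (@of_real R k).

Lemma of_realK : cancel of_real (@to_real R k).
Proof. by rewrite /of_real /to_real; case: k. Qed.

Lemma of_real0 : of_real 0 = 0.
Proof. by rewrite /of_real; case: k. Qed.

Lemma of_realD x y : of_real (x + y) = of_real x + of_real y.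
Proof. by rewrite /of_real; case: k => //; exact: rmorphD. Qed.

Lemma of_realM x y : of_real (x * y) = of_real x * of_real y.
Proof. by rewrite /of_real; case: k => //; exact: rmorphM. Qed.

Lemma ler_of_real x y : (of_real x <= of_real y) = (x <= y).
Proof. by rewrite /of_real; case: k => //; exact: lecR. Qed.

Lemma ltr_of_real x y : (of_real x < of_real y) = (x < y).
Proof. by rewrite /of_real; case: k => //; exact: ltcR. Qed.

Lemma to_realK (z : K) : 0 <= z -> of_real (to_real z) = z.
Proof.
rewrite /of_real /to_real; move: z; case: k => // -[a b] /=.
by rewrite lecE/= => /andP[/eqP -> _].
Qed.

Lemma of_real_rnorm (V : normedZmodType K) (v : V) : of_real (rnorm v) = `|v|.
Proof. exact: to_realK. Qed.

Lemma rnorm_ge0 (V : normedZmodType K) (v : V) : 0 <= rnorm v.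
Proof. by rewrite -ler_of_real of_real_rnorm of_real0. Qed.

Lemma rnormD (V : normedZmodType K) (u v : V) :
  rnorm (u + v) <= rnorm u + rnorm v.
Proof. by rewrite -ler_of_real of_realD !of_real_rnorm ler_normD. Qed.

Lemma rnorm0_eq0 (V : normedZmodType K) (v : V) : rnorm v = 0 -> v = 0.
Proof.
by move=> v0; apply/normr0_eq0; rewrite -of_real_rnorm v0 of_real0.
Qed.

Lemma rnormZ (V : normedModType K) (c : K) (v : V) :
  rnorm (c *: v) = rnorm (c : K) * rnorm v.
Proof.
by apply: (can_inj of_realK); rewrite of_realM !of_real_rnorm normrZ.
Qed.

End scalar_theory.

Section lp_theory.
Variables (R : realType) (I : finType) (p : \bar R).
Hypothesis p1 : (1 <= p)%E.
Implicit Types v w : I -> R.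

Lemma lp_norm_ge0 v : 0 <= lp_norm p v.
Proof.
case: p => [q| |] //=; first exact: powR_ge0.
by elim/big_ind : _ => // x y x0 y0; rewrite le_max x0.
Qed.

Lemma lp_normZ a v : 0 <= a -> lp_norm p (fun i => a * v i) = a * lp_norm p v.
Proof.
move=> a0; case: p p1 => [q|_|] //=; last first.
  rewrite (big_morph ( *%R a) (id1 := 0) (op1 := Num.max)) ?mulr0//.
    by apply: eq_bigr => i _; rewrite normrM ger0_norm.
  by move=> x y; rewrite maxr_pMr.
rewrite lee_fin => q1; have q0 : q != 0 by rewrite gt_eqF// (lt_le_trans _ q1).
under eq_bigr do rewrite normrM (ger0_norm a0) powRM//.
rewrite -mulr_sumr powRM ?powR_ge0 ?sumr_ge0//.
by rewrite -powRrM divff// powRr1.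
Qed.

Lemma lp_norm_le v w : (forall i, `|v i| <= `|w i|) -> lp_norm p v <= lp_norm p w.
Proof.
case: p p1 => [q|_|_] /=; last by move=> _; exact: lexx.
  rewrite lee_fin => q1; have q0 : 0 <= q by rewrite (le_trans _ q1).
  have s0 (u : I -> R) : \sum_i `|u i| `^ q \in Num.nneg.
    by rewrite nnegrE sumr_ge0// => i _; exact: powR_ge0.
  have qi0 : 0 <= q^-1 by rewrite invr_ge0.
  have n0 (x : R) : `|x| \in Num.nneg by rewrite nnegrE.
  move=> vw; apply: (ge0_ler_powR qi0 (s0 _) (s0 _)).
  by apply: ler_sum => i _; exact: (ge0_ler_powR q0 (n0 _) (n0 _) (vw i)).
have m0 : 0 <= \big[Num.max/0]_i `|w i|.
  by elim/big_ind : _ => // x y x0 y0; rewrite le_max x0.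
move=> vw; apply/bigmax_leP; split; [exact: m0|move=> i _].
by rewrite (le_trans (vw i))// (le_bigmax _ (fun i => `|w i|)).
Qed.

Lemma lp_norm_coord v i : `|v i| <= lp_norm p v.
Proof.
case: p p1 => [q|_|] //=; last exact: (le_bigmax _ (fun i => `|v i|)).
rewrite lee_fin => q1; have q0 : 0 < q by rewrite (lt_le_trans _ q1).
rewrite -[leLHS](powRr1 (normr_ge0 _)) -(divff (lt0r_neq0 q0)) powRrM.
have v0 j : 0 <= `|v j| `^ q by exact: powR_ge0.
apply: ge0_ler_powR; rewrite ?invr_ge0 ?nnegrE// ?sumr_ge0// ?(ltW q0)//.
by rewrite (bigD1 i)//= lerDl sumr_ge0.
Qed.

Lemma lp_norm_eq0 v : lp_norm p v = 0 -> forall i, v i = 0.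
Proof.
by move=> v0 i; apply/normr0_eq0/le_anti; rewrite normr_ge0 -[X in _ <= X]v0 lp_norm_coord.
Qed.

Lemma lp_normD v w : lp_norm p (fun i => v i + w i) <= lp_norm p v + lp_norm p w.
Proof.
have [v0|v0] := eqVneq (lp_norm p v) 0.
  by rewrite v0 add0r lp_norm_le// => i; rewrite (lp_norm_eq0 v0) add0r.
have [w0|w0] := eqVneq (lp_norm p w) 0.
  by rewrite w0 addr0 lp_norm_le// => i; rewrite (lp_norm_eq0 w0) addr0.
have {}v0 : 0 < lp_norm p v by rewrite lt_neqAle eq_sym v0 lp_norm_ge0.
have {}w0 : 0 < lp_norm p w by rewrite lt_neqAle eq_sym w0 lp_norm_ge0.
case: p p1 v0 w0 => [q|_ _ _|] //=; last first.
  apply: bigmax_le => [|i _].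
    by rewrite addr_ge0// -/(lp_norm +oo%E _) /=;
      elim/big_ind : _ => // x y x0 y0; rewrite le_max x0.
  by rewrite (le_trans (ler_normD _ _))// lerD//; [exact: (le_bigmax _ (fun i => `|v i|))|exact: (le_bigmax _ (fun i => `|w i|))].
rewrite lee_fin => q1.
have q0 : 0 < q by rewrite (lt_le_trans _ q1).
have sE (u : I -> R) : \sum_i `|u i| `^ q = ((\sum_i `|u i| `^ q) `^ q^-1) `^ q.
  by rewrite -powRrM mulVf ?gt_eqF// powRr1// sumr_ge0// => i _; exact: powR_ge0.
move: (sE v) (sE w).
move: ((\sum_i `|v i| `^ q) `^ q^-1) ((\sum_i `|w i| `^ q) `^ q^-1).
move=> a b va wb a0 b0.
have ab0 : 0 < a + b by exact: addr_gt0.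
suff : \sum_i `|v i + w i| `^ q <= (a + b) `^ q.
  move=> h; rewrite -[leRHS](powRr1 (ltW ab0)) -(divff (lt0r_neq0 q0)) powRrM.
  apply: ge0_ler_powR => //; rewrite ?invr_ge0 ?nnegrE ?(ltW q0) ?powR_ge0//.
  by rewrite sumr_ge0// => i _; exact: powR_ge0.
have t01 : 0 <= a / (a + b) <= 1.
  by rewrite divr_ge0 ?(ltW a0) ?(ltW ab0)//= ler_pdivrMr// mul1r lerDl (ltW b0).
pose t := Itv01 (andP t01).1 (andP t01).2.
have tE : t%:num = a / (a + b) by [].
have t'E : unstable.onem t%:num = b / (a + b).
  by rewrite tE /unstable.onem; field; rewrite gt_eqF.
have sum1 (u : I -> R) (c : R) : 0 < c -> \sum_i `|u i| `^ q = c `^ q ->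
    \sum_i (`|u i| / c) `^ q = 1.
  move=> c0 uc; have cq0 : c `^ q != 0 by rewrite gt_eqF// powR_gt0.
  apply: (mulfI cq0); rewrite mulr1 -[RHS]uc mulr_sumr; apply: eq_bigr => i _.
  have uc0 : 0 <= `|u i| / c by rewrite divr_ge0// ltW.
  by rewrite -(powRM _ (ltW c0) uc0) mulrCA divff ?mulr1// gt_eqF.
have step i : `|v i + w i| `^ q <=
    (a + b) `^ q * (a / (a + b) * (`|v i| / a) `^ q +
                    b / (a + b) * (`|w i| / b) `^ q).
  have vi0 : 0 <= `|v i| / a by rewrite divr_ge0// ltW.
  have wi0 : 0 <= `|w i| / b by rewrite divr_ge0// ltW.
  have := @convex_powR R q q1 t (`|v i| / a) (`|w i| / b).
  rewrite !inE /= !in_itv/= !andbT => /(_ vi0 wi0) h.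
  rewrite [X in X `^ _ <= _]convRE [X in _ <= X]convRE tE t'E in h.
  apply: le_trans (ler_wpM2l (powR_ge0 (a + b) q) h).
  have inner0 : 0 <= a / (a + b) * (`|v i| / a) + b / (a + b) * (`|w i| / b).
    by rewrite addr_ge0// mulr_ge0// divr_ge0// ltW.
  rewrite -(powRM _ (ltW ab0) inner0).
  have -> : (a + b) * (a / (a + b) * (`|v i| / a) + b / (a + b) * (`|w i| / b))
      = `|v i| + `|w i|.
    by field; rewrite !gt_eqF.
  apply: (ge0_ler_powR (ltW q0)); rewrite ?nnegrE ?addr_ge0//.
  exact: ler_normD.
apply: le_trans (ler_sum _ (fun i _ => step i)) _.
rewrite -mulr_sumr big_split/= -!mulr_sumr (sum1 v)// (sum1 w)//.
by rewrite !mulr1 -mulrDl divff ?gt_eqF// mulr1.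
Qed.


End lp_theory.

(* The exponent and the proof that it is at least 1 are kept as parameters of
   the type because its norm depends on them. *)
Definition lp_sum (R : realType) (k : scalar_kind) (p : \bar R)
    (p1 : (1 <= p)%E) (L : finType)
    (X : L -> completeNormedModType (scalars R k)) : Type := forall l, X l.

Section lp_sum.
Variables (R : realType) (k : scalar_kind) (p : \bar R) (p1 : (1 <= p)%E).
Variables (L : finType) (X : L -> completeNormedModType (scalars R k)).
Local Notation K := (scalars R k).
Local Notation of_real := (@of_real R k).
Local Notation V := (lp_sum p1 X).
Implicit Types (x y z : V) (c : K).

HB.instance Definition _ := gen_eqMixin V.
HB.instance Definition _ := gen_choiceMixin V.

Let add x y : V := fun l => x l + y l.
Let opp x : V := fun l => - x l.
Let scale c x : V := fun l => c *: x l.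

Let addA : associative add.
Proof. by move=> x y z; apply/functional_extensionality_dep => l; exact: addrA. Qed.
Let addC : commutative add.
Proof. by move=> x y; apply/functional_extensionality_dep => l; exact: addrC. Qed.
Let add0 : left_id (fun l => 0) add.
Proof. by move=> x; apply/functional_extensionality_dep => l; exact: add0r. Qed.
Let addN : left_inverse (fun l => 0) opp add.
Proof. by move=> x; apply/functional_extensionality_dep => l; exact: addNr. Qed.

HB.instance Definition _ := GRing.isZmodule.Build V addA addC add0 addN.

Let scaleA c d x : scale c (scale d x) = scale (c * d) x.
Proof. by apply/functional_extensionality_dep => l; exact: scalerA. Qed.
Let scale1 : left_id 1 scale.
Proof. by move=> x; apply/functional_extensionality_dep => l; exact: scale1r. Qed.
Let scaleDr : right_distributive scale +%R.
Proof. by move=> c x y; apply/functional_extensionality_dep => l; exact: scalerDr. Qed.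
Let scaleDl x : {morph scale^~ x : c d / c + d}.
Proof. by move=> c d; apply/functional_extensionality_dep => l; exact: scalerDl. Qed.

HB.instance Definition _ :=
  GRing.Zmodule_isLmodule.Build K V scaleA scale1 scaleDr scaleDl.

Let norm x : K := of_real (lp_norm p (fun l => rnorm (x l))).

Let normD x y : norm (x + y) <= norm x + norm y.
Proof.
rewrite /norm -of_realD ler_of_real.
apply: le_trans (lp_normD p1 _ _); apply: lp_norm_le => // l.
by rewrite !ger0_norm ?addr_ge0 ?rnorm_ge0//; exact: rnormD.
Qed.

Let normZ c x : norm (c *: x) = `|c| * norm x.
Proof.
rewrite /norm -(of_real_rnorm (c : K)) -of_realM -lp_normZ ?rnorm_ge0//.
by congr (of_real (lp_norm p _)); apply/funext => l; exact: rnormZ.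
Qed.

Let norm0_eq0 x : norm x = 0 -> x = 0.
Proof.
rewrite /norm -(of_real0 R k) => /(can_inj (@of_realK R k)) x0.
apply/functional_extensionality_dep => l.
by apply: rnorm0_eq0; exact: (lp_norm_eq0 p1 x0 l).
Qed.

HB.instance Definition _ := Lmodule_isNormed.Build K V normD normZ norm0_eq0.

Lemma lp_sum_normE x : `|x| = of_real (lp_norm p (fun l => rnorm (x l))).
Proof. by []. Qed.

Lemma lp_sum_coord x l : `|x l| <= `|x|.
Proof.
rewrite lp_sum_normE -of_real_rnorm ler_of_real.
have := lp_norm_coord p1 (fun l => rnorm (x l)) l.
by rewrite ger0_norm// rnorm_ge0.
Qed.

Let complete (F : set_system V) : ProperFilter F -> cauchy F -> cvg F.
Proof.
move=> FF /cauchy_ballP Fc; apply/cvg_ex.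
have Fl l : cvg ((fun x : V => x l) @ F).
  apply: cauchy_cvg; apply/cauchy_ballP => e e0.
  have [[P Q] /= [FP FQ] PQ] := Fc e e0.
  exists ([set x l | x in P], [set x l | x in Q]) => /=.
    by split; [move: FP|move: FQ]; apply: filterS => x ?; exists x.
  move=> [_ _] /= [[x Px <-] [z Qz <-]].
  have : ball x e z by exact: (PQ (x, z)).
  by rewrite -!ball_normE /ball_/= => /(le_lt_trans _); apply; exact: (lp_sum_coord (x - z) l).
pose y : V := fun l => lim ((fun x : V => x l) @ F).
exists y; apply/cvgrPdist_le => e e0.
pose C := lp_norm p (fun _ : L => 1 : R) + 1.
have C0 : 0 < C by rewrite ltr_wpDl// lp_norm_ge0.
have e0' : 0 < to_real e by rewrite -(ltr_of_real k) of_real0 to_realK// ltW.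
have d0 : 0 < of_real (to_real e / C) by rewrite -(of_real0 R k) ltr_of_real divr_gt0.
have near_y l : \forall x \near F, `|y l - (x : V) l| <= of_real (to_real e / C).
  by move/cvgrPdist_le : (Fl l) => /(_ _ d0).
have Fy := filter_forall _ near_y.
apply: filterS (Fy _) => x yx.
rewrite lp_sum_normE -(to_realK (ltW e0)) ler_of_real.
have eC0 : 0 <= to_real e / C by rewrite divr_ge0// ltW.
apply: (@le_trans _ _ (lp_norm p (fun _ : L => to_real e / C * 1))).
  apply: lp_norm_le => // l.
  rewrite mulr1 (ger0_norm (rnorm_ge0 _)) (ger0_norm eC0).
  by rewrite -(ler_of_real k) of_real_rnorm; exact: yx.
rewrite lp_normZ// [leLHS]mulrAC ler_pdivrMr// ler_pM2l//.
by rewrite /C lerDl.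
Qed.

HB.instance Definition _ := Uniform_isComplete.Build V complete.

End lp_sum.

Section diag.
Variables (R : realType) (k : scalar_kind) (p : \bar R) (p1 : (1 <= p)%E).
Variables (L : finType) (X Y : L -> completeNormedModType (scalars R k)).
Variable A : forall l, {linear X l -> Y l}.

Definition lp_diag (x : lp_sum p1 X) : lp_sum p1 Y := fun l => A l (x l).

Let lp_diag_linear : linear lp_diag.
Proof.
by move=> c x y; apply/functional_extensionality_dep => l; exact: linearP.
Qed.

HB.instance Definition _ := GRing.isLinear.Build (scalars R k)
  (lp_sum p1 X) (lp_sum p1 Y) _ lp_diag lp_diag_linear.

End diag.
Arguments lp_diag {R k p} p1 {L X Y} A x.

Definition directed_set (D : Type) (leD : D -> D -> Prop) : Prop :=
  [/\ inhabited D, (forall u, leD u u),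
      (forall u v w, leD u v -> leD v w -> leD u w) &
      (forall u v, exists w, leD u w /\ leD v w)].

(* the filter along which nets indexed by D converge *)
Definition net_tails (D : Type) (leD : D -> D -> Prop) : set_system D :=
  [set B | exists u, forall v, leD u v -> B v].

Section product_trees.
Variable D : Type.

Definition GammaD (xi : ord) (n : nat) : set (seq (ord * D)) :=
  [set t | Gamma xi n (unzip1 t)].

Definition LambdaD (xi : ord) (n i : nat) : set (seq (ord * D)) :=
  [set t | Lambda xi n i (unzip1 t)].

End product_trees.

Section alpha.
Variables (R : realType) (k : scalar_kind).
Local Notation K := (scalars R k).

Definition weakly_null_net (D : Type) (leD : D -> D -> Prop)
    (X : normedModType K) (x : D -> X) : Prop :=
  forall f : {linear X -> K^o}, continuous f -> f (x u) @[u --> net_tails leD] --> 0.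

Definition weakly_null_tree (xi : ord) (n : nat) (D : Type)
    (leD : D -> D -> Prop) (X : normedModType K) (x : seq (ord * D) -> X) : Prop :=
  forall (s : seq (ord * D)) (z : ord), s = [::] \/ GammaD xi n s ->
    (forall u, GammaD xi n (rcons s (z, u))) ->
    weakly_null_net leD (fun u => x (rcons s (z, u))).

(* z_i^t; the sum runs over the nonempty initial segments [take j t] of t *)
Definition block_sum (xi : ord) (n : nat) (D : Type) (X : normedModType K)
    (x : seq (ord * D) -> X) (i : nat) (t : seq (ord * D)) : X :=
  \sum_(1 <= j < (size t).+1 | `[< LambdaD xi n i (take j t) >])
    of_real k (Prob R xi n (unzip1 (take j t))) *: x (take j t).

Variables (X Y : completeNormedModType K).

(* [block_sum] is indexed from 1, while i ranges over 0, ..., n-1 *)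
Definition alpha_n (xi : ord) (r : \bar R) (n : nat) (A : {linear X -> Y}) : \bar R :=
  ereal_inf [set a%:E | a in [set a : R | 0 < a /\
    forall (D : Type) (leD : D -> D -> Prop), directed_set leD ->
    forall (c : 'I_n -> K) (x : seq (ord * D) -> X),
      weakly_null_tree xi n leD x ->
      (forall t, GammaD xi n t -> `|x t| <= 1) ->
      (ereal_inf [set (rnorm (A (\sum_(i < n) c i *: block_sum xi n x i.+1 t)))%:E
                 | t in MAX (@GammaD D xi n)]
       <= (a * lp_norm r (fun i => rnorm (c i)))%:E)%E]].

Definition alpha (xi : ord) (r : \bar R) (A : {linear X -> Y}) : \bar R :=
  ereal_sup [set alpha_n xi r n A | n in [set n | (1 <= n)%N]].

End alpha.

(* Main.v *)
(* The quantities [alpha] are recast as a game. For a filter [F] of moves, [Q F xi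
   P] says that a player who chooses the branch of Gamma_{xi,1} and, at each node,
   a member of [F], from which the opponent picks the next vector, can force the
   block vector sum_{s <= t} P_{xi,1}(s) x_s into [P]. A winning strategy picks a
   good branch in every weakly null tree, and a strategy of the opponent is a
   weakly null tree indexed by the weak neighbourhoods of 0; hence alpha_{xi,r}(A)
   <= a iff for all coefficients (a_i) and all b > a ||(a_i)||_r the player forces
   ||A sum_i a_i z_i|| < b in the iterated game over the unit ball with its weak
   neighbourhoods of 0 ([alpha_leP]).

   Two properties of [Q] replace the usual passage to subtrees. First, two convex
   sets which can be forced separately can be forced simultaneously ([Q_and]): a
   game of n blocks can be prolonged to one of kn blocks, since averages over the
   consecutive groups of n blocks stay in the convex set. Second, if a convex set
   [E] can be forced, then in the game where the moves are weighted by their norms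
   the player forces z to be close to c E, with c the average norm of the moves
   ([Q_fat]).

   Upper bound: in the direct sum, the block vectors are z_i^l ~ c_i^l e_i^l with
   (c_i^l)_l in the unit ball of l_p, and by [Q_and] the e_i^l can be chosen good
   for all scalings d_i in a finite grid of [0,1] at once; this gives ||A_l sum_i
   a_i z_i^l|| <= alpha(A_l) ||(a_i c_i^l)_i||_r + eps for every l, and one
   concludes by Minkowski's inequality (r <= p) or Hoelder's (p < r). Lower bound:
   concatenate, over l, almost optimal coefficients for the A_l, with weights
   giving equality in Hoelder's inequality. *)
From HB Require Import structures.
Require Import Defs.
From mathcomp Require Import all_boot all_order all_algebra.
From mathcomp Require Import all_classical all_reals all_analysis.
From mathcomp Require Import ring lra.
Import Order.TTheory GRing.Theory Num.Theory.
Import numFieldNormedType.Exports.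
Local Open Scope classical_set_scope.
Local Open Scope ring_scope.

Set Implicit Arguments.
Unset Strict Implicit.
Unset Printing Implicit Defensive.

(** * Ordinals *)

Lemma ple_total a b : ple a b \/ plt b a.
Proof.
elim: a b => A f IH b; have [|/existsNP[i fi]] := pselect (forall i, plt (f i) b).
  by move=> h; left; case: b h => B g h i; exact: h.
right; exists i; case: b fi => B g fi.
have gf j : plt (g j) (f i).
  by have [fg|//] := IH i (g j); case: fi; exists j.
by case: (f i) gf.
Qed.

Lemma ple_padd_id a b : ple a (padd a b).
Proof. by case: a b => A f [B g] i; exists (inl i); exact: ple_refl. Qed.

Lemma padd_plt a b c : plt b c -> plt (padd a b) (padd a c).
Proof.
by case: a c => A f [C h] [j bj]; exists (inr j); apply: padd_mono => //; exact: ple_refl.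
Qed.

Lemma padd0 a : ple (padd a pzero) a.
Proof. by case: a => A f [i|[]]; exists i; exact: ple_refl. Qed.

Lemma padd_assoc a b c : ple (padd a (padd b c)) (padd (padd a b) c).
Proof.
elim: c => C h IH; case: a b IH => A f [B g] IH [i|[j|k]].
- by exists (inl (inl i)); exact: ple_refl.
- by exists (inl (inr j)); exact: ple_refl.
- by exists (inr k); exact: IH.
Qed.

Lemma ple0_padd a : ple a (padd pzero a).
Proof. by elim: a => A f IH i; exists (inr i); exact: IH. Qed.

Lemma padd_pmuln a m : ple (padd a (pmuln a m)) (pmuln a m.+1).
Proof.
elim: m => [|m IH].
  exact: ple_trans (padd0 _) (ple0_padd _).
by apply: ple_trans (padd_assoc _ _ _) _; apply: padd_mono IH (ple_refl _).
Qed.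

Lemma pmuln_leq a m n : (m <= n)%N -> ple (pmuln a m) (pmuln a n).
Proof.
move=> /subnK <-; elim: (n - m)%N => [|d IH]; first exact: ple_refl.
exact: ple_trans IH (ple_padd_id _ _).
Qed.

Lemma pmuln_pomega z m : ple (pmuln (pomega z) m) (pomega (psucc z)).
Proof. by apply: plt_ple; exists (Some (tt, m)); exact: ple_refl. Qed.

(** The left side is the least ordinal above all ordinals below omega^z and all omega^z + omega^z m;
    the latter are at most omega^z (m+1) and so stay below omega^(z+1). *)
Lemma padd_pomega z : ple (padd (pomega z) (pomega (psucc z))) (pomega (psucc z)).
Proof.
have h0 : ple (pomega z) (pmuln (pomega z) 1).
  exact: ple_trans (ple_padd_id _ pzero) (padd_pmuln _ 0).
have E B (g : B -> preord) c : ple (padd c (PSup g)) (pomega (psucc z)) <->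
    (forall i, plt i c -> plt i (pomega (psucc z))) /\
    forall j, plt (padd c (g j)) (pomega (psucc z)).
  split=> [h|[h1 h2]].
    split=> [i ic|j]; last first.
      by apply: plt_ple_trans h; apply: padd_plt; exists j; exact: ple_refl.
    by apply: plt_ple_trans h; apply: plt_ple_trans ic (ple_padd_id _ _).
  case: c h1 h2 => C f h1 h2 [i|j]; last exact: h2.
  by apply: h1; exists i; exact: ple_refl.
have lt m : plt (pmuln (pomega z) m) (pomega (psucc z)).
  by exists (Some (tt, m)); exact: ple_refl.
apply/E; split=> [i iz|[[[] m]|]].
- by apply: plt_ple_trans iz _; apply: plt_ple; apply: ple_plt_trans h0 (lt _).
- exact: ple_plt_trans (padd_pmuln _ m) (lt _).
- by apply: ple_plt_trans (padd0 _) _; apply: ple_plt_trans h0 (lt _).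
Qed.

Lemma olt_irrefl a : ~ olt a a.
Proof. exact: plt_irrefl. Qed.

Lemma ole_olt_trans b a c : ole a b -> olt b c -> olt a c.
Proof. exact: ple_plt_trans. Qed.

Lemma olt_ole_trans b a c : olt a b -> ole b c -> olt a c.
Proof. exact: plt_ple_trans. Qed.

Lemma ole_trans b a c : ole a b -> ole b c -> ole a c.
Proof. exact: ple_trans. Qed.

Lemma ole_total a b : ole a b \/ olt b a.
Proof. exact: ple_total. Qed.

Lemma olt_total a b : [\/ olt a b, a = b | olt b a].
Proof.
have [ab|] := ole_total a b; last by move=> ?; apply: Or33.
have [ba|] := ole_total b a; last by move=> ?; apply: Or31.
by apply: Or32; exact: ord_eqP.
Qed.

Lemma olt_oadd a b c : olt b c -> olt (oadd a b) (oadd a c).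
Proof.
move=> bc; apply: ple_plt_trans (repr_piK _).1 _.
by apply: plt_ple_trans (repr_piK _).2; exact: padd_plt.
Qed.

Lemma ole_oadd a b : ole a (oadd a b).
Proof. exact: ple_trans (ple_padd_id _ _) (repr_piK _).2. Qed.

Lemma oadd_inj a : injective (oadd a).
Proof.
move=> b c abc; case: (olt_total b c) => // /(olt_oadd a); rewrite abc;
  by move/olt_irrefl.
Qed.

Lemma omuln_leq a m n : (m <= n)%N -> ole (omuln a m) (omuln a n).
Proof.
move=> mn; apply: ple_trans (repr_piK _).1 _; apply: ple_trans (repr_piK _).2.
exact: pmuln_leq.
Qed.

Lemma oadd_omuln a m : oadd (omuln a m) a = omuln a m.+1.
Proof.
apply: ord_eqP; apply: ple_trans (repr_piK _).1 _; apply: ple_trans (repr_piK _).2;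
  by apply: padd_mono (ple_refl _); case: (repr_piK (pmuln (repr a) m)).
Qed.

Lemma omuln_oomega z m : ole (omuln (oomega z) m) (oomega (osucc z)).
Proof.
apply: ple_trans (repr_piK _).1 _; apply: ple_trans (repr_piK _).2.
apply: ple_trans (pmuln_mono _ (repr_piK _).1) _.
by apply: ple_trans (pmuln_pomega _ _) _; apply: pomega_mono; exact: (repr_piK _).2.
Qed.

Lemma oadd_oomega z : ole (oadd (oomega z) (oomega (osucc z))) (oomega (osucc z)).
Proof.
have h : ple (repr (oomega (osucc z))) (pomega (psucc (repr z))).
  by apply: ple_trans (repr_piK _).1 _; apply: pomega_mono; exact: (repr_piK _).1.
apply: ple_trans (repr_piK _).1 _; apply: ple_trans (padd_mono (repr_piK _).1 h) _.
apply: ple_trans (padd_pomega _) _; apply: ple_trans (repr_piK _).2.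
by apply: pomega_mono; exact: (repr_piK _).2.
Qed.

Lemma ole_oomega a b : ole a b -> ole (oomega a) (oomega b).
Proof.
move=> ab; apply: ple_trans (repr_piK _).1 _; apply: ple_trans (repr_piK _).2.
exact: pomega_mono.
Qed.

Lemma olt0_oomega a : olt ozero (oomega a).
Proof.
apply: ple_plt_trans (repr_piK _).1 _; apply: plt_ple_trans (repr_piK _).2.
by case: (repr a) => A f; exists None; exact: ple_refl.
Qed.

Lemma ord_cases a : [\/ a = ozero, exists b, a = osucc b | olimit a].
Proof.
have [->|a0] := pselect (a = ozero); first by apply: Or31.
have [h|/existsNP[b /not_implyP[ba nba]]] :=
  pselect (forall b, olt b a -> olt (osucc b) a); first by apply: Or33.
apply: Or32; exists b; apply: ord_eqP; last exact: osucc_le.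
by have [|//] := ole_total a (osucc b).
Qed.

(** * The trees Gamma_{xi,n} *)

Section initial_segments.
Variable T : Type.
Implicit Types (s t u v : seq T) (G H : set (seq T)).

Lemma init_seg_cat s t : init_seg s (s ++ t).
Proof. by exists t. Qed.

Lemma init_seg_comparable s t u v : s ++ u = t ++ v -> init_seg s t \/ init_seg t s.
Proof.
elim: s t => [|x s IH] [|y t] /=; [by left; exists [::]|by left; exists (y :: t)|by right; exists (x :: s)|].
by case=> -> /IH[[w ->]|[w ->]]; [left|right]; exists w.
Qed.

Lemma MAX_cat G g u : MAX G g -> G (g ++ u) -> u = [::].
Proof.
move=> [_ gm] /gm /(_ (init_seg_cat _ _)).
by rewrite -{2}[g]cats0 => /(congr1 (drop (size g))); rewrite !drop_size_cat.
Qed.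

Lemma MAX_eq G g g' u u' : MAX G g -> MAX G g' -> g ++ u = g' ++ u' -> g = g' /\ u = u'.
Proof.
move=> gm gm' e; have gg' : g = g'.
  case: (init_seg_comparable e) => h; first by rewrite (gm.2 _ gm'.1 h).
  by rewrite (gm'.2 _ gm.1 h).
split=> //; move: e; rewrite gg' => /(congr1 (drop (size g'))).
by rewrite !drop_size_cat.
Qed.

Lemma MAX_prefix G g g' u : MAX G g -> G g' -> g' = g ++ u -> g' = g.
Proof. by move=> gm Gg' e; rewrite e (MAX_cat gm (u := u)) ?cats0 // -e. Qed.

(** The tree [G] with a copy of [H] hung on every maximal branch. [GammaS] writes Gamma_{xi,n+1} in
    this form, so that induction on n replaces the explicit block decompositions. *)
Definition tcat G H : set (seq T) :=
  [set t | G t \/ exists g h, [/\ MAX G g, H h & t = g ++ h]].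

End initial_segments.

Lemma oshift_inj a : injective (oshift a).
Proof. by apply: inj_map; exact: oadd_inj. Qed.

Lemma oshift_cat a s t : oshift a (s ++ t) = oshift a s ++ oshift a t.
Proof. exact: map_cat. Qed.

Lemma oshift_cat_inv a s t u : oshift a s = oshift a t ++ u ->
  exists2 v, s = t ++ v & u = oshift a v.
Proof.
elim: t s => [|y t IH] [|x s] //=; [by exists [::]|by exists (x :: s)|].
by case=> /oadd_inj -> /IH[v -> ->]; exists v.
Qed.

Lemma MAX_oshift a G t : MAX (oshift a @` G) t <-> exists2 s, MAX G s & t = oshift a s.
Proof.
split=> [[[s Gs <-] sm]|[s [Gs sm] ->]].
  exists s => //; split=> // u Gu [v uv].
  by apply: (@oshift_inj a); apply: sm; [exists u|rewrite uv oshift_cat; exists (oshift a v)].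
split; first by exists s.
by move=> _ [u Gu <-] [v /oshift_cat_inv[w uw _]]; congr oshift; apply: sm => //; exists w.
Qed.

Lemma blocks_cons xi n t ts :
  blocks xi n.+1 (t :: ts) = oshift (omuln (oomega xi) n) t ++ blocks xi n ts.
Proof.
rewrite /blocks /= subSS subn0; congr (_ ++ _).
rewrite (iotaDl 1 0) -map_comp; congr flatten; exact: eq_map.
Qed.

Section Gamma_of.
Variables (G : set (seq ord)) (xi : ord).

Lemma block_decomp1 n ts t : block_decomp G xi n.+1 1 ts t <->
  exists s, [/\ G s, ts = [:: s] & t = oshift (omuln (oomega xi) n) s].
Proof.
split=> [[]|[s [Gs -> ->]]]; last first.
  by split=> //=; rewrite blocks_cons /blocks /= cats0.
case: ts => [|s []]//= _ _ Gs ->; exists s; split => //.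
by rewrite blocks_cons /blocks /= cats0.
Qed.

Lemma block_decompS n i ts t : block_decomp G xi n.+1 i.+2 ts t <->
  exists s ts' h, [/\ MAX G s, block_decomp G xi n i.+1 ts' h, ts = s :: ts' &
    t = oshift (omuln (oomega xi) n) s ++ h].
Proof.
split=> [[]|[s [ts' [h [sm [szt tm tG ->]]]]]].
  case: ts => [|s ts]//= [sz] sm Gl ->.
  exists s, ts, (blocks xi n ts); split=> //; last exact: blocks_cons.
    exact: (sm 0%N).
  by split => // j ji; exact: (sm j.+1).
move=> -> ->; split=> //=; [by rewrite szt|by case|by rewrite blocks_cons].
Qed.

Lemma Lambda_of1 n t : Lambda_of G xi n.+1 1 t <->
  exists2 s, G s & t = oshift (omuln (oomega xi) n) s.
Proof.
split=> [[ts /block_decomp1[s [Gs _ ->]]]|[s Gs ->]]; first by exists s.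
by exists [:: s]; apply/block_decomp1; exists s.
Qed.

Lemma Lambda_ofS n i t : Lambda_of G xi n.+1 i.+2 t <->
  exists s h, [/\ MAX G s, Lambda_of G xi n i.+1 h &
    t = oshift (omuln (oomega xi) n) s ++ h].
Proof.
split=> [[ts /block_decompS[s [ts' [h [sm th _ ->]]]]]|[s [h [sm [ts hts] ->]]]].
  by exists s, h; split=> //; exists ts'.
by exists (s :: ts); apply/block_decompS; exists s, ts, h.
Qed.

Lemma Gamma_ofS n :
  Gamma_of G xi n.+1 = tcat (oshift (omuln (oomega xi) n) @` G) (Gamma_of G xi n).
Proof.
apply/seteqP; split=> t.
  case=> -[//|[|i]] /andP[_ iin]; first by move/Lambda_of1 => [s Gs ->]; left; exists s.
  move/Lambda_ofS => [s [h [sm hh ->]]]; right.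
  exists (oshift (omuln (oomega xi) n) s), h; split=> //; last by exists i.+1.
  by apply/MAX_oshift; exists s.
case=> [[s Gs <-]|[g [h [/MAX_oshift[s sm ->] [[//|i] iin hh] ->]]]].
  by exists 1%N => //; apply/Lambda_of1; exists s.
by exists i.+2 => //; apply/Lambda_ofS; exists s, h.
Qed.

Lemma Gamma_of0 : Gamma_of G xi 0 = set0.
Proof. by apply/seteqP; split=> // t [[|i]]. Qed.

Hypothesis G0 : ~ G [::].

Lemma Gamma_of_nonempty n : ~ Gamma_of G xi n [::].
Proof.
elim: n => [|n IH]; first by rewrite Gamma_of0.
rewrite Gamma_ofS => -[[s Gs]|[g [h [gm hh]]]].
  by case: s Gs.
by case: g gm => // -[[[]]].
Qed.

(** Two maximal branches of which one begins the other coincide, so t determines its first block,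
    and induction on n removes it. The local [key] excludes that one decomposition ends in its first
    block while the other goes on: a member of [G] would properly extend a maximal one. *)
Lemma block_decomp_uniq n i j ts ts' t : (1 <= i <= n)%N -> (1 <= j <= n)%N ->
  block_decomp G xi n i ts t -> block_decomp G xi n j ts' t -> i = j /\ ts = ts'.
Proof.
have key m k s1 s2 us h : (1 <= k <= m)%N -> G s1 -> MAX G s2 ->
    block_decomp G xi m k us h -> 
    oshift (omuln (oomega xi) m) s1 <> oshift (omuln (oomega xi) m) s2 ++ h.
  move=> km Gs1 s2m hh /oshift_cat_inv[v s12]; rewrite (MAX_cat s2m (u := v)) -?s12// => h0.
  apply: (@Gamma_of_nonempty m); rewrite -[[::]]/(oshift (omuln (oomega xi) m) [::]) -h0.
  by exists k => //; exists us.
elim: n i j ts ts' t => [|n IH] [|[|i]] [|[|j]] ts ts' t //= iin jin.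
- by move=> /block_decomp1[s [_ -> ->]] /block_decomp1[s' [_ -> /oshift_inj ->]].
- move=> /block_decomp1[s [Gs _ ->]] /block_decompS[s' [us [h [sm hh _]]]].
  by move/key => /(_ j.+1 us jin Gs sm hh).
- move=> /block_decompS[s' [us [h [sm hh _ ->]]]] /block_decomp1[s [Gs _ /esym]].
  by move/key => /(_ i.+1 us iin Gs sm hh).
- move=> /block_decompS[s [us [h [sm hh -> ->]]]] /block_decompS[s' [us' [h' [sm' hh' ->]]]].
  move=> e; have [] := @MAX_eq _ (oshift (omuln (oomega xi) n) @` G) _ _ h h' _ _ e.
  + by apply/MAX_oshift; exists s.
  + by apply/MAX_oshift; exists s'.
  move=> /oshift_inj -> hh'E; move: hh'; rewrite -hh'E => hh'.
  by have [[->] ->] := IH i.+1 j.+1 _ _ _ iin jin hh hh'.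
Qed.

End Gamma_of.

Lemma GammaS xi n : Gamma xi n.+1 =
  tcat (oshift (omuln (oomega xi) n) @` Gamma1 xi) (Gamma xi n).
Proof. exact: Gamma_ofS. Qed.

Lemma ord_ind (P : ord -> Prop) : P ozero -> (forall z, P z -> P (osucc z)) ->
  (forall x, olimit x -> (forall z, olt z x -> P z) -> P x) -> forall x, P x.
Proof.
move=> P0 PS Pl x; elim: (olt_wf x) => {}x _ IH.
have [->//|[z xz]|/Pl] := ord_cases x; last exact.
by rewrite xz; apply: PS; apply: IH; rewrite xz; exact: olt_osucc.
Qed.

Lemma Gamma1_nonempty xi : ~ Gamma1 xi [::].
Proof.
elim/ord_ind : xi => [|z IH|x lx IH]; first by rewrite Gamma1_0.
  by rewrite Gamma1_succ => -[n _]; exact: Gamma_of_nonempty.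
by rewrite Gamma1_limit// => -[z zx [[|? ?]// h _]]; apply: (IH (osucc z)) => //; exact: lx.2.
Qed.

Lemma Gamma_nonempty xi n : ~ Gamma xi n [::].
Proof. exact/Gamma_of_nonempty/Gamma1_nonempty. Qed.

(** The bound for one block is a hypothesis because [Gamma1_lt] calls this lemma inside its
    induction on xi. *)
Lemma Gamma_ltG xi n t a :
  (forall t a, Gamma1 xi t -> a \in t -> olt a (oomega xi)) ->
  Gamma xi n t -> a \in t -> olt a (omuln (oomega xi) n).
Proof.
move=> lt1; have lts m s : Gamma1 xi s -> a \in oshift (omuln (oomega xi) m) s ->
    olt a (omuln (oomega xi) m.+1).
  move=> Gs /mapP[b bs ->]; rewrite -oadd_omuln; apply: olt_oadd; exact: lt1 Gs bs.
elim: n t => [|n IH] t; first by rewrite /Gamma Gamma_of0.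
rewrite GammaS => -[[s Gs <-]|[_ [h [/MAX_oshift[s [Gs _] ->] hh ->]]]]; first exact: lts.
rewrite mem_cat => /orP[|ah]; first exact: lts.
by apply: olt_ole_trans (IH _ hh ah) _; exact: omuln_leq.
Qed.

Lemma Gamma1_lt xi t a : Gamma1 xi t -> a \in t -> olt a (oomega xi).
Proof.
elim/ord_ind : xi t a => [|z IH|x lx IH] t a.
- by rewrite Gamma1_0 => -> ; rewrite inE => /eqP ->; exact: olt0_oomega.
- rewrite Gamma1_succ => -[n _ Gt] at_; apply: olt_ole_trans (omuln_oomega z n).
  exact: Gamma_ltG IH Gt at_.
- rewrite Gamma1_limit// => -[z zx [s Gs ->]] /mapP[b bs ->].
  have zx' := lx.2 _ zx.
  apply: olt_ole_trans (ole_oomega (plt_ple zx')).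
  apply: olt_ole_trans (oadd_oomega z); apply: olt_oadd; exact: IH Gs bs.
Qed.

Lemma Gamma_head_lt xi n a t : Gamma xi n (a :: t) -> olt a (omuln (oomega xi) n).
Proof. by move=> h; apply: Gamma_ltG h _; [exact: Gamma1_lt|rewrite mem_head]. Qed.

Lemma Gamma_head_le xi n a t : Gamma xi n.+1 (a :: t) -> ole (omuln (oomega xi) n) a.
Proof.
rewrite GammaS => -[[[|b s] Gs]//= [<- _]|[_ [h [/MAX_oshift[[|b s] [Gs _] ->] _]]]].
- exact: ole_oadd.
- by case: (Gamma1_nonempty Gs).
- by case=> -> _; exact: ole_oadd.
Qed.

(** The first ordinal lies in [omega^xi (n-1), omega^xi n) and so determines n: the union defining
    Gamma_{xi+1,1} is disjoint. *)
Lemma Gamma_head_inj xi m n a s t : Gamma xi m (a :: s) -> Gamma xi n (a :: t) -> m = n.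
Proof.
wlog mn : m n s t / (m < n)%N => [wl|] Gs Gt.
  have [mn|nm|//] := ltngtP m n; first exact: wl mn Gs Gt.
  exact/esym/(wl _ _ _ _ nm Gt Gs).
case: n mn Gt => // n mn /Gamma_head_le na; have := Gamma_head_lt Gs => am.
case: (@olt_irrefl a); apply: olt_ole_trans am _; apply: ole_trans na; exact: omuln_leq.
Qed.

(** The first ordinal of a member of omega^z + Gamma_{z+1,1} lies in [omega^z, omega^(z+1)), by the
    absorption [oadd_oomega]. These intervals are disjoint, hence so is the union at a limit
    ordinal. *)
Lemma Gamma1_limit_inj xi z z' s t : Gamma1 (osucc z) s -> Gamma1 (osucc z') t ->
  head xi (oshift (oomega z) s) = head xi (oshift (oomega z') t) -> 
  z = z'.
Proof.
case: s => [/Gamma1_nonempty//|b s]; case: t => [_ /Gamma1_nonempty//|c t] /= Gs Gt.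
wlog zz' : z z' b c s t Gs Gt / olt z z' => [wl bc|bc].
  have [zz'|//|zz'] := olt_total z z'; first exact: wl Gs Gt zz' bc.
  by apply/esym; exact: wl Gt Gs zz' (esym bc).
case: (@olt_irrefl (oadd (oomega z) b)).
have bz := Gamma1_lt Gs (mem_head _ _).
apply: olt_ole_trans (olt_oadd _ bz) _; apply: ole_trans (oadd_oomega z) _.
apply: ole_trans (ole_oomega (osucc_le zz')) _; rewrite bc; exact: ole_oadd.
Qed.

Definition prefix_closed (T : Type) (G : set (seq T)) :=
  forall s u, s <> [::] -> G (s ++ u) -> G s.

Lemma oshift_prefix_closed a G : prefix_closed G -> prefix_closed (oshift a @` G).
Proof.
move=> Gp s u s0 [t Gt tE].
have [v tv _] : exists2 v, t = take (size s) t ++ v & True.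
  by exists (drop (size s) t) => //; rewrite cat_take_drop.
have sE : s = oshift a (take (size s) t).
  by rewrite /oshift map_take -/(oshift a t) tE take_size_cat.
by exists (take (size s) t) => //; apply: (Gp _ v); [move=> t0; apply: s0; rewrite sE t0|rewrite -tv].
Qed.

Lemma tcat_prefix_closed (T : Type) (G H : set (seq T)) :
  prefix_closed G -> prefix_closed H -> prefix_closed (tcat G H).
Proof.
move=> Gp Hp s u s0 [Gsu|[g [h [gm hh e]]]]; first by left; exact: Gp Gsu.
case: (init_seg_comparable e) => -[v].
  by move=> gs; left; apply: (Gp _ v) => //; rewrite -gs; exact: gm.1.
move=> sv; case: v sv => [|x v] sv; first by left; rewrite sv cats0; exact: gm.1.
right; exists g, (x :: v); split=> //; apply: (Hp _ u) => //.
by move: e; rewrite sv -catA => /(congr1 (drop (size g))); rewrite !drop_size_cat// => ->.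
Qed.

Lemma Gamma_prefix_closedG xi n : prefix_closed (Gamma1 xi) -> prefix_closed (Gamma xi n).
Proof.
move=> h; elim: n => [|n IH]; first by move=> s u _; rewrite /Gamma Gamma_of0.
by rewrite GammaS; apply: tcat_prefix_closed IH; exact: oshift_prefix_closed.
Qed.

Lemma Gamma1_prefix_closed xi : prefix_closed (Gamma1 xi).
Proof.
elim/ord_ind : xi => [|z IH|x lx IH] s u s0.
- by rewrite Gamma1_0 /=; case: s s0 => //= a [|b s]// _; case: u.
- by rewrite Gamma1_succ => -[n n1 h]; exists n => //; apply: Gamma_prefix_closedG h.
- rewrite Gamma1_limit// => -[z zx [t Gt tE]].
  have [|t' Gt' <-] := @oshift_prefix_closed (oomega z) _ (IH _ (lx.2 _ zx)) s u s0.
    by exists t.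
  by exists z => //; exists t'.
Qed.

Lemma Gamma_prefix_closed xi n : prefix_closed (Gamma xi n).
Proof. exact/Gamma_prefix_closedG/Gamma1_prefix_closed. Qed.

(** * Probabilities and block sums *)

Section probabilities.
Variable R : realType.

Lemma Prob_of_decomp (p : seq ord -> R) xi n i ts t : (1 <= i <= n)%N ->
  block_decomp (Gamma1 xi) xi n i ts t -> Prob_of p xi n t = p (nth [::] ts i.-1).
Proof.
move=> iin tts; rewrite /Prob_of; case: xgetP => [v _ [j [us [jin tus ->]]]|].
  by have [<- <-] := block_decomp_uniq (@Gamma1_nonempty xi) iin jin tts tus.
by move=> /(_ (p (nth [::] ts i.-1))); case; exists i, ts.
Qed.

Lemma Prob_head xi n s : Gamma1 xi s ->
  Prob R xi n.+1 (oshift (omuln (oomega xi) n) s) = Prob1 R xi s.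
Proof.
move=> Gs; rewrite /Prob (@Prob_of_decomp _ _ _ 1 [:: s])//.
by apply/block_decomp1; exists s.
Qed.

Lemma Prob_tail xi n s h : MAX (Gamma1 xi) s -> Gamma xi n h ->
  Prob R xi n.+1 (oshift (omuln (oomega xi) n) s ++ h) = Prob R xi n h.
Proof.
move=> sm [[//|i] iin [ts hts]]; rewrite /Prob (Prob_of_decomp _ _ hts)//.
rewrite (@Prob_of_decomp _ _ _ i.+2 (s :: ts))//.
by apply/block_decompS; exists s, ts, h.
Qed.

Lemma Prob1_0 : Prob1 R ozero [:: ozero] = 1.
Proof.
rewrite Prob1E /Prob1_step; case: xgetP => [v _|/(_ 1)].
  case=> [[]//|[z [zxi _]]|[[]//]].
  by have := olt0 zxi.
by case; apply: Or31.
Qed.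

Lemma Prob1_succ z n t : (1 <= n)%N -> Gamma z n t ->
  Prob1 R (osucc z) t = n%:R^-1 * Prob R z n t.
Proof.
move=> n1 Gt; rewrite Prob1E /Prob1_step; case: xgetP => [v _|].
  case=> [[/osucc_neq0]//|[y [yz [/osucc_inj <- [m [m1 Gmt ->]]]]]|[/osucc_nlimit]//].
  by case: t Gt Gmt => [/Gamma_nonempty//|a t] Gt /(Gamma_head_inj Gt) ->.
move=> /(_ (n%:R^-1 * Prob R z n t)); case; apply: Or32.
by exists z, (olt_osucc z); split => //; exists n.
Qed.

Lemma Prob1_limit xi z s : olimit xi -> olt z xi -> Gamma1 (osucc z) s ->
  Prob1 R xi (oshift (oomega z) s) = Prob1 R (osucc z) s.
Proof.
move=> lxi zxi Gs; rewrite Prob1E /Prob1_step; case: xgetP => [v _|].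
  case=> [[x0]|[y [yz [xy _]]]|[_ [y [yx [u [Gu e ->]]]]]].
  - by case: lxi.
  - by rewrite xy in lxi; case: (osucc_nlimit lxi).
  - have zy := @Gamma1_limit_inj xi _ _ _ _ Gs Gu (congr1 (head xi) e).
    by move: e; rewrite zy => /oshift_inj ->.
move=> /(_ (Prob1 R (osucc z) s)); case; apply: Or33; split=> //.
by exists z, (lxi.2 _ zxi), s.
Qed.

End probabilities.

Lemma unzip1_cat (S T : Type) (s t : seq (S * T)) :
  unzip1 (s ++ t) = unzip1 s ++ unzip1 t.
Proof. exact: map_cat. Qed.

Lemma unzip1_rcons (S T : Type) (s : seq (S * T)) a :
  unzip1 (rcons s a) = rcons (unzip1 s) a.1.
Proof. exact: map_rcons. Qed.

Section weighted_sums.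
Variables (R : realType) (k : scalar_kind) (X : lmodType (scalars R k)).
Implicit Types (s t h : seq (ord * X)) (p : seq ord -> R).

(** A position of the game is a branch whose entries carry the vectors played, so the vector at a
    node is the one in its last entry; the default serves the empty position only. *)
Definition last_vec t : X := (last (ozero, 0) t).2.

Definition wsum p t : X :=
  \sum_(j < size t) of_real k (p (unzip1 (take j.+1 t))) *: last_vec (take j.+1 t).

Definition pshift (a : ord) t : seq (ord * X) := [seq (oadd a b.1, b.2) | b <- t].

Lemma unzip1_pshift a t : unzip1 (pshift a t) = oshift a (unzip1 t).
Proof. by rewrite /unzip1 /pshift /oshift -!map_comp. Qed.

Lemma wsum_cat p s h :
  wsum p (s ++ h) = wsum p s + wsum (fun u => p (unzip1 s ++ u)) h.
Proof.
rewrite /wsum size_cat big_split_ord /=; congr (_ + _).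
  by apply: eq_bigr => j _; rewrite takel_cat.
apply: eq_bigr => j _.
have -> : take (size s + j).+1 (s ++ h) = s ++ take j.+1 h.
  by rewrite take_cat ltnNge leqW ?leq_addr//= -addnS addKn.
rewrite unzip1_cat /last_vec last_cat.
by case: h j => [[]//|a h] j /=.
Qed.

Lemma wsum_pshift p a t : wsum p (pshift a t) = wsum (p \o oshift a) t.
Proof.
rewrite /wsum size_map; apply: eq_bigr => j _ /=.
rewrite -/(pshift a t) -map_take -/(pshift a _) unzip1_pshift; congr (_ *: _).
by rewrite /last_vec; case: t j => [[]//|b t] j /=; rewrite last_map.
Qed.

Lemma eq_wsum p q t : (forall u v, u <> [::] -> unzip1 t = u ++ v -> p u = q u) ->
  wsum p t = wsum q t.
Proof.
move=> pq; apply: eq_bigr => j _; congr (of_real k _ *: _).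
apply: (pq _ (unzip1 (drop j.+1 t))); last by rewrite -unzip1_cat cat_take_drop.
by case: t j {pq} => [[]|].
Qed.

Lemma wsum0 p t : (forall u v, u <> [::] -> unzip1 t = u ++ v -> p u = 0) -> wsum p t = 0.
Proof.
move=> p0; rewrite (eq_wsum (q := fun=> 0))// /wsum big1// => j _.
by rewrite of_real0 scale0r.
Qed.

Lemma wsumZ c p t : wsum (fun u => c * p u) t = of_real k c *: wsum p t.
Proof.
by rewrite scaler_sumr; apply: eq_bigr => j _; rewrite of_realM scalerA.
Qed.

End weighted_sums.

Section block_sums.
Variables (R : realType) (k : scalar_kind) (X : normedModType (scalars R k)).
Implicit Types (s t h : seq (ord * X)).

Definition bsum xi n i t : X := block_sum xi n (@last_vec R k X) i t.

Lemma bsumE xi n i t : bsum xi n i t =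
  wsum (fun u => if `[< Lambda xi n i u >] then Prob R xi n u else 0) t.
Proof.
rewrite /bsum /block_sum big_add1 big_mkord big_mkcond/=; apply: eq_bigr => j _.
by rewrite /LambdaD/=; case: ifPn => // _; rewrite of_real0 scale0r.
Qed.

(** An initial segment that runs past the maximal branch s is too long for Lambda_{xi,n+1,1}, and
    within s the weights are those of P_{xi,1}. *)
Lemma bsum_head xi n s h : MAX (Gamma1 xi) (unzip1 s) ->
  bsum xi n.+1 1 (pshift (omuln (oomega xi) n) s ++ h) = wsum (Prob1 R xi) s.
Proof.
move=> sm; rewrite bsumE wsum_cat wsum_pshift [X in _ + X]wsum0 ?addr0 => [|u v u0 _].
  apply: eq_wsum => u v u0 suv /=.
  have Gu : Gamma1 xi u by apply: (@Gamma1_prefix_closed xi u v u0); rewrite -suv; exact: sm.1.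
  case: asboolP => [_|[]]; first exact: Prob_head.
  by apply/Lambda_of1; exists u.
case: asboolP => // /Lambda_of1 [w Gw]; rewrite unzip1_pshift => /esym.
move=> /oshift_cat_inv[v' wsv uv]; case: u0; rewrite uv.
by rewrite (MAX_cat sm (u := v')) -?wsv.
Qed.

(** Initial segments inside the first block do not reach Lambda_{xi,n+1,i+2}; the longer ones lose
    their first block without change of weight. *)
Lemma bsum_tail xi n i s h : (i < n)%N -> MAX (Gamma1 xi) (unzip1 s) ->
  bsum xi n.+1 i.+2 (pshift (omuln (oomega xi) n) s ++ h) = bsum xi n i.+1 h.
Proof.
move=> iin sm; rewrite !bsumE wsum_cat wsum_pshift wsum0 ?add0r => [|u v u0 suv /=].
  apply: eq_wsum => u v u0 huv /=; rewrite unzip1_pshift.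
  case: asboolP => [/Lambda_ofS[s' [h' [sm' hh' e]]]|nL].
    have [||_ uh] := @MAX_eq _ (oshift (omuln (oomega xi) n) @` Gamma1 xi) _ _ u h' _ _ e.
    - by apply/MAX_oshift; exists (unzip1 s).
    - by apply/MAX_oshift; exists s'.
    rewrite uh; case: asboolP => // _; apply: Prob_tail => //.
    by exists i.+1.
  case: asboolP => // hu; case: nL; apply/Lambda_ofS.
  by exists (unzip1 s), u.
case: asboolP => // /Lambda_ofS[s' [h' [sm' hh' /oshift_cat_inv[w us hw]]]].
have Gu : Gamma1 xi u by apply: (@Gamma1_prefix_closed xi u v u0); rewrite -suv; exact: sm.1.
case: (@Gamma_nonempty xi n); exists i.+1; first by [].
by have -> : [::] = h' by rewrite hw (MAX_cat sm' (u := w)) -?us.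
Qed.

End block_sums.

(** * Games on trees *)

Section game.
Variables (T : Type) (F : set (set T)).
Implicit Types (G H : set (seq ord)) (K : set (seq (ord * T))) (s t : seq (ord * T)).

(** A proof of [Win] is a winning strategy: [z] and [P] are the player's choices, the universally
    quantified [v] is the opponent's reply, and the inductive type makes every play finite. *)
Inductive Win G K s : Prop :=
| WinStop : MAX G (unzip1 s) -> K s -> Win G K s
| WinStep z P : F P -> G (rcons (unzip1 s) z) ->
    (forall v, P v -> Win G K (rcons s (z, v))) -> Win G K s.

Lemma Win_mono G K K' s : (forall t, MAX G (unzip1 t) -> K t -> K' t) ->
  Win G K s -> Win G K' s.
Proof.
move=> KK'; elim=> {}s => [sm Ks|z P FP Gs _ IH]; first by apply: WinStop => //; exact: KK'.
exact: WinStep FP Gs IH.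
Qed.

Lemma eq_Win G K K' s : (forall t, MAX G (unzip1 t) -> K t <-> K' t) ->
  Win G K s <-> Win G K' s.
Proof. by move=> KK'; split; apply: Win_mono => t /KK' []. Qed.

(** A play on the glued tree is a play on [G] up to a maximal branch followed by a play on [H]. Both
    trees contain the empty sequence, so that each part can start at its root. *)
Lemma Win_tcat G H K : G [::] -> H [::] ->
  Win (tcat G H) K [::] <-> Win G (fun s => Win H (fun s' => K (s ++ s')) [::]) [::].
Proof.
move=> G0 H0; split; last first.
- elim=> s => [sm|z P FP Gs _ IH]; last by apply: WinStep FP _ IH; left.
  have [g1 g2] := sm.
  rewrite -{2}[s]cats0; elim=> s' => [s'm Ks|z P FP Hs _ IH].
    apply: WinStop => //; rewrite unzip1_cat; split.
      by right; exists (unzip1 s), (unzip1 s'); split=> //; exact: s'm.1.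
    move=> w [Gw [v wE]|[g [h [gm Hh ->]]] [v]].
      have vs : unzip1 s' ++ v = [::] by apply: (MAX_cat sm); rewrite catA -wE.
      by case: v vs wE => [_ ->|? ?]; [rewrite cats0|case: (unzip1 s')].
    rewrite -catA => /(MAX_eq gm sm) [-> hE]; congr cat.
    by apply: s'm.2 => //; exists v.
  apply: (WinStep FP (z := z)) => [|v Pv].
    right; exists (unzip1 s), (rcons (unzip1 s') z); split=> //.
    by rewrite unzip1_cat rcons_cat.
  by rewrite rcons_cat; exact: IH.
(* Beyond a maximal branch g of [G] the remaining play stays in the copy of [H] hung on g. *)
have key g h : MAX G (unzip1 g) -> H (unzip1 h) -> Win (tcat G H) K (g ++ h) ->
    Win H (fun s' => K (g ++ s')) h.
  move=> gm Hh W; have [s sE] : exists s, s = g ++ h by exists (g ++ h).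
  rewrite -sE in W; elim: W h Hh sE => {}s => [sm Ks|z P FP Gs _ IH] h Hh sE.
    apply: WinStop; last by rewrite -sE.
    split=> // u Hu [v uv].
    have : unzip1 g ++ u = unzip1 g ++ unzip1 h.
      rewrite -unzip1_cat -sE; apply: sm.2; first by right; exists (unzip1 g), u.
      by exists v; rewrite sE unzip1_cat uv catA.
    by move/(congr1 (drop (size (unzip1 g)))); rewrite !drop_size_cat.
  have Hhz : H (rcons (unzip1 h) z).
    move: Gs; rewrite sE unzip1_cat rcons_cat => -[Gs|[g' [h' [gm' Hh']]]].
      by have := MAX_cat gm Gs; case: unzip1.
    by move=> /(MAX_eq gm gm') [_ ->].
  apply: (WinStep FP Hhz) => v Pv; apply: (IH v Pv); first by rewrite unzip1_rcons.
  by rewrite sE rcons_cat.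
suff main s : Win (tcat G H) K s -> G (unzip1 s) ->
    Win G (fun s => Win H (fun s' => K (s ++ s')) [::]) s by move/main; apply.
elim=> {}s.
  move=> sm Ks Gs.
  have sm' : MAX G (unzip1 s) by split=> // u Gu; apply: sm.2; left.
  by apply: WinStop => //; have := @key s [::] sm' H0; rewrite cats0; apply; exact: WinStop sm Ks.
move=> z P FP Gsz W IH Gs.
have [sm|sm] := pselect (MAX G (unzip1 s)).
  by apply: WinStop => //; have := @key s [::] sm H0; rewrite cats0; apply; exact: WinStep FP Gsz W.
(* A branch of [G] that is not maximal can be continued only inside [G]. *)
have Gsz' : G (rcons (unzip1 s) z).
  case: Gsz => // -[g [h [gm Hh]]].
  case/lastP: h Hh => [|h y] Hh; first by rewrite cats0 => ->; exact: gm.1.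
  by rewrite -rcons_cat => /rcons_inj[sE _]; case: sm; rewrite (MAX_prefix gm Gs sE).
by apply: (WinStep FP Gsz') => v Pv; apply: IH => //; rewrite unzip1_rcons.
Qed.

(** The trees omit the empty sequence; the game needs it as its starting position. *)
Definition star G : set (seq ord) := [set s | s = [::] \/ G s].

Lemma MAX_star G (t : seq ord) : G t -> ~ G [::] -> MAX (star G) = MAX G.
Proof.
move=> Gt G0; apply/seteqP; split=> s [].
  move=> [->|Gs] sm; last by split=> // u Gu; apply: sm; right.
  by case: t Gt => // a t Gt; have := sm (a :: t) (or_intror Gt) (ex_intro _ _ erefl).
move=> Gs sm; split; first by right.
move=> u [-> [v]|Gu]; last exact: sm.
by case: s Gs {sm}.
Qed.

Lemma star_tcat G H (t : seq ord) : G t -> ~ G [::] -> star (tcat G H) = tcat (star G) (star H).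
Proof.
move=> Gt G0; apply/seteqP; split=> s; rewrite /tcat (MAX_star Gt G0).
  case=> [->|[Gs|[g [h [gm Hh ->]]]]]; first by left; left.
    by left; right.
  by right; exists g, h; split=> //; right.
case=> [[->|Gs]|[g [h [gm [->|Hh] ->]]]]; first by left.
- by right; left.
- by rewrite cats0; right; left; exact: gm.1.
- by right; right; exists g, h.
Qed.

(** The first ordinal determines the tree [Gs i] in which the rest of the branch stays, so the first
    move amounts to the choice of i. *)
Lemma Win_bigcup (I : Type) (D : set I) (Gs : I -> set (seq ord)) K : (exists i, D i) ->
  (forall i, D i -> exists t : seq ord, Gs i t) -> (forall i, D i -> ~ Gs i [::]) ->
  (forall i j a (s t : seq ord), D i -> D j -> Gs i (a :: s) -> Gs j (a :: t) -> i = j) ->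
  Win (star [set t : seq ord | exists2 i, D i & Gs i t]) K [::] <->
  exists2 i, D i & Win (star (Gs i)) K [::].
Proof.
move=> [i0 Di0] Gs1 Gs0 hd; set U := [set t | _].
have U0 : ~ U [::] by move=> [i /Gs0].
have ext i (s : seq ord) z : D i -> s <> [::] -> Gs i s -> U (rcons s z) -> Gs i (rcons s z).
  move=> Di; case: s => // a s _ Gas [j Dj] Gasz.
  by rewrite (hd i j a _ _ Di Dj Gas Gasz).
have MU i (s : seq ord) : D i -> Gs i s -> MAX U s <-> MAX (Gs i) s.
  move=> Di Gis; have s0 : s <> [::] by move=> s0; apply: (Gs0 i Di); rewrite -s0.
  split=> -[_ sm]; split=> //.
  - by move=> u Gu; apply: sm; exists i.
  - by exists i.
  move=> u [j Dj Gju] su; apply: sm => //.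
  case: s s0 Gis su => // a s _ Gis [v uE]; rewrite uE in Gju *.
  by rewrite (hd i j a _ _ Di Dj Gis Gju).
have [t0 Gt0] := Gs1 i0 Di0.
have Ut0 : U t0 by exists i0.
split.
  case=> [|z P FP [Gz|[i Di Giz]] W].
  - by rewrite (MAX_star Ut0)// => -[].
  - by case: unzip1 Gz.
  exists i => //; apply: (WinStep FP (z := z)); first by right.
  move=> v Pv; have := W v Pv.
  have : Gs i (unzip1 (rcons [::] (z, v))) by [].
  move: (rcons _ _) => s Gis {}W; have [t Gt] := Gs1 i Di.
  elim: W Gis => {}s => [sm Ks|y Q FQ [sy|Gsy] _ IH] Gis.
  - move: sm; rewrite (MAX_star Ut0)// => /(MU _ _ Di Gis) sm.
    by apply: WinStop => //; rewrite (MAX_star Gt)//; exact: Gs0.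
  - by case: unzip1 sy.
  have s0 : unzip1 s <> [::] by move=> s0; apply: (Gs0 i Di); rewrite -s0.
  have Giy := ext _ _ _ Di s0 Gis Gsy.
  by apply: (WinStep FQ (z := y)) => [|u Qu]; [right|apply: IH; rewrite ?unzip1_rcons].
move=> [i Di]; have [t Gt] := Gs1 i Di; elim=> s => [|y Q FQ [sy|Gsy] _ IH].
- rewrite (MAX_star Gt); last exact: Gs0.
  by move=> sm Ks; apply: WinStop => //; rewrite (MAX_star Ut0)//; exact/(MU _ _ Di sm.1).
- by case: unzip1 sy.
- by apply: (WinStep FQ (z := y)) IH; right; exists i.
Qed.

End game.

Lemma Win_shift (R : realType) (k : scalar_kind) (X : lmodType (scalars R k))
    (F : set (set X)) a G K :
  Win F (star (oshift a @` G)) K [::] <-> Win F (star G) (K \o @pshift R k X a) [::].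
Proof.
have stE : star (oshift a @` G) = oshift a @` star G.
  apply/seteqP; split=> s.
    by case=> [->|[u Gu <-]]; [exists [::] => //; left|exists u => //; right].
  by case=> u [->|Gu] <-; [left|right; exists u].
rewrite stE; move: (star G) => {stE}G; split.
  have [s0 s0E] : exists s0 : seq (ord * X), s0 = [::] by exists [::].
  rewrite -{2}s0E; have : ([::] : seq (ord * X)) = pshift a s0 by rewrite s0E.
  move=> {s0E} sE W; elim: W s0 sE => {}s => [sm Ks|z P FP [u Gu uE] _ IH] s0 sE.
    move: sm; rewrite sE unzip1_pshift => /MAX_oshift[u um /oshift_inj us].
    by apply: WinStop; rewrite ?us//= -sE.
  case/lastP: u Gu uE => [_|u y Gu]; first by case: unzip1.
  rewrite /oshift map_rcons -/(oshift a u) => /rcons_inj[uE zE].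
  have us0 : u = unzip1 s0 by apply: (@oshift_inj a); rewrite uE sE unzip1_pshift.
  apply: (WinStep FP (z := y)) => [|v Pv]; first by rewrite -us0.
  by apply: (IH v Pv); rewrite sE /pshift map_rcons zE.
rewrite -[X in Win _ _ _ X -> _]/(@nil (ord * X)) => W.
rewrite -[[::]]/(pshift a ([::] : seq (ord * X))).
elim: W => s => [sm Ks|z P FP Gs _ IH].
  by apply: WinStop => //; rewrite unzip1_pshift; apply/MAX_oshift; exists (unzip1 s).
apply: (WinStep FP (z := oadd a z)) => [|v Pv].
  by exists (rcons (unzip1 s) z) => //; rewrite unzip1_pshift /oshift map_rcons.
by have := IH v Pv; rewrite /pshift map_rcons.
Qed.

Lemma of_real1 (R : realType) (k : scalar_kind) : of_real k 1 = 1 :> scalars R k.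
Proof. by case: k. Qed.

(** * The forcing quantifier [Q] and its equivalence with the game *)

Section forcing.
Variables (R : realType) (k : scalar_kind) (X : lmodType (scalars R k)).
Local Notation K := (scalars R k).
Implicit Types (q : set (set X)) (P : set X) (cs : seq K) (w : X) (F : set (set X)).

(** The iterated game with coefficients [cs]: the block vectors are forced one after the other, each
    with knowledge of the earlier ones, and w accumulates their weighted sum. *)
Fixpoint chain q cs P w : Prop :=
  if cs is a :: cs' then q [set z | chain q cs' P (w + a *: z)] else P w.

(** The recursion follows that of Gamma_{xi,1} and P_{xi,1}: a single move at 0, the average of n
    block vectors at a successor, with n chosen by the player, and the choice of a smaller ordinal
    at a limit. *)
Definition Q_step F (xi : ord) (rec : forall z, olt z xi -> set (set X)) : set (set X) :=
  [set P |
     [\/ xi = ozero /\ F P,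
         exists z (zxi : olt z xi), xi = osucc z /\
           exists2 n, (1 <= n)%N & chain (rec z zxi) (nseq n (of_real k n%:R^-1)) P 0 |
         olimit xi /\ exists z (zxi : olt (osucc z) xi), rec (osucc z) zxi P]].

Definition Q F : ord -> set (set X) := Fix olt_wf _ (Q_step F).

Lemma QE F xi : Q F xi = Q_step F (fun z (_ : olt z xi) => Q F z).
Proof.
rewrite /Q Fix_eq// => a f g fg; congr Q_step.
by apply/functional_extensionality_dep => z; apply/funext => za; exact: fg.
Qed.

Lemma Q_0 F : Q F ozero = F.
Proof.
rewrite QE; apply/seteqP; split=> P; last by move=> ?; apply: Or31.
case=> [[]//|[z [zxi _]]|[[]//]].
by have := olt0 zxi.
Qed.

Lemma Q_succ F z : Q F (osucc z) = [set P | exists2 n, (1 <= n)%N &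
  chain (Q F z) (nseq n (of_real k n%:R^-1)) P 0].
Proof.
rewrite QE; apply/seteqP; split=> P.
  by case=> [[/osucc_neq0]|[y [yz [/osucc_inj <-]]]|[/osucc_nlimit]].
by move=> h; apply: Or32; exists z, (olt_osucc z).
Qed.

Lemma Q_limit F xi : olimit xi ->
  Q F xi = [set P | exists2 z, olt z xi & Q F (osucc z) P].
Proof.
move=> lxi; rewrite QE; apply/seteqP; split=> P.
  case=> [[x0]|[y [yz [xy _]]]|[_ [z [zxi h]]]].
  - by case: lxi.
  - by rewrite xy in lxi; case: (osucc_nlimit lxi).
  - by exists z => //; exact: olt_trans (olt_osucc z) zxi.
by move=> [z zxi h]; apply: Or33; split=> //; exists z, (lxi.2 _ zxi).
Qed.

End forcing.

Section Win_Q.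
Variables (R : realType) (k : scalar_kind) (X : normedModType (scalars R k)).
Local Notation K := (scalars R k).
Variables (F : set (set X)) (F_up : forall P P' : set X, P `<=` P' -> F P -> F P').

Lemma Gamma1_inhabited xi : exists t, Gamma1 xi t.
Proof.
elim/ord_ind : xi => [|z [t Gt]|x lx IH].
- by exists [:: ozero]; rewrite Gamma1_0.
- exists (oshift (omuln (oomega z) 0) t); rewrite Gamma1_succ; exists 1%N => //.
  by rewrite GammaS; left; exists t.
- have [z zx] : exists z, olt z x.
    have [h|x0|/olt0//] := olt_total ozero x; first by exists ozero.
    by case: lx => /(_ (esym x0)).
  have [t Gt] := IH _ (lx.2 _ zx).
  by exists (oshift (oomega z) t); rewrite Gamma1_limit//; exists z => //; exists t.
Qed.

Lemma Gamma_inhabited xi n : (0 < n)%N -> exists t, Gamma xi n t.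
Proof.
case: n => // n _; have [t Gt] := Gamma1_inhabited xi.
by exists (oshift (omuln (oomega xi) n) t); rewrite GammaS; left; exists t.
Qed.

Lemma MAX_starGamma xi n : (0 < n)%N -> MAX (star (Gamma xi n)) = MAX (Gamma xi n).
Proof.
by move=> /(Gamma_inhabited xi) [t Gt]; apply: MAX_star Gt _; exact: Gamma_nonempty.
Qed.

Lemma MAX_starGamma1 xi : MAX (star (Gamma1 xi)) = MAX (Gamma1 xi).
Proof.
by have [t Gt] := Gamma1_inhabited xi; apply: MAX_star Gt _; exact: Gamma1_nonempty.
Qed.

(** Every nonempty initial segment of t lies in exactly one Lambda_{xi,n,i}, so the blocks partition
    the sum. *)
Lemma wsum_Prob xi n (t : seq (ord * X)) : Gamma xi n (unzip1 t) ->
  wsum (Prob R xi n) t = \sum_(i < n) bsum xi n i.+1 t.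
Proof.
move=> Gt; under eq_bigr do rewrite bsumE; rewrite /wsum exchange_big/=.
apply: eq_bigr => j _; set u := unzip1 _.
have : Gamma xi n u.
  apply: (@Gamma_prefix_closed xi n u (unzip1 (drop j.+1 t))).
    by rewrite /u; case: t j {u Gt} => [[]|].
  by rewrite -unzip1_cat cat_take_drop.
case=> -[//|i] iin [ts tsu].
rewrite (bigD1 (Ordinal iin))//= big1 ?addr0 => [|l li].
  by case: asboolP => // -[]; exists ts.
case: asboolP => [[ts' tsu']|_]; last by rewrite of_real0 scale0r.
have [[il] _] := block_decomp_uniq (@Gamma1_nonempty xi) iin (ltn_ord l : (1 <= l.+1 <= n)%N) tsu tsu'.
by case/eqP : li; exact/val_inj.
Qed.

(** Stated relative to the case of one block, which [Win_Gamma1] supplies from its induction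
    hypothesis. [Win_tcat] splits off the first block, and this is one step of [chain]. *)
Lemma Win_Gamma xi (cs : seq K) P w :
  (forall P, Win F (star (Gamma1 xi)) (fun t => P (wsum (Prob1 R xi) t)) [::] <-> Q F xi P) ->
  Win F (star (Gamma xi (size cs)))
    (fun t => P (w + \sum_(i < size cs) cs`_i *: bsum xi (size cs) i.+1 t)) [::]
  <-> chain (Q F xi) cs P w.
Proof.
move=> WQ; elim: cs w => [|a cs IH] w /=.
  split=> [[]|Pw].
  - by rewrite big_ord0 addr0.
  - by move=> z Q0 _ []; [|move=> [[]]].
  apply: WinStop; last by rewrite big_ord0 addr0.
  by split; [left|move=> s [->|[[]]]].
set n := size cs.
have [t0 Gt0] := Gamma1_inhabited xi.
have Gt0' : (oshift (omuln (oomega xi) n) @` Gamma1 xi) (oshift (omuln (oomega xi) n) t0).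
  by exists t0.
have G0 : ~ (oshift (omuln (oomega xi) n) @` Gamma1 xi) [::].
  by move=> [[|//] /Gamma1_nonempty].
rewrite GammaS (star_tcat _ Gt0' G0) Win_tcat; [|by left|by left].
rewrite Win_shift -WQ; apply: eq_Win => s; rewrite MAX_starGamma1 => sm /=.
rewrite -IH; apply: eq_Win => h hm.
rewrite big_ord_recl /= bsum_head// addrA; under eq_bigr do rewrite /bump /= add1n bsum_tail//.
by [].
Qed.

(** At a successor, the first move chooses a tree Gamma_{z,n}, and the factor 1/n in the weights
    turns the sum into the average of n blocks. At a limit it chooses a shifted tree Gamma_{z+1,1},
    and the shift preserves the weights. *)
Lemma Win_Gamma1 xi P :
  Win F (star (Gamma1 xi)) (fun t => P (wsum (Prob1 R xi) t)) [::] <-> Q F xi P.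
Proof.
elim/ord_ind : xi P => [|z IH|x lx IH] P.
- rewrite Q_0 Gamma1_0; have MAX0 (s : seq ord) : MAX (star [set [:: ozero]]) s -> s = [:: ozero].
    by rewrite (@MAX_star _ [:: ozero])// => -[].
  have sum1 (v : X) : wsum (Prob1 R ozero) [:: (ozero, v)] = v.
    by rewrite /wsum big_ord1 /= Prob1_0 of_real1 scale1r.
  split.
    case=> [/MAX0//|z P' FP' [|[zE]] W]; first by [].
    apply: F_up FP' => v /W; rewrite zE; case=> [_ /=|y Q0 _ [|[]]//].
    by rewrite sum1.
  move=> FP; apply: (WinStep FP (z := ozero)); first by right.
  move=> v Pv; apply: WinStop => /=; last by rewrite sum1.
  rewrite (@MAX_star _ [:: ozero])//; split=> // s -> //.
- rewrite Gamma1_succ Q_succ (@Win_bigcup _ _ _ [set n | (1 <= n)%N]).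
  + have key n : (1 <= n)%N -> Win F (star (Gamma z n))
        (fun t => P (wsum (Prob1 R (osucc z)) t)) [::] <->
        chain (Q F z) (nseq n (of_real k n%:R^-1)) P 0.
      move=> n1; rewrite -(Win_Gamma _ _ _ IH) size_nseq.
      apply: eq_Win => t; rewrite MAX_starGamma// => tm.
      rewrite (eq_wsum (q := fun u => n%:R^-1 * Prob R z n u)); last first.
        move=> u v u0 uv; apply: Prob1_succ => //.
        by apply: (@Gamma_prefix_closed z n u v) => //; rewrite -uv; exact: tm.1.
      rewrite wsumZ wsum_Prob; last exact: tm.1.
      rewrite scaler_sumr add0r; under [in X in _ <-> X]eq_bigr => i _ do rewrite nth_nseq ltn_ord.
      by [].
    by split=> -[n n1 /key h]; exists n => //; exact: h.
  + by exists 1%N.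
  + by move=> n; exact: Gamma_inhabited.
  + by move=> n _; exact: Gamma_nonempty.
  + by move=> i j a s t _ _; exact: Gamma_head_inj.
- rewrite Q_limit//.
  have -> : Gamma1 x = [set t | exists2 z, olt z x & (oshift (oomega z) @` Gamma1 (osucc z)) t].
    rewrite Gamma1_limit//; apply/seteqP; split=> t [z zx [s Gs sE]]; exists z => //; exists s => //.
  rewrite Win_bigcup.
  + have key z : olt z x -> Win F (star (oshift (oomega z) @` Gamma1 (osucc z)))
        (fun t => P (wsum (Prob1 R x) t)) [::] <-> Q F (osucc z) P.
      move=> zx; rewrite Win_shift -(IH _ (lx.2 _ zx)); apply: eq_Win => t.
      rewrite MAX_starGamma1 => tm /=; rewrite wsum_pshift.
      rewrite (eq_wsum (q := Prob1 R (osucc z)))// => u v u0 uv /=.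
      apply: Prob1_limit => //.
      by apply: (@Gamma1_prefix_closed (osucc z) u v) => //; rewrite -uv; exact: tm.1.
    by split=> -[z zx /key h]; exists z => //; exact: h.
  + have [h|x0|/olt0//] := olt_total ozero x; first by exists ozero.
    by case: lx => /(_ (esym x0)).
  + move=> z zx; have [t Gt] := Gamma1_inhabited (osucc z).
    by exists (oshift (oomega z) t); exists t.
  + by move=> z zx [[|//] /Gamma1_nonempty].
  + move=> i j a s t _ _ [u Gu uE] [v Gv vE].
    by apply: (@Gamma1_limit_inj x _ _ _ _ Gu Gv); rewrite uE vE.
Qed.

Lemma Win_chain xi (cs : seq K) P w : 
  Win F (star (Gamma xi (size cs)))
    (fun t => P (w + \sum_(i < size cs) cs`_i *: bsum xi (size cs) i.+1 t)) [::]
  <-> chain (Q F xi) cs P w.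
Proof. exact/Win_Gamma/Win_Gamma1. Qed.

End Win_Q.

(** * Weakly null trees and the game *)

Section weak.
Variables (R : realType) (k : scalar_kind) (X : completeNormedModType (scalars R k)).
Local Notation K := (scalars R k).

(* The filter on [X] generated by the unit ball and the weak neighbourhoods of 0. *)
Inductive weakB : set X -> Prop :=
| weakB_ball S : (forall x, rnorm x <= 1 -> S x) -> weakB S
| weakB_fun S (f : {linear X -> K^o}) e : continuous f -> 0 < e ->
    (forall x, rnorm (f x : K) < e -> S x) -> weakB S
| weakB_I S S1 S2 : weakB S1 -> weakB S2 -> (forall x, S1 x -> S2 x -> S x) -> weakB S.

Lemma weakB_up S S' : S `<=` S' -> weakB S -> weakB S'.
Proof. by move=> SS' WS; apply: (weakB_I WS WS) => x Sx _; exact: SS'. Qed.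

Lemma weakB_0 S : weakB S -> S 0.
Proof.
elim=> {}S => [h|f e _ e0 h|S1 S2 _ S10 _ S20 h]; last exact: h.
  by apply: h; rewrite -(ler_of_real k) of_real_rnorm normr0 of_real1.
by apply: h; rewrite linear0 -(ltr_of_real k) of_real_rnorm normr0 -(of_real0 R k) ltr_of_real.
Qed.

Lemma net_tails_filter (D : Type) (leD : D -> D -> Prop) :
  directed_set leD -> Filter (net_tails leD).
Proof.
move=> [[u0] refl trans dir]; split; first by exists u0.
  move=> P P' [u hu] [v hv]; have [w [uw vw]] := dir u v; exists w => y wy.
  by split; [apply: hu; exact: trans wy|apply: hv; exact: trans wy].
by move=> P P' PP' [u hu]; exists u => v /hu /PP'.
Qed.

Lemma weakB_net (D : Type) (leD : D -> D -> Prop) (x : D -> X) S :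
  directed_set leD -> weakly_null_net leD x -> (forall u, rnorm (x u) <= 1) ->
  weakB S -> net_tails leD (S \o x).
Proof.
move=> [[u0] refl trans dir] xnull x1; elim=> {}S => [h|f e fc e0 h|S1 S2 _ [u1 h1] _ [u2 h2] h].
- by exists u0 => v _; exact/h/x1.
- have e0' : 0 < of_real k e by rewrite -(of_real0 R k) ltr_of_real.
  have TF : Filter (net_tails leD) by exact: net_tails_filter.
  have /cvgrPdist_lt /(_ _ e0') [u hu] := xnull f fc.
  exists u => v uv; apply: h; rewrite -(ltr_of_real k) of_real_rnorm.
  by have := hu v uv; rewrite sub0r normrN.
- have [w [uw vw]] := dir u1 u2; exists w => y wy.
  by apply: h; [apply: h1; exact: trans wy|apply: h2; exact: trans wy].
Qed.

Section positions.
Variable D : Type.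
Implicit Types (x : seq (ord * D) -> X) (t : seq (ord * D)).

(** The position reached when the opponent answers along t by the vectors of the tree x. *)
Definition posx x t : seq (ord * X) :=
  zip (unzip1 t) (mkseq (fun j => x (take j.+1 t)) (size t)).

Lemma posx_rcons x t a : posx x (rcons t a) = rcons (posx x t) (a.1, x (rcons t a)).
Proof.
rewrite /posx size_rcons mkseqS unzip1_rcons zip_rcons ?size_mkseq ?size_map//.
rewrite -(size_rcons t a) take_size; congr (rcons (zip _ _) _).
by apply/eq_in_map => j; rewrite mem_iota add0n => /= jt; rewrite -cats1 takel_cat.
Qed.

Lemma unzip1_posx x t : unzip1 (posx x t) = unzip1 t.
Proof. by rewrite /posx unzip1_zip// size_mkseq size_map. Qed.

Lemma size_posx x t : size (posx x t) = size t.
Proof. by rewrite -(size_map fst) -/(unzip1 _) unzip1_posx size_map. Qed.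

Lemma take_posx x j t : take j (posx x t) = posx x (take j t).
Proof.
elim/last_ind: t => [//|t a IH]; rewrite posx_rcons -!cats1.
have [jt|tj] := leqP j (size t); first by rewrite !takel_cat ?size_posx.
by rewrite !take_oversize ?size_cat ?size_posx ?addn1// cats1 cats1 posx_rcons.
Qed.

Lemma last_vec_posx x t : t <> [::] -> last_vec (posx x t) = x t.
Proof. by case/lastP: t => // t a _; rewrite posx_rcons /last_vec last_rcons. Qed.

Lemma block_sum_posx xi n x i t : block_sum xi n x i t = bsum xi n i (posx x t).
Proof.
rewrite /bsum /block_sum size_posx [LHS]big_nat_cond [RHS]big_nat_cond.
apply: eq_big => [j|j /andP[/andP[j1 jt] _]].
  by rewrite /LambdaD /= take_posx unzip1_posx.
rewrite take_posx unzip1_posx last_vec_posx//.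
by case: t j j1 jt => [|a t] [|j].
Qed.

Lemma MAX_GammaD xi n t : inhabited D ->
  MAX (@GammaD D xi n) t <-> MAX (Gamma xi n) (unzip1 t).
Proof.
move=> [d]; split=> -[Gt tm]; split=> //.
  move=> s Gs [v sE]; have := tm (t ++ [seq (y, d) | y <- v]).
  have uE : unzip1 (t ++ [seq (y, d) | y <- v]) = s.
    by rewrite unzip1_cat sE /unzip1 -map_comp map_id.
  rewrite /GammaD /= uE => /(_ Gs (init_seg_cat _ _)) e.
  by rewrite -uE e.
move=> s Gs [v sE]; have : unzip1 s = unzip1 t.
  by apply: tm => //; exists (unzip1 v); rewrite sE unzip1_cat.
rewrite sE unzip1_cat => /(congr1 size)/eqP; rewrite size_cat !size_map.
by rewrite -[X in _ == X]addn0 eqn_add2l => /nilP ->; rewrite cats0.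
Qed.

End positions.

(** The strategy is followed along the tree: the net at the current node is eventually in the set
    that the player names, so some index u gives an admissible reply. *)
Lemma Win_tree xi n K (D : Type) (leD : D -> D -> Prop) (x : seq (ord * D) -> X) :
  (0 < n)%N -> directed_set leD -> weakly_null_tree xi n leD x ->
  (forall t, GammaD xi n t -> `|x t| <= 1) ->
  Win weakB (star (Gamma xi n)) K [::] ->
  exists2 t, MAX (@GammaD D xi n) t & K (posx x t).
Proof.
move=> n0 dir xnull x1.
suff main s : Win weakB (star (Gamma xi n)) K s -> forall t, t = [::] \/ GammaD xi n t ->
    s = posx x t -> exists2 t, MAX (@GammaD D xi n) t & K (posx x t).
  by move/main => /(_ [::]); apply; first by left.
elim=> {}s => [sm Ks|z P WP Gs _ IH] t tG sE.
  exists t; last by rewrite -sE.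
  apply/MAX_GammaD; first by case: dir.
  by move: sm; rewrite MAX_starGamma// sE unzip1_posx.
have Gu u : GammaD xi n (rcons t (z, u)).
  case: Gs; first by case: (unzip1 s).
  by rewrite /GammaD /= unzip1_rcons sE unzip1_posx.
have x1' u : rnorm (x (rcons t (z, u))) <= 1.
  by rewrite -(ler_of_real k) of_real_rnorm of_real1; exact: x1.
have [u hu] := weakB_net dir (xnull t z tG Gu) x1' WP.
have Px : P (x (rcons t (z, u))) by apply: hu; case: dir.
by apply: (IH _ Px (rcons t (z, u))); [right|rewrite posx_rcons sE].
Qed.

(** From a position that is not winning, every admissible ordinal and every U of the filter leave a
    reply in U and in the unit ball that leads again to a position that is not winning. These
    replies form a tree indexed by the sets of the filter under reverse inclusion. *)
Lemma not_Win_tree xi n K : (0 < n)%N -> ~ Win weakB (star (Gamma xi n)) K [::] ->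
  exists D : Type, exists leD : D -> D -> Prop, exists x : seq (ord * D) -> X,
  [/\ directed_set leD, weakly_null_tree xi n leD x,
    (forall t, GammaD xi n t -> `|x t| <= 1) &
    forall t, MAX (@GammaD D xi n) t -> ~ K (posx x t)].
Proof.
move=> n0 nW; pose D := {S : set X | weakB S}.
have WT : weakB setT by exact: weakB_ball.
have WB : weakB [set x | rnorm x <= 1] by exact: weakB_ball.
pose cand s z (U : D) :=
  [set v | [/\ sval U v, rnorm v <= 1 & ~ Win weakB (star (Gamma xi n)) K (rcons s (z, v))]].
(* Where no such reply exists the value is 0; it lies in every set of the filter, so the tree is
   bounded and weakly null at all nodes. *)
pose pick s z U := xget 0 (cand s z U).
have pickP s z U : sval U (pick s z U) /\ rnorm (pick s z U) <= 1.
  rewrite /pick; case: xgetP => [v _ []//|_]; have W0 := weakB_0 (svalP U); split=> //.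
  by have := weakB_0 WB.
pose pos t := foldl (fun s (a : ord * D) => rcons s (a.1, pick s a.1 a.2)) [::] t.
pose x t := last_vec (pos t).
have pos_rcons t a : pos (rcons t a) = rcons (pos t) (a.1, pick (pos t) a.1 a.2).
  by rewrite /pos foldl_rcons.
have x_rcons t a : x (rcons t a) = pick (pos t) a.1 a.2.
  by rewrite /x pos_rcons /last_vec last_rcons.
have posE t : posx x t = pos t.
  by elim/last_ind: t => // t a IH; rewrite posx_rcons IH x_rcons pos_rcons.
have dir : directed_set (fun U V : D => sval V `<=` sval U).
  split.
  + by constructor; exists setT.
  + by move=> U y.
  + by move=> U V W UV VW y /VW /UV.
  + move=> [U WU] [V WV].
    have WUV : weakB (U `&` V) by apply: (weakB_I WU WV).
    by exists (exist _ _ WUV); split=> y [].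
have TF := net_tails_filter dir.
exists D, (fun U V => sval V `<=` sval U), x; split=> //.
- move=> s z sG Gu f fc; apply/cvgrPdist_lt => e e0.
  have e0' : 0 < to_real e by rewrite -(ltr_of_real k) of_real0 to_realK// ltW.
  have WU : weakB [set y | rnorm (f y : scalars R k) < to_real e] by exact: weakB_fun fc e0' _.
  exists (exist _ _ WU) => V UV; rewrite sub0r normrN x_rcons /=.
  have /UV /= := (pickP (pos s) z V).1.
  by rewrite -(ltr_of_real k) of_real_rnorm to_realK// ltW.
- case/lastP=> [/Gamma_nonempty//|t a _]; rewrite x_rcons.
  by rewrite -of_real_rnorm -(of_real1 R k) ler_of_real; exact: (pickP _ _ _).2.
have inv t : GammaD xi n t -> ~ Win weakB (star (Gamma xi n)) K (pos t).
  have : GammaD xi n t -> star (Gamma xi n) (unzip1 t) by right.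
  move=> /[swap] Gt /(_ Gt); elim/last_ind: t {Gt} => [//|t a IH] Gta.
  have Gt : star (Gamma xi n) (unzip1 t).
    case: Gta => [|]; rewrite unzip1_rcons; first by case: (unzip1 t).
    case E : (unzip1 t) => [|b u]; first by left.
    rewrite -cats1 => Gt; right; exact: (Gamma_prefix_closed _ Gt).
  rewrite pos_rcons; suff [v hv] : exists v, cand (pos t) a.1 a.2 v.
    by rewrite /pick; case: xgetP => [w _ []//|/(_ v)].
  apply: contrapT => nv; apply: (IH Gt).
  have WU : weakB (sval a.2 `&` [set x | rnorm x <= 1]).
    by apply: (weakB_I (svalP a.2) WB).
  apply: (WinStep WU (z := a.1)) => [|v [Uv v1]].
    by rewrite -posE unzip1_posx -unzip1_rcons.
  by apply: contrapT => nWv; apply: nv; exists v.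
move=> t tm Kt; apply: (inv t); first exact: tm.1.
apply: WinStop; last by rewrite -posE.
rewrite MAX_starGamma// -posE unzip1_posx; apply/MAX_GammaD => //.
by constructor; exists setT.
Qed.

End weak.

(** * The quantities alpha in terms of forcing *)

Section alpha_chain.
Variables (R : realType) (k : scalar_kind) (X Y : completeNormedModType (scalars R k)).
Local Notation K := (scalars R k).

Definition snorm (r : \bar R) (cs : seq K) : R :=
  lp_norm r (fun i : 'I_(size cs) => rnorm (cs`_i : K)).

Lemma Win_chain_weak xi (cs : seq K) (P : set X) :
  Win (@weakB R k X) (star (Gamma xi (size cs)))
    (fun t => P (\sum_(i < size cs) cs`_i *: bsum xi (size cs) i.+1 t)) [::]
  <-> chain (Q (@weakB R k X) xi) cs P 0.
Proof.
rewrite -Win_chain; last exact: weakB_up.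
by apply: eq_Win => t _; rewrite add0r.
Qed.

(** The game is determined by trees: a winning strategy meets every weakly null tree ([Win_tree]),
    and without one some weakly null tree defeats the player ([not_Win_tree]). *)
Lemma alpha_leP xi (r : \bar R) (A : {linear X -> Y}) a : (1 <= r)%E -> 0 <= a ->
  (alpha xi r A <= a%:E)%E <->
  forall cs b, a * snorm r cs < b ->
    chain (Q (@weakB R k X) xi) cs [set w | rnorm (A w) < b] 0.
Proof.
move=> r1 a0; split=> [Aa cs b ab|h].
  have s0 : 0 <= snorm r cs by exact: lp_norm_ge0.
  have b0 : 0 < b by apply: le_lt_trans ab; exact: mulr_ge0.
  (* The supremum in [alpha] starts at n = 1, so the empty list is treated apart. *)
  case cs0 : (size cs == 0)%N.
    by move: cs0; rewrite size_eq0 => /eqP -> /=; rewrite linear0 -(ltr_of_real k)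
      of_real_rnorm normr0 -(of_real0 R k) ltr_of_real.
  have n0 : (0 < size cs)%N by rewrite lt0n cs0.
  have Ana : (alpha_n xi r (size cs) A <= a%:E)%E.
    by apply: le_trans Aa; apply: ereal_sup_ubound; exists (size cs).
  (* A constant above a below which the bound by b persists; if the norm of [cs] vanishes, any
     constant above a will do. *)
  have [a' [aa' a'b]] : exists a', a < a' /\ forall a0, a0 < a' -> a0 * snorm r cs < b.
    have [->|sn0] := eqVneq (snorm r cs) 0.
      by exists (a + 1); rewrite ltrDl; split=> // ?; rewrite mulr0.
    have {}sn0 : 0 < snorm r cs by rewrite lt_neqAle eq_sym sn0.
    exists (b / snorm r cs); rewrite ltr_pdivlMr//; split=> // a1.
    by rewrite ltr_pdivlMr.
  have : (alpha_n xi r (size cs) A < a'%:E)%E by apply: le_lt_trans Ana _; rewrite lte_fin.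
  move=> /ereal_inf_lt [_ [a1 [a10 H] <-]]; rewrite lte_fin => /a'b a1b.
  apply: contrapT; rewrite -Win_chain_weak => /(not_Win_tree n0).
  move=> [D [leD [x [dir xnull x1 nK]]]].
  have := H D leD dir (fun i => cs`_i) x xnull x1.
  move=> /le_lt_trans => /(_ b%:E); rewrite lte_fin => /(_ a1b).
  move=> /ereal_inf_lt [_ [t tm <-]]; rewrite lte_fin => tb.
  by apply: (nK t tm) => /=; under eq_bigr do rewrite -block_sum_posx.
(* Two slacks are used: [e] makes the constant positive, as [alpha_n] requires, and [d] below yields
   the strict inequality that the hypothesis [h] takes. *)
apply: ge_ereal_sup => _ [n n1 <-]; apply/lee_addgt0Pr => e e0.
apply: ereal_inf_lbound; exists (a + e); last by rewrite EFinD.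
split; first by rewrite ltr_wpDl.
move=> D leD dir c x xnull x1; apply/lee_addgt0Pr => d d0.
have [cs [szcs csE]] : exists cs : seq K, size cs = n /\ forall i : 'I_n, cs`_i = c i.
  exists [seq c i | i <- enum 'I_n]; rewrite size_map size_enum_ord; split=> // i.
  by rewrite (nth_map i) ?size_enum_ord// nth_ord_enum.
case: n / szcs n1 c xnull x1 csE => n1 c xnull x1 csE.
have snE : snorm r cs = lp_norm r (fun i => rnorm (c i : K)).
  by congr lp_norm; apply/funext => i; rewrite csE.
rewrite -snE -EFinD; have s0 : 0 <= snorm r cs by exact: lp_norm_ge0.
have : a * snorm r cs < (a + e) * snorm r cs + d.
  by rewrite mulrDl -addrA ltrDl ltr_wpDl// mulr_ge0// ltW.
move=> /h; rewrite -Win_chain_weak => /(Win_tree n1 dir xnull x1)[t tm /= tb].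
apply: (@le_trans _ _ (rnorm (A (\sum_(i < size cs) c i *: block_sum xi (size cs) x i.+1 t)))%:E).
  by apply: ereal_inf_lbound; exists t.
under eq_bigr do rewrite block_sum_posx -csE.
by rewrite lee_fin ltW.
Qed.

End alpha_chain.

(** * Convex sets that can be forced *)

Lemma of_realB (R : realType) (k : scalar_kind) (x y : R) :
  of_real k (x - y) = of_real k x - of_real k y.
Proof. by apply/eqP; rewrite eq_sym subr_eq -of_realD subrK. Qed.

Section convex.
Variables (R : realType) (k : scalar_kind) (Z : lmodType (scalars R k)).
Local Notation K := (scalars R k).
Local Notation "r %:K" := (@of_real R k r) (at level 1, format "r %:K").
Implicit Types (P : set Z) (q F : set (set Z)) (cs : seq K) (w : Z).

Definition cvx P := forall (t : R) u v, 0 <= t <= 1 -> P u -> P v ->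
  P (t%:K *: u + (1 - t)%:K *: v).

Definition cone P (c : R) : set Z := [set v | exists2 e, P e & v = c%:K *: e].

(** The point (c e + d f)/(c+d) of the convex set realizes the sum; c = d = 0 is apart because of
    the quotient. *)
Lemma coneD P c d u v : cvx P -> 0 <= c -> 0 <= d -> cone P c u -> cone P d v ->
  cone P (c + d) (u + v).
Proof.
move=> Pc c0 d0 [e Pe ->] [f Pf ->].
have [cd0|cd0] := eqVneq (c + d) 0.
  have /andP[/eqP -> /eqP ->] : (c == 0) && (d == 0) by rewrite -paddr_eq0// cd0.
  by exists e => //; rewrite of_real0 addr0 of_real0 !scale0r addr0.
have cd_gt0 : 0 < c + d by rewrite lt_neqAle eq_sym cd0 addr_ge0.
exists ((c / (c + d))%:K *: e + (1 - c / (c + d))%:K *: f).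
  apply: Pc => //; apply/andP; split; first by rewrite divr_ge0// ltW.
  by rewrite ler_pdivrMr// mul1r lerDl.
rewrite scalerDr !scalerA -!of_realM mulrBr mulr1 mulrCA divff// mulr1.
by rewrite [c + d]addrC addrK.
Qed.

Lemma coneZ P l c u : cone P c u -> cone P (l * c) (l%:K *: u).
Proof. by move=> [e Pe ->]; exists e => //; rewrite scalerA of_realM. Qed.

Lemma cone1 P u : cone P 1 u <-> P u.
Proof.
rewrite /cone /= of_real1; split=> [[e Pe ->]|Pu]; first by rewrite scale1r.
by exists u => //; rewrite scale1r.
Qed.

Lemma cvxI P P' : cvx P -> cvx P' -> cvx (P `&` P').
Proof. by move=> Pc Pc' t u v t01 [Pu Pu'] [Pv Pv']; split; [exact: Pc|exact: Pc']. Qed.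

Lemma of_real_onem (t : R) : t%:K + (1 - t)%:K = 1.
Proof. by rewrite -of_realD addrC subrK of_real1. Qed.

Lemma cvx_comb (t : R) (w : Z) : t%:K *: w + (1 - t)%:K *: w = w.
Proof. by rewrite -scalerDl of_real_onem scale1r. Qed.

Definition up q := forall P P', P `<=` P' -> q P -> q P'.
Definition proper q := forall P, q P -> exists z, P z.
Definition cvx_and q := forall P P', cvx P -> cvx P' -> q P -> q P' -> q (P `&` P').

Section chain_theory.
Variables (q : set (set Z)) (q_up : up q).

Lemma chain_mono cs P P' w : P `<=` P' -> chain q cs P w -> chain q cs P' w.
Proof.
move=> PP'; elim: cs w => [|c cs IH] w /=; first exact: PP'.
by apply: q_up => z; exact: IH.
Qed.

Lemma chain_cat cs ds P w : chain q (cs ++ ds) P w = chain q cs (chain q ds P) w.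
Proof. by elim: cs w => //= c cs IH w; congr q; apply/funext => z; exact: IH. Qed.

Lemma chain_affine (l : K) (w0 : Z) cs P w :
  chain q [seq l * c | c <- cs] P (w0 + l *: w) =
  chain q cs [set z | P (w0 + l *: z)] w.
Proof.
elim: cs w => //= c cs IH w; congr q; apply/funext => z /=.
by rewrite -IH -addrA -scalerA -scalerDr.
Qed.

Lemma chain_inhabited cs P w : proper q -> chain q cs P w -> exists z, P z.
Proof.
move=> qp; elim: cs w => [|c cs IH] w /=; first by exists w.
by move=> /qp [z]; exact: IH.
Qed.

Hypothesis q_and : cvx_and q.

Lemma cvx_affine P (a : K) w : cvx P -> cvx [set z | P (w + a *: z)].
Proof.
move=> Pc t u v t01 Pu Pv /=; have := Pc t _ _ t01 Pu Pv.
by rewrite !scalerDr addrACA cvx_comb !scalerA ![_%:K * a]mulrC.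
Qed.

(** By [cvx_and] the next block vector can be made good for the starting points u and v at once; it
    is then good for their convex combination, by induction. *)
Lemma chain_cvx cs P : cvx P -> cvx (chain q cs P).
Proof.
move=> Pc; elim: cs => [//|c cs IH] t u v t01 /= Pu Pv.
apply: q_up (q_and (cvx_affine IH) (cvx_affine IH) Pu Pv).
move=> z [Pu' Pv'] /=; have := IH t _ _ t01 Pu' Pv'.
by rewrite !scalerDr addrACA cvx_comb.
Qed.

Lemma chain_and cs P P' w : cvx P -> cvx P' -> chain q cs P w -> chain q cs P' w ->
  chain q cs (P `&` P') w.
Proof.
move=> Pc Pc'; elim: cs w => [//|c cs IH] w /= Pw Pw'.
apply: q_up (q_and (cvx_affine (chain_cvx Pc)) (cvx_affine (chain_cvx Pc')) Pw Pw').
by move=> z [Pz Pz']; exact: IH.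
Qed.

End chain_theory.

(* Playing [n] blocks [m] times over averages [m] points of the convex set [P]. *)
Lemma chain_mul q m n P : up q -> proper q -> cvx P -> (0 < m)%N -> (0 < n)%N ->
  chain q (nseq n (n%:R^-1)%:K) P 0 ->
  chain q (nseq (m * n) ((m * n)%:R^-1)%:K) P 0.
Proof.
move=> qu qp Pc m0 n0 Pn; have mn0 : (m%:R : R) != 0 by rewrite pnatr_eq0 -lt0n.
(* Invariant: after i rounds w is i/m times a point of [P], by [coneD]. It holds at i = 0 because
   [P] is nonempty. *)
suff main j i w : (i + j = m)%N -> cone P (i%:R / m%:R) w ->
    chain q (nseq (j * n) ((m * n)%:R^-1)%:K) P w.
  apply: (main m 0%N); first by [].
  have [e Pe] := chain_inhabited qp Pn.
  by exists e => //; rewrite mul0r of_real0 scale0r.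
elim: j i w => [|j IH] i w.
  by rewrite addn0 => -> /=; rewrite divff// => /cone1.
move=> ijm wP; rewrite mulSn nseqD chain_cat.
have -> : nseq n ((m * n)%:R^-1)%:K = [seq (m%:R^-1)%:K * c | c <- nseq n (n%:R^-1)%:K].
  by rewrite map_nseq -of_realM natrM invfM.
rewrite -[w]addr0 -[X in _ + X](scaler0 _ (m%:R^-1)%:K) chain_affine.
apply: chain_mono Pn => // z Pz /=; apply: (IH i.+1); first by rewrite addSnnS.
rewrite -addn1 natrD mulrDl; apply: coneD => //; rewrite ?divr_ge0//.
by exists z => //; rewrite mul1r.
Qed.

Section Q_theory.
Variables (F : set (set Z)) (F_up : up F) (F_proper : proper F).
Hypothesis F_I : forall P P', F P -> F P' -> F (P `&` P').

Lemma Q_up xi : up (Q F xi).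
Proof.
elim/ord_ind : xi => [|z IH|x lx IH] P P' PP'; first by rewrite Q_0; exact: F_up.
  by rewrite !Q_succ => -[n n1 h]; exists n => //; apply: chain_mono h.
by rewrite !Q_limit// => -[z zx h]; exists z => //; exact: IH (lx.2 _ zx) _ _ PP' h.
Qed.

Lemma Q_proper xi : proper (Q F xi).
Proof.
elim/ord_ind : xi => [|z IH|x lx IH] P; first by rewrite Q_0; exact: F_proper.
  by rewrite !Q_succ => -[n n1]; exact: chain_inhabited.
by rewrite !Q_limit// => -[z zx]; exact: IH (lx.2 _ zx) P.
Qed.

Lemma Q_le_succ z P : Q F z P -> Q F (osucc z) P.
Proof.
move=> h; rewrite Q_succ; exists 1%N => //=; apply: Q_up h => y /=.
by rewrite invr1 of_real1 scale1r add0r.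
Qed.

Lemma Q_le a b P : ole a b -> Q F a P -> Q F b P.
Proof.
elim/ord_ind : b a P => [|z IH|x lx IH] a P ab Qa.
- have [/olt0//|<-//|a0] := olt_total a ozero.
  by case: (@olt_irrefl a); exact: ole_olt_trans a0.
- have [az|<-//|za] := olt_total a (osucc z).
    by apply: Q_le_succ; apply: IH Qa; exact: lt_osucc.
  by case: (@olt_irrefl a); exact: ole_olt_trans za.
- have [ax|<-//|xa] := olt_total a x; last by case: (@olt_irrefl a); exact: ole_olt_trans xa.
  by rewrite Q_limit//; exists a => //; exact: Q_le_succ.
Qed.

Lemma Q_F xi P : F P -> Q F xi P.
Proof.
move=> FP; apply: (@Q_le ozero); last by rewrite Q_0.
by have [//|/olt0] := ole_total ozero xi.
Qed.

(** At a successor, n blocks repeated m times and m blocks repeated n times both become mn blocks of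
    equal weight, on which [chain_and] intersects the targets. At a limit the larger of the two
    ordinals serves both. *)
Lemma Q_and xi : cvx_and (Q F xi).
Proof.
elim/ord_ind : xi => [|z IH|x lx IH] P P' Pc Pc'.
- by rewrite Q_0; exact: F_I.
- rewrite !Q_succ => -[n n0 Pn] [m m0 Pm].
  exists (m * n)%N; first by rewrite muln_gt0 m0.
  apply: chain_and => //; first exact: Q_up.
    exact: chain_mul (@Q_up z) (@Q_proper z) Pc m0 n0 Pn.
  by rewrite mulnC; exact: chain_mul (@Q_up z) (@Q_proper z) Pc' n0 m0 Pm.
rewrite !Q_limit// => -[z zx Pz] [y yx Py].
have le_succ a b : ole a b -> ole (osucc a) (osucc b).
  by move=> ab; apply: osucc_le; apply: ole_olt_trans ab (olt_osucc _).
have [zy|yz] := ole_total z y.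
  exists y => //; apply: IH => //; first exact: lx.2.
  by apply: Q_le Pz; exact: le_succ.
exists z => //; apply: IH => //; first exact: lx.2.
by apply: Q_le Py; exact/le_succ/plt_ple.
Qed.

End Q_theory.

Lemma Q_sub F F' xi P : up F -> F `<=` F' -> Q F xi P -> Q F' xi P.
Proof.
move=> Fu FF'; elim/ord_ind : xi P => [|z IH|x lx IH] P; first by rewrite !Q_0; exact: FF'.
  rewrite !Q_succ => -[n n1 h]; exists n => //.
  elim: (nseq n _) 0 h => [//|c cs IHcs] w /= h.
  by apply: IH; apply: Q_up h => // y; exact: IHcs.
by rewrite !Q_limit// => -[z zx h]; exists z => //; apply: IH h; exact: lx.2.
Qed.

End convex.

Section pushforward.
Variables (R : realType) (k : scalar_kind) (Z Z' : lmodType (scalars R k)).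
Variable T : {linear Z -> Z'}.

Definition push (F : set (set Z)) : set (set Z') := [set P | F (T @^-1` P)].

Lemma chain_push q q' cs P w : (forall P, q' P = q (T @^-1` P)) ->
  chain q' cs P (T w) = chain q cs (T @^-1` P) w.
Proof.
move=> qq'; elim: cs w => //= c cs IH w; rewrite qq'; congr q.
by apply/funext => z /=; rewrite -IH linearD linearZ.
Qed.

(** Block vectors are linear combinations of the moves, so [T] may be applied to the moves or to the
    result. *)
Lemma Q_push F xi P : Q (push F) xi P = Q F xi (T @^-1` P).
Proof.
elim/ord_ind : xi P => [|z IH|x lx IH] P; first by rewrite !Q_0.
  rewrite !Q_succ; apply/propext; split=> -[n n1 h]; exists n => //;
    by move: h; rewrite -(linear0 T) (chain_push _ _ _ IH).
by rewrite !Q_limit//; apply/propext; split=> -[z zx h]; exists z => //;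
  move: h; rewrite IH//; exact: lx.2.
Qed.

End pushforward.

Section rnorm_theory.
Variables (R : realType) (k : scalar_kind).
Local Notation K := (scalars R k).
Local Notation "r %:K" := (@of_real R k r) (at level 1, format "r %:K").

Lemma rnorm_of_real (c : R) : 0 <= c -> rnorm (c%:K : K) = c.
Proof.
move=> c0; rewrite /rnorm ger0_norm ?of_realK// -(of_real0 R k) ler_of_real//.
Qed.

Lemma of_realX (x : R) : x != 0 -> x%:K * (x^-1)%:K = 1.
Proof. by move=> x0; rewrite -of_realM divff// of_real1. Qed.

(** Error bookkeeping for [state_step]: [x - (s + v)] is the old error, [y - u] that of the new
    move, and [v + u - e] the overflow lost when a slot is closed. *)
Lemma subr_split (U : zmodType) (x y s v u e : U) :
  x + y - (s + e) = x - (s + v) + (y - u) + (v + u - e).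
Proof.
have -> : x - (s + v) + (y - u) = x + y - (s + (v + u)).
  by rewrite [s + (v + u)]addrA [- (s + v + u)]opprD addrACA.
by move: (v + u) (x + y) => a b; rewrite !opprD !addrA subrK.
Qed.

Variable V : normedModType K.
Implicit Types (v w : V).

Lemma rnorm_scale (c : R) v : 0 <= c -> rnorm (c%:K *: v) = c * rnorm v.
Proof. by move=> c0; rewrite rnormZ rnorm_of_real. Qed.

Lemma rnormN v : rnorm (- v) = rnorm v.
Proof. by rewrite /rnorm normrN. Qed.

Lemma rnorm0 : rnorm (0 : V) = 0.
Proof. by rewrite /rnorm normr0 -(of_real0 R k) of_realK. Qed.

Lemma cvx_ball (e : R) : cvx [set v : V | rnorm v <= e].
Proof.
move=> t u v /andP[t0 t1] /= ue ve; apply: le_trans (rnormD _ _) _.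
have s0 : 0 <= 1 - t by rewrite subr_ge0.
rewrite !rnorm_scale//; have -> : e = t * e + (1 - t) * e by ring.
by apply: lerD; exact: ler_wpM2l.
Qed.

End rnorm_theory.

(** * Games in which the moves are weighted by their norms *)

Section weights.
Variables (R : realType) (k : scalar_kind) (V : normedModType (scalars R k)).
Local Notation K := (scalars R k).
Local Notation "r %:K" := (@of_real R k r) (at level 1, format "r %:K").
Implicit Types (E : set V) (d : R).

(* [u.2] is the accumulated norm, and [u.1] is [d]-close to [u.2 * E]. *)
Definition fat E d : set (V * K^o)%type := [set u | exists c : R,
  [/\ 0 <= c <= 1, u.2 = c%:K & exists2 v, cone E c v & rnorm (u.1 - v) <= d]].

Lemma cvx_fat E d : cvx E -> cvx (fat E d).
Proof.
move=> Ec t u v t01 [c [/andP[c0 c1] uc [x xc ux]]] [c' [/andP[c'0 c'1] vc [y yc vy]]].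
have /andP[t0 t1] := t01.
have s0 : 0 <= 1 - t by rewrite subr_ge0.
exists (t * c + (1 - t) * c'); split.
- apply/andP; split; first by rewrite addr_ge0// mulr_ge0.
  by nra.
- by rewrite /= uc vc [RHS]of_realD !of_realM.
exists (t%:K *: x + (1 - t)%:K *: y).
  by apply: coneD => //; [exact: mulr_ge0|exact: mulr_ge0|exact: coneZ|exact: coneZ].
have -> /= : (t%:K *: u + (1 - t)%:K *: v).1 - (t%:K *: x + (1 - t)%:K *: y) =
    t%:K *: (u.1 - x) + (1 - t)%:K *: (v.1 - y).
  by rewrite !scalerBr opprD addrACA.
exact: (cvx_ball t01 ux vy).
Qed.

Section machine.
Variables (q : set (set V)) (qh : set (set (V * K^o)%type)).
Hypotheses (q_up : up q) (q_proper : proper q) (q_and : cvx_and q).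
Hypothesis q_ball : q [set v | rnorm v <= 1].
Hypothesis qh_up : up qh.
Hypothesis q_fat : forall E, cvx E -> E `<=` [set v | rnorm v <= 1] -> q E ->
  forall d, 0 < d -> qh (fat E d).
Variables (E : set V) (n : nat) (M del : R).
Hypotheses (Ec : cvx E) (E1 : E `<=` [set v | rnorm v <= 1]).
Hypotheses (M0 : 0 < M) (del0 : 0 < del).
Local Notation ni := ((n.+1)%:R^-1)%:K.
Hypothesis qE : chain q (nseq n.+1 ni) E 0.

(** The points that may fill the current slot when j slots follow it and w is the weighted sum over
    the slots already filled. *)
Let slot j w : set V := [set e | chain q (nseq j ni) E (w + ni *: e)] `&` [set e | rnorm e <= 1].

Let slot_cvx j w : cvx (slot j w).
Proof. by apply: cvxI; [exact: (cvx_affine (chain_cvx q_up q_and Ec))|exact: cvx_ball]. Qed.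

Let slot_q j w : chain q (nseq j.+1 ni) E w -> q (slot j w).
Proof. by move=> h; apply: q_and => //; [exact: (cvx_affine (chain_cvx q_up q_and Ec))|exact: cvx_ball]. Qed.

(* State after [N] moves with total [Z] and total norm [C].  Each of the [n.+1]
   slots of a round is filled until its mass reaches [M]; [rho] rounds are
   complete, with total [g], the current round has the average [w] so far, and its
   current slot, followed by [j] empty ones, contains [v] of mass [m]. *)
Let state (N : nat) (Z : V) (C : R) : Prop :=
  exists (j rho : nat) (w v g : V) (m : R), let cl : R := (rho * n.+1 + (n - j))%:R in
  [/\ [/\ (j <= n)%N, chain q (nseq j.+1 ni) E w & rnorm w <= (n - j)%:R / n.+1%:R],
      [/\ 0 <= m, m <= M & cone (slot j w) m v],
      cone E (rho%:R * (n.+1%:R * M)) g,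
      rnorm (Z - (g + (n.+1%:R * M)%:K *: w + v)) <= N%:R * del + cl &
      [/\ cl * M + m <= C, C <= cl * M + m + cl & C <= N%:R]].

Let start_slot j w : chain q (nseq j.+1 ni) E w -> cone (slot j w) 0 0.
Proof. by move=> /slot_q /q_proper[e he]; exists e => //; rewrite of_real0 scale0r. Qed.

Let state0 : state 0 0 0.
Proof.
exists n, 0%N, 0, 0, 0, 0; rewrite /= subnn mul0n addn0; split.
- by split=> //; rewrite rnorm0 mul0r.
- by split=> //; [exact: ltW|exact: start_slot].
- have [e Ee] := chain_inhabited q_proper qE.
  by exists e => //; rewrite mul0r of_real0 scale0r.
- by rewrite scaler0 !addr0 subr0 rnorm0 !mul0r.
- by rewrite !mul0r !addr0.
Qed.

(** By [q_fat] for the current slot, the new move z with recorded norm c is [del]-close to a point u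
    of c times the slot. A slot whose mass m + c exceeds M is closed and cut down to M; this loses
    at most c <= 1, in mass as in norm, which accounts for the error terms [cl]. *)
Let state_step N Z C : state N Z C ->
  qh [set y | exists2 c : R, y.2 = c%:K & state N.+1 (Z + y.1) (C + c)].
Proof.
move=> [j [rho [w [v [g [m [] [jn wE w1] [m0 mM vm] gE]]]]]].
set cl := (_ + _)%N => Zerr [C1 C2 C3].
have SlE : slot j w `<=` [set e | rnorm e <= 1] by move=> e [].
apply: qh_up (q_fat (@slot_cvx j w) SlE (slot_q wE) del0) => -[z _] [c [/andP[c0 c1] /= -> [u uc zu]]].
exists c => //=.
have vu : cone (slot j w) (m + c) (v + u) by exact: coneD.
have S1 : N.+1%:R = N%:R + 1 :> R by rewrite -addn1 natrD.
have CN : C + c <= N.+1%:R by rewrite S1; exact: lerD.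
have [mcM|Mmc] := leP (m + c) M.
  exists j, rho, w, (v + u), g, (m + c); split=> //.
  - by split=> //; exact: addr_ge0.
  - rewrite -/cl [_ + (v + u)]addrA opprD addrACA.
    by apply: le_trans (rnormD _ _) _; rewrite S1; lra.
  - by rewrite -/cl; split=> //; lra.
have [e [eE e1] ve] := vu.
have cl1 : cl.+1%:R = cl%:R + 1 :> R by rewrite -addn1 natrD.
have w'1 : rnorm (w + ni *: e) <= (n - j).+1%:R / n.+1%:R.
  apply: le_trans (rnormD _ _) _; rewrite rnorm_scale ?invr_ge0//.
  rewrite -[(n - j).+1]addn1 [(_ + 1)%:R]natrD mulrDl; apply: lerD => //.
  by rewrite mul1r ler_piMr// invr_ge0.
have err : rnorm (Z + z - (g + (n.+1%:R * M)%:K *: (w + ni *: e))) <= N.+1%:R * del + cl.+1%:R.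
  have -> : (n.+1%:R * M)%:K *: (w + ni *: e) = (n.+1%:R * M)%:K *: w + M%:K *: e.
    rewrite scalerDr scalerA -of_realM; congr (_ + _ *: _).
    by rewrite mulrAC divff ?mul1r// pnatr_eq0.
  have -> : Z + z - (g + ((n.+1%:R * M)%:K *: w + M%:K *: e)) =
     (Z - (g + (n.+1%:R * M)%:K *: w + v)) + (z - u) + ((v + u) - M%:K *: e).
    by rewrite [in LHS]addrA; exact: subr_split.
  apply: le_trans (rnormD _ _) _; apply: le_trans (lerD (rnormD _ _) (lexx _)) _.
  have -> : v + u - M%:K *: e = (m + c - M)%:K *: e by rewrite ve of_realB scalerBl.
  have mcM0 : 0 <= m + c - M by rewrite subr_ge0 ltW.
  rewrite rnorm_scale// S1 cl1.
  have : (m + c - M) * rnorm e <= 1 by apply: mulr_ile1; rewrite ?rnorm_ge0//; lra.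
  by lra.
have C1' : cl.+1%:R * M + 0 <= C + c by rewrite cl1; lra.
have C2' : C + c <= cl.+1%:R * M + 0 + cl.+1%:R by rewrite cl1; lra.
(* If the closed slot was the last of its round, [w + ni *: e] is a point of [E] and the round
   contributes (n+1)M times this point to g; otherwise the next slot is opened. *)
case jE : j => [|i].
  have cl'E : (rho.+1 * n.+1 + (n - n))%N = cl.+1.
    by rewrite /cl jE subnn subn0 addn0 mulSn addnC addnS.
  rewrite /= jE /= in eE.
  exists n, rho.+1, 0, 0, (g + (n.+1%:R * M)%:K *: (w + ni *: e)), 0; rewrite cl'E; split=> //.
  - by split=> //; rewrite rnorm0 subnn mul0r.
  - by split=> //; [exact: ltW|exact: start_slot].
  - rewrite -addn1 natrD mulrDl mul1r; apply: coneD => //.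
    + by rewrite !mulr_ge0// ltW.
    + by rewrite mulr_ge0// ltW.
    by rewrite -[X in cone E X](mulr1); apply: coneZ; apply/cone1.
  - by rewrite scaler0 !addr0.
have iltn : (i < n)%N by rewrite -jE.
have cl'E : (rho * n.+1 + (n - i))%N = cl.+1 by rewrite /cl jE -subnSK// addnS.
rewrite jE in eE w'1; rewrite subnSK// in w'1.
exists i, rho, (w + ni *: e), 0, g, 0; rewrite cl'E; split=> //.
- by split=> //; exact: ltnW.
- by split=> //; [exact: ltW|exact: start_slot].
- by rewrite addr0.
Qed.

(** Z is compared with C e, where g = rho (n+1) M e. The errors are N del <= N d/4; the losses cl,
    counted twice, with cl <= N/M <= N d/8; and the incomplete round of norm at most (n+1)M + M,
    counted twice, which is at most N d/4 by the lower bound on N. The total is below N d. *)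
Let state_end N Z C d : (0 < N)%N -> del <= d / 4 -> 8 / d <= M ->
  2 * (n.+1%:R + 1) * M <= N%:R * (d / 4) -> 0 < d ->
  state N Z C -> fat E d ((N%:R^-1)%:K *: (Z, C%:K : K^o)).
Proof.
move=> N0 deld Md nMN d0 [j [rho [w [v [g [m [] [jn wE w1] [m0 mM vm] gE]]]]]].
set cl := (_ + _)%N => Zerr [C1 C2 C3].
have Nr0 : 0 < N%:R :> R by rewrite ltr0n.
have cl0 : 0 <= cl%:R :> R by [].
have C0 : 0 <= C by apply: le_trans C1; rewrite addr_ge0// mulr_ge0// ltW.
have [e Ee ge] := gE.
exists (N%:R^-1 * C); split.
- apply/andP; split; first by rewrite mulr_ge0// invr_ge0.
  by rewrite mulrC ler_pdivrMr// mul1r.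
- by rewrite /= of_realM.
exists ((N%:R^-1)%:K *: (C%:K *: e)); first by apply: coneZ; exists e.
rewrite /= -scalerBr rnorm_scale ?invr_ge0// mulrC ler_pdivrMr//.
set a := n.+1%:R * M in Zerr ge *.
have a0 : 0 < a by rewrite mulr_gt0.
have w1' : rnorm w <= 1.
  by apply: le_trans w1 _; rewrite ler_pdivrMr// mul1r ler_nat (leq_trans (leq_subr _ _)).
have v1 : rnorm v <= M.
  have [f [_ f1] ->] := vm; rewrite rnorm_scale//.
  by apply: le_trans mM; rewrite ler_piMr.
have cD : C - rho%:R * a = (C - (cl%:R * M + m)) + (n - j)%:R * M + m.
  by rewrite /cl natrD natrM /a; ring.
have cD0 : 0 <= C - rho%:R * a.
  rewrite cD; apply: addr_ge0 => //; apply: addr_ge0; first by rewrite subr_ge0.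
  by rewrite mulr_ge0// ltW.
have njM : (n - j)%:R * M <= a.
  by rewrite /a ler_pM2r// ler_nat (leq_trans (leq_subr _ _)).
have -> : Z - C%:K *: e = (Z - (g + a%:K *: w + v)) + (a%:K *: w + v - (C - rho%:R * a)%:K *: e).
  rewrite of_realB scalerBl -ge opprB -[g + _ + v]addrA; set y := _ + v.
  by rewrite [y + (g - _)]addrA [y + g]addrC addrA subrK.
have De : rnorm ((C - rho%:R * a)%:K *: e) <= C - rho%:R * a.
  by rewrite rnorm_scale// ler_piMr//; exact: E1.
have awv : rnorm (a%:K *: w + v) <= a + M.
  apply: le_trans (rnormD _ _) _; rewrite rnorm_scale; last exact: ltW.
  by apply: lerD => //; rewrite ler_piMr// ltW.
apply: le_trans (rnormD _ _) _.
apply: le_trans (lerD Zerr (rnormD _ _)) _; rewrite rnormN.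
have DE : C - rho%:R * a <= cl%:R + a + M by rewrite cD; lra.
have clM : cl%:R * M <= N%:R by lra.
have cld : cl%:R <= N%:R * (d / 8).
  rewrite -(ler_pM2r M0); apply: le_trans clM _.
  rewrite -mulrA ler_peMr// -ler_pdivrMl ?divr_gt0//.
  by rewrite invf_div mulr1.
have Nd : N%:R * del <= N%:R * (d / 4) by rewrite ler_pM2l.
have aE : 2 * (n.+1%:R + 1) * M = 2 * a + 2 * M by rewrite /a; ring.
rewrite aE in nMN.
have -> : d * N%:R = N%:R * (d / 4) * 4 by field.
have -> : N%:R * (d / 4) * 4 = N%:R * (d / 4) + N%:R * (d / 8) * 2 + N%:R * (d / 4) * 2 by field.
by lra.
Qed.

Lemma chain_fat d : 0 < d -> del <= d / 4 -> 8 / d <= M ->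
  exists2 N, (0 < N)%N & chain qh (nseq N (N%:R^-1)%:K) (fat E d) 0.
Proof.
move=> d0 deld Md.
(* N is so large that one incomplete round is negligible in the average. *)
pose N := (Num.truncn (2 * (n.+1%:R + 1) * M / (d / 4))).+1.
have NN : 2 * (n.+1%:R + 1) * M <= N%:R * (d / 4).
  by rewrite -ler_pdivrMr ?divr_gt0// ltW// truncnS_gt.
exists N => //.
suff main r i Z C : (i + r = N)%N -> state i Z C ->
    chain qh (nseq r (N%:R^-1)%:K) (fat E d) ((N%:R^-1)%:K *: (Z, C%:K : K^o)).
  have := main N 0%N 0 0 erefl state0; rewrite of_real0.
  by rewrite -[(0, 0)]/(0 : V * K^o)%type scaler0.
elim: r i Z C => [|r IH] i Z C; first by rewrite addn0 => ->; exact: state_end.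
move=> irN /state_step; apply: qh_up => -[z _] [c /= -> st].
rewrite -scalerDr; have -> : (Z, C%:K : K^o) + (z, c%:K) = (Z + z, (C + c)%:K : K^o).
  by rewrite of_realD.
by apply: IH st; rewrite addSnnS.
Qed.

End machine.
Variables (F : set (set V)) (G : set (set (V * K^o)%type)).
Hypotheses (F_up : up F) (F_proper : proper F).
Hypothesis F_I : forall P P', F P -> F P' -> F (P `&` P').
Hypothesis F_ball : F [set v | rnorm v <= 1].
Hypothesis G_up : up G.
Hypothesis F_fat : forall E d, F E -> 0 < d -> G (fat E d).

(** In the successor step the induction hypothesis is the rule [q_fat] of the slot construction,
    which is run with capacity M = 8/d and accuracy d/4. *)
Theorem Q_fat xi E d : cvx E -> E `<=` [set v | rnorm v <= 1] -> Q F xi E -> 0 < d ->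
  Q G xi (fat E d).
Proof.
elim/ord_ind : xi E d => [|z IH|x lx IH] E d Ec E1.
- by rewrite !Q_0; exact: F_fat.
- rewrite !Q_succ => -[[//|n] _ qE] d0.
  have M0 : 0 < 8 / d by rewrite divr_gt0.
  have del0 : 0 < d / 4 by rewrite divr_gt0.
  have [N N0 h] := chain_fat (@Q_up _ _ _ _ F_up z) (@Q_proper _ _ _ _ F_proper z)
    (@Q_and _ _ _ _ F_up F_proper F_I z) (Q_F F_up z F_ball) (@Q_up _ _ _ _ G_up z)
    (fun E Ec EB qE d => IH E d Ec EB qE) Ec E1 M0 del0 qE d0 (lexx _) (lexx _).
  by exists N.
- rewrite !Q_limit// => -[z zx h] d0; exists z => //; apply: IH => //; exact: lx.2.
Qed.

End weights.

(** * Direct sums *)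

Lemma chain_shift (R : realType) (k : scalar_kind) (Z : lmodType (scalars R k))
    (q : set (set Z)) cs P w0 w :
  chain q cs P (w0 + w) = chain q cs [set z | P (w0 + z)] w.
Proof.
elim: cs w => //= c cs IH w; congr q; apply/funext => z /=.
by rewrite -IH addrA.
Qed.

Lemma chain_sub (R : realType) (k : scalar_kind) (Z : lmodType (scalars R k))
    (q q' : set (set Z)) cs P w : up q -> q `<=` q' -> chain q cs P w -> chain q' cs P w.
Proof.
move=> qu qq'; elim: cs w => //= c cs IH w h; apply: qq'.
by apply: qu h => z; exact: IH.
Qed.

Section weak_maps.
Variables (R : realType) (k : scalar_kind).
Local Notation K := (scalars R k).
Local Notation "r %:K" := (@of_real R k r) (at level 1, format "r %:K").

Lemma weakB_proper (X : completeNormedModType K) : proper (@weakB R k X).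
Proof. by move=> P /weakB_0; exists 0. Qed.

Lemma weakB_and (X : completeNormedModType K) (P P' : set X) :
  weakB P -> weakB P' -> weakB (P `&` P').
Proof. by move=> WP WP'; apply: (weakB_I WP WP'). Qed.

Lemma weakB_unit (X : completeNormedModType K) : weakB [set x : X | rnorm x <= 1].
Proof. exact: weakB_ball. Qed.

Lemma rnorm_contract_continuous (X Y : normedModType K) (T : {linear X -> Y}) :
  (forall x, rnorm (T x) <= rnorm x) -> continuous T.
Proof.
move=> T1; apply: bounded_linear_continuous; apply/linear_boundedP.
near=> r => x; have r1 : 1 <= r by near: r; apply: nbhs_pinfty_ge; exact: real1.
rewrite -[leLHS]of_real_rnorm; apply: (@le_trans _ _ `|x|).
  by rewrite -[leRHS]of_real_rnorm ler_of_real.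
by rewrite ler_peMl.
Unshelve. all: by end_near. Qed.

Lemma rnorm_bounded (X Y : normedModType K) (T : {linear X -> Y}) : continuous T ->
  exists2 C, 0 <= C & forall x, rnorm (T x) <= C * rnorm x.
Proof.
move=> /(_ 0) /(@continuous_linear_bounded _ _ _ 0 T) /linear_boundedP /pinfty_ex_gt0 [M M0 TM].
exists (to_real M) => [|x]; first by rewrite -(ler_of_real k) of_real0 to_realK ltW.
by rewrite -(ler_of_real k) of_realM !of_real_rnorm to_realK// ltW.
Qed.

Lemma weakB_pull (X Y : completeNormedModType K) (T : {linear X -> Y}) S :
  (forall x, rnorm (T x) <= rnorm x) -> weakB S -> weakB (T @^-1` S).
Proof.
move=> T1; have Tc := rnorm_contract_continuous T1.
elim=> {}S => [h|f e fc e0 h|S1 S2 _ W1 _ W2 h].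
- by apply: weakB_ball => x x1; apply: h; exact: le_trans x1.
- apply: (@weakB_fun _ _ _ _ (f \o T : {linear X -> K^o}) e) => // [x|x /= xe].
    by apply: continuous_comp; [exact: Tc|exact: fc].
  exact: h.
- by apply: (weakB_I W1 W2) => x; exact: h.
Qed.

(** If the norm of v is at least d, then v divided by its norm lies in [E] as soon as v is in a
    suitable set of the filter: for a functional f and c >= d, |f v| < d e gives |f (v/c)| < e. A
    shorter v is d-close to 0, which belongs to [E]. *)
Lemma weakB_fat (X : completeNormedModType K) (E : set X) d : weakB E -> 0 < d ->
  weakB [set v | fat E d (v, (rnorm v)%:K)].
Proof.
move=> WE d0.
have WE' : weakB [set v : X | forall c, d <= c -> rnorm v <= c -> E ((c^-1)%:K *: v)].
  elim: WE => {}E => [h|f e fc e0 h|S1 S2 _ W1 _ W2 h].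
  - apply: weakB_ball => v _ c dc vc; have c0 : 0 < c by exact: lt_le_trans dc.
    by apply: h; rewrite rnorm_scale ?invr_ge0 ?(ltW c0)// mulrC ler_pdivrMr// mul1r.
  - have ed0 : 0 < d * e by rewrite mulr_gt0.
    apply: (weakB_fun fc ed0) => v fv c dc vc; have c0 : 0 < c by exact: lt_le_trans dc.
    apply: h; rewrite linearZ/= (rnorm_scale (V := K^o)) ?invr_ge0 ?(ltW c0)//.
    rewrite mulrC ltr_pdivrMr//; apply: lt_le_trans fv _.
    by rewrite mulrC ler_pM2l.
  - apply: (weakB_I W1 W2) => v h1 h2 c dc vc; apply: h; [exact: h1|exact: h2].
apply: (weakB_I WE' (weakB_unit X)) => v Ev v1.
exists (rnorm v); split=> //; first by rewrite rnorm_ge0.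
have [vd|dv] := ltP (rnorm v) d.
  exists 0; last by rewrite subr0 /= ltW.
  by exists 0; [exact: weakB_0|rewrite scaler0].
have v0 : rnorm v != 0 by rewrite gt_eqF// (lt_le_trans d0).
exists v; last by rewrite subrr rnorm0 ltW.
exists (((rnorm v)^-1)%:K *: v); first exact: Ev.
by rewrite scalerA of_realX// scale1r.
Qed.

Section sum_maps.
Variables (p : \bar R) (p1 : (1 <= p)%E) (L : finType).
Variable X : L -> completeNormedModType K.
Local Notation V := (lp_sum p1 X).

Definition coord l (x : V) : X l := x l.

Let coord_linear l : linear (@coord l).
Proof. by []. Qed.

HB.instance Definition _ l := GRing.isLinear.Build K V (X l) _ (@coord l) (@coord_linear l).

Lemma coord_contract l (x : V) : rnorm (coord l x) <= rnorm x.
Proof. by rewrite -(ler_of_real k) !of_real_rnorm; exact: lp_sum_coord. Qed.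

Lemma rnorm_lp_sum (x : V) : rnorm x = lp_norm p (fun l => rnorm (x l)).
Proof. by apply: (can_inj (@of_realK R k)); rewrite of_real_rnorm. Qed.

Definition inj l (v : X l) : V := eqtype.dfwith (fun j => 0 : X j) v.

Let inj_linear l : linear (@inj l).
Proof.
move=> c u v; apply/functional_extensionality_dep => j.
rewrite -[RHS]/(c *: inj u j + inj v j) /inj.
case: eqtype.dfwithP => [|{}j lj]; first by rewrite !dfwith_in.
by rewrite !dfwith_out// scaler0 addr0.
Qed.

HB.instance Definition _ l := GRing.isLinear.Build K (X l) V _ (@inj l) (@inj_linear l).

Lemma inj_in l (v : X l) : inj v l = v.
Proof. exact: dfwith_in. Qed.

Lemma inj_out l j (v : X l) : l != j -> inj v j = 0.
Proof. exact: dfwith_out. Qed.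

Lemma inj_contract l (v : X l) : rnorm (inj v) <= rnorm v.
Proof.
rewrite rnorm_lp_sum; case: p p1 => [q|_|] //=.
  rewrite lee_fin => q1; have q0 : q != 0 by rewrite gt_eqF// (lt_le_trans _ q1).
  rewrite (bigD1 l)//= big1 ?addr0 => [|j jl].
    by rewrite inj_in -powRrM divff// powRr1// ger0_norm // rnorm_ge0.
  by rewrite inj_out 1?eq_sym// rnorm0 normr0 powR0.
apply/bigmax_leP; split=> [|j _]; first exact: rnorm_ge0.
have [<-|lj] := eqVneq l j; first by rewrite inj_in ger0_norm ?rnorm_ge0.
by rewrite inj_out// rnorm0 normr0 rnorm_ge0.
Qed.

End sum_maps.
End weak_maps.

Section snorm_theory.
Variables (R : realType) (k : scalar_kind) (r : \bar R).
Hypothesis r1 : (1 <= r)%E.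
Local Notation K := (scalars R k).
Local Notation "r %:K" := (@of_real R k r) (at level 1, format "r %:K").
Implicit Types cs : seq K.

Lemma snorm_ord cs n : size cs = n ->
  snorm r cs = lp_norm r (fun i : 'I_n => rnorm (cs`_i : K)).
Proof. by move=> <-. Qed.

Lemma snorm_ge0 cs : 0 <= snorm r cs.
Proof. exact: lp_norm_ge0. Qed.

Lemma snormZ (c : R) cs : 0 <= c -> snorm r [seq c%:K * d | d <- cs] = c * snorm r cs.
Proof.
move=> c0; rewrite (@snorm_ord _ (size cs)) ?size_map// /snorm -lp_normZ//.
congr lp_norm; apply/funext => i; rewrite (nth_map 0)//.
apply: (can_inj (@of_realK R k)).
by rewrite of_realM !of_real_rnorm normrM -[`|c%:K|]of_real_rnorm rnorm_of_real.
Qed.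

Lemma snorm_flatten (L : finType) (cs : L -> seq K) (be : L -> R) :
  (forall l, snorm r (cs l) <= be l) ->
  snorm r (flatten [seq cs l | l <- enum L]) <= lp_norm r be.
Proof.
move=> csb; have be0 l : 0 <= be l by exact: le_trans (snorm_ge0 _) (csb l).
case: r r1 csb => [q| |]//= => [|_ csb].
  rewrite lee_fin => q1 csb; have q0 : 0 < q by rewrite (lt_le_trans _ q1).
  have nnegs (I : Type) (s : seq I) (v : I -> R) : 0 <= \sum_(i <- s) `|v i| `^ q.
    by rewrite sumr_ge0// => i _; exact: powR_ge0.
  rewrite /snorm /=; apply: ge0_ler_powR; rewrite ?nnegrE ?nnegs// ?invr_ge0 ?(ltW q0)//.
  rewrite -(big_mkord xpredT (fun i => `|rnorm ((flatten [seq cs l | l <- enum L])`_i : K)| `^ q)).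
  rewrite -(big_nth 0 xpredT (fun c => `|rnorm (c : K)| `^ q)) big_flatten big_map big_enum/=.
  apply: ler_sum => l _; have := csb l; rewrite /snorm /=.
  rewrite -(big_mkord xpredT (fun i => `|rnorm ((cs l)`_i : K)| `^ q)).
  rewrite -(big_nth 0 xpredT (fun c => `|rnorm (c : K)| `^ q)) => h.
  rewrite (ger0_norm (be0 l)) -[leLHS]powRr1 ?nnegs// -(@mulVf _ q) ?gt_eqF// powRrM.
  by apply: ge0_ler_powR => //; rewrite ?nnegrE ?powR_ge0// ltW.
rewrite /snorm /=; apply/bigmax_leP; split=> [|i _].
  by apply: (big_ind (fun x => 0 <= x)) => // x y x0 y0; rewrite le_max x0.
have /flatten_mapP[l _ lc] := mem_nth 0 (ltn_ord i).
move: lc; set c := _`_i => lc; apply: le_trans (le_bigmax _ _ l).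
rewrite (ger0_norm (be0 l)); apply: le_trans (csb l).
rewrite -[X in rnorm X](nth_index 0 lc); have ic : (index c (cs l) < size (cs l))%N by rewrite index_mem.
rewrite /snorm /=; have := le_bigmax 0 (fun i : 'I_(size (cs l)) => `|rnorm ((cs l)`_i : K)|) (Ordinal ic); apply.
Qed.

End snorm_theory.

Section alpha_scaled.
Variables (R : realType) (k : scalar_kind) (X Y : completeNormedModType (scalars R k)).
Variables (A : {linear X -> Y}) (r : \bar R) (xi : ord).
Hypothesis r1 : (1 <= r)%E.
Local Notation K := (scalars R k).
Local Notation "r %:K" := (@of_real R k r) (at level 1, format "r %:K").

Lemma alpha_ge0 : (0 <= alpha xi r A)%E.
Proof.
apply: (@le_trans _ _ (alpha_n xi r 1 A)); last first.
  by apply: ereal_sup_ubound; exists 1%N.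
by apply: le_ereal_inf_tmp => _ [a [a0 _] <-]; rewrite lee_fin ltW.
Qed.

(** When alpha exceeds th there are coefficients and a bound b > th ||cs||_r that cannot be forced;
    rescaling by be th / b gives norm at most be. When be th = 0 the empty list works, since no norm
    is below 0. *)
Lemma alpha_gt_witness th be : 0 <= th -> 0 <= be -> th = 0 \/ (th%:E < alpha xi r A)%E ->
  exists2 cs : seq K, snorm r cs <= be &
    ~ chain (Q (@weakB R k X) xi) cs [set w | rnorm (A w) < be * th] 0.
Proof.
move=> th0 be0 thA; have [bth0|bth0] := eqVneq (be * th) 0.
  exists [::]; last by rewrite /= bth0 linear0 rnorm0 ltxx.
  apply: le_trans be0; rewrite (snorm_ord _ (erefl : size [::] = 0%N)) /=.
  case: r r1 => [q|_|]//= => [|]; last by rewrite big_ord0.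
  rewrite lee_fin big_ord0 => q1; rewrite powR0// invr_eq0 gt_eqF//.
  by rewrite (lt_le_trans _ q1).
case: thA => [th00|]; first by rewrite th00 mulr0 eqxx in bth0.
rewrite ltNge => /negP thA; have := thA; rewrite (alpha_leP xi A r1 th0).
move=> /existsNP[cs /existsNP[b /not_implyP[tb nc]]].
have b0 : 0 < b by apply: le_lt_trans tb; rewrite mulr_ge0// snorm_ge0.
pose la := be * th / b.
have la0 : 0 < la by rewrite divr_gt0// lt_neqAle eq_sym bth0 mulr_ge0.
exists [seq la%:K * c | c <- cs].
  rewrite snormZ ?(ltW la0)// /la mulrAC ler_pdivrMr// -mulrA ler_wpM2l// ltW//.
apply: contra_not nc.
rewrite -[X in chain _ _ _ X](addr0 0) -[X in chain _ _ _ (_ + X)](scaler0 _ la%:K) chain_affine.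
apply: chain_mono; first by apply: Q_up; exact: weakB_up.
move=> w /=; rewrite add0r linearZ/= rnorm_scale ?(ltW la0)//.
by rewrite /la mulrAC ltr_pdivrMr// ltr_pM2l// lt_neqAle eq_sym bth0 mulr_ge0.
Qed.

End alpha_scaled.

(** * Lower estimate for the direct sum *)

Section lower.
Variables (R : realType) (k : scalar_kind) (p : \bar R) (p1 : (1 <= p)%E) (L : finType).
Variables (X Y : L -> completeNormedModType (scalars R k)).
Variables (A : forall l, {linear X l -> Y l}) (r : \bar R) (xi : ord).
Hypothesis r1 : (1 <= r)%E.
Local Notation K := (scalars R k).
Local Notation "r %:K" := (@of_real R k r) (at level 1, format "r %:K").
Local Notation V := (lp_sum p1 X).
Local Notation DA := (lp_diag p1 A : {linear lp_sum p1 X -> lp_sum p1 Y}).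

(** The opponent may confine the replies to the l-th summand: [inj] is a contraction, so preimages
    of sets of the filter are in the filter of [X l]. *)
Lemma chain_inj l cs (P : set V) w : chain (Q (@weakB R k V) xi) cs P w ->
  chain (Q (@weakB R k (X l)) xi) cs [set v | P (w + inj p1 v)] 0.
Proof.
rewrite -{1}[w]addr0 chain_shift -(linear0 (@inj R k p p1 L X l)) => h.
have -> : [set v | P (w + inj p1 v)] = @inj R k p p1 L X l @^-1` [set z | P (w + z)] by [].
rewrite -(chain_push _ _ _ (fun P => Q_push _ _ xi P)).
apply: chain_sub h; first by apply: Q_up; exact: weakB_up.
move=> S; apply: Q_sub; first exact: weakB_up.
by move=> U; apply: weakB_pull; exact: inj_contract.
Qed.

Lemma alpha_coord_le l a : 0 <= a -> (alpha xi r DA <= a%:E)%E -> (alpha xi r (A l) <= a%:E)%E.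
Proof.
move=> a0; rewrite !alpha_leP// => h cs b /h /(@chain_inj l).
apply: chain_mono => [|w /=]; first by apply: Q_up; exact: weakB_up.
rewrite add0r; apply: le_lt_trans.
by rewrite -{1}(inj_in p1 w) -[A l _]/(coord l (DA (inj p1 w))); exact: coord_contract.
Qed.

(** During the coefficients [cs l] the opponent plays in the l-th summand only and keeps the result
    outside [S l]; what was achieved in other coordinates is not disturbed. *)
Lemma chain_flatten (cs : L -> seq K) (S : forall l, set (X l)) (ls : seq L) (P : set V) w :
  uniq ls -> (forall l, ~ chain (Q (@weakB R k (X l)) xi) (cs l) (S l) 0) ->
  chain (Q (@weakB R k V) xi) (flatten [seq cs l | l <- ls]) P w ->
  exists v : V, [/\ P (w + v), forall l, l \in ls -> ~ S l (v l) &
    forall l, l \notin ls -> v l = 0].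
Proof.
move=> uls nS; elim: ls w uls => [|l ls IH] w /= => [_ Pw|/andP[lls uls]].
  by exists 0; rewrite addr0.
rewrite chain_cat => /(@chain_inj l) h.
have [v nv hv] : exists2 v, ~ S l v &
    chain (Q (@weakB R k V) xi) (flatten [seq cs l | l <- ls]) P (w + inj p1 v).
  apply: contrapT => nex; apply: (nS l); apply: chain_mono h => [|v hv].
    by apply: Q_up; exact: weakB_up.
  by apply: contrapT => nv; apply: nex; exists v.
have [u [Pu hu u0]] := IH _ uls hv.
exists (inj p1 v + u); rewrite addrA; split=> // j; rewrite inE.
  have -> : (inj p1 v + u) j = inj p1 v j + u j by [].
  case/predU1P=> [->|jls]; first by rewrite inj_in u0// addr0.
  rewrite inj_out ?add0r; first exact: hu.
  by apply: contra lls => /eqP ->.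
rewrite negb_or => /andP[jl jls].
by rewrite -[LHS]/(inj p1 v j + u j) inj_out 1?eq_sym// u0// addr0.
Qed.

(** Coefficients of norm at most be l that are almost extremal for [A l] are concatenated over l,
    and the opponent keeps the norm of [A l (v l)] at least be l th l in every coordinate. *)
Lemma alpha_diag_lower a (th be : L -> R) : 0 <= a -> (alpha xi r DA <= a%:E)%E ->
  (forall l, 0 <= th l) -> (forall l, 0 <= be l) ->
  (forall l, th l = 0 \/ ((th l)%:E < alpha xi r (A l))%E) ->
  lp_norm p (fun l => be l * th l) <= a * lp_norm r be.
Proof.
move=> a0; rewrite (alpha_leP _ _ r1 a0) => h th0 be0 thA.
have H l := alpha_gt_witness r1 (th0 l) (be0 l) (thA l).
pose cs l := projT1 (cid2 (H l)).
have csb l : snorm r (cs l) <= be l by rewrite /cs; case: cid2.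
have csn l : ~ chain (Q (@weakB R k (X l)) xi) (cs l) [set w | rnorm (A l w) < be l * th l] 0.
  by rewrite /cs; case: cid2.
apply/ler_addgt0Pr => e e0.
have hb : a * snorm r (flatten [seq cs l | l <- enum L]) < a * lp_norm r be + e.
  apply: (@le_lt_trans _ _ (a * lp_norm r be)); last by rewrite ltrDl.
  by apply: ler_wpM2l => //; exact: snorm_flatten.
have {}h := h _ _ hb.
have [v [/= + vn _]] := chain_flatten (enum_uniq L) csn h.
rewrite add0r rnorm_lp_sum => /ltW; apply: le_trans.
apply: lp_norm_le => // l; rewrite !ger0_norm ?rnorm_ge0 ?mulr_ge0//.
by rewrite leNgt; apply/negP; apply: (vn l); rewrite mem_enum.
Qed.

End lower.

Section finite_and.
Variables (R : realType) (k : scalar_kind) (Z : lmodType (scalars R k)).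
Local Notation K := (scalars R k).
Variable q : set (set Z).
Hypotheses (q_up : up q) (q_and : cvx_and q) (q_T : q setT).

Lemma cvx_all (T : eqType) (s : seq T) (E : T -> set Z) :
  (forall x, cvx (E x)) -> cvx [set z | forall x, x \in s -> E x z].
Proof. by move=> Ec t u v t01 Eu Ev x xs; apply: Ec => //; [exact: Eu|exact: Ev]. Qed.

Lemma q_all (T : eqType) (s : seq T) (E : T -> set Z) :
  (forall x, cvx (E x)) -> (forall x, x \in s -> q (E x)) ->
  q [set z | forall x, x \in s -> E x z].
Proof.
move=> Ec; elim: s => [_|x s IH qE]; first by apply: q_up q_T => z _ x.
have qs : q [set z | forall y, y \in s -> E y z].
  by apply: IH => y ys; apply: qE; rewrite inE ys orbT.
apply: q_up (q_and (Ec x) (cvx_all (s := s) Ec) (qE x (mem_head _ _)) qs) => z [Ex Es] y.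
by rewrite inE => /predU1P[->|/Es].
Qed.

Lemma chain_all (T : eqType) (s : seq T) (E : T -> set Z) cs w :
  (forall x, cvx (E x)) -> (forall x, x \in s -> chain q cs (E x) w) ->
  chain q cs [set z | forall x, x \in s -> E x z] w.
Proof.
move=> Ec; elim: cs w => [w EW|c cs IH w EW] /=; first by move=> x /EW.
pose E' x := [set z | chain q cs (E x) (w + c *: z)].
have E'c x : cvx (E' x) by exact: cvx_affine (chain_cvx q_up q_and (Ec x)).
by apply: q_up (q_all E'c EW) => z E'z; apply: IH => x /E'z.
Qed.

End finite_and.

(** * Block vectors of a direct sum *)

Section Q_lp_sum.
Variables (R : realType) (k : scalar_kind) (p : \bar R) (p1 : (1 <= p)%E) (L : finType).
Variable X : L -> completeNormedModType (scalars R k).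
Variable xi : ord.
Local Notation K := (scalars R k).
Local Notation "r %:K" := (@of_real R k r) (at level 1, format "r %:K").
Local Notation V := (lp_sum p1 X).
Local Notation Z := (V * (L -> K^o))%type.

Let part l (z : Z) : (X l * K^o)%type := (coord l z.1, z.2 l).

Let part_linear l : linear (@part l).
Proof. by []. Qed.

HB.instance Definition _ l :=
  GRing.isLinear.Build K Z (X l * K^o)%type _ (@part l) (@part_linear l).

Let fstZ (z : Z) : V := z.1.

Let fstZ_linear : linear fstZ.
Proof. by []. Qed.

HB.instance Definition _ := GRing.isLinear.Build K Z V _ fstZ fstZ_linear.

(** Moves of the direct sum carry the norms of their coordinates along; averaged together with the
    vectors, this second component records the weights c_l. *)
Let FZ : set (set Z) := [set P | weakB [set x : V | P (x, fun l => (rnorm (x l))%:K)]].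

Let FZ_up : up FZ.
Proof. by move=> P P' PP'; apply: weakB_up => x; exact: PP'. Qed.

Let FZ_proper : proper FZ.
Proof. by move=> P /weakB_0 P0; exists (0, fun l => (rnorm ((0 : V) l))%:K). Qed.

Let FZ_and P P' : FZ P -> FZ P' -> FZ (P `&` P').
Proof. exact: weakB_and. Qed.

Let norms : set Z := [set z | exists2 c : L -> R,
  (forall l, 0 <= c l) /\ (forall l, z.2 l = (c l)%:K) & lp_norm p c <= 1].

Let norms_cvx : cvx norms.
Proof.
move=> t u v /andP[t0 t1] [c [c0 uc] c1] [d [d0 vd] d1].
have s0 : 0 <= 1 - t by rewrite subr_ge0.
exists (fun l => t * c l + (1 - t) * d l).
  split=> l; first by rewrite addr_ge0// mulr_ge0.
  rewrite -[LHS]/(t%:K * u.2 l + (1 - t)%:K * v.2 l) uc vd.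
  by rewrite [RHS]of_realD !of_realM.
apply: le_trans (lp_normD p1 _ _) _; rewrite !lp_normZ//.
by have := ler_wpM2l t0 c1; have := ler_wpM2l s0 d1; lra.
Qed.

(** Projected by [part l], the game becomes that of [X l] weighted by norms, where [Q_fat] applies.
    [Q_and] joins the finitely many coordinates and the convex condition [norms], and [fstZ] leads
    back to the direct sum. *)
Theorem Q_lp_sum (E : forall l, set (X l)) d (P : set V) :
  (forall l, cvx (E l)) -> (forall l, E l `<=` [set e | rnorm e <= 1]) ->
  (forall l, Q (@weakB R k (X l)) xi (E l)) -> 0 < d ->
  (forall (x : V) (c : L -> R) (e : V), (forall l, 0 <= c l) -> lp_norm p c <= 1 ->
    (forall l, E l (e l)) -> (forall l, rnorm (x l - (c l)%:K *: e l) <= d) -> P x) ->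
  Q (@weakB R k V) xi P.
Proof.
move=> Ec E1 QE d0 H.
have qU := @Q_up _ _ _ _ FZ_up xi.
have qA := @Q_and _ _ _ _ FZ_up FZ_proper FZ_and xi.
have QN : Q FZ xi norms.
  apply: Q_F => //; apply: weakB_ball => x x1.
  by exists (fun l => rnorm (x l)); [split=> // l; exact: rnorm_ge0|rewrite -rnorm_lp_sum].
have QT : Q FZ xi setT by apply: qU QN.
have Qpart l : Q FZ xi (@part l @^-1` fat (E l) d).
  rewrite -Q_push; apply: (Q_fat (F := @weakB R k (X l))) => //.
  - exact: weakB_up.
  - exact: weakB_proper.
  - exact: weakB_and.
  - exact: weakB_unit.
  - by move=> S S' SS'; apply: FZ_up => z; exact: SS'.
  - move=> S e WS e0.
    exact: weakB_pull (@coord_contract _ _ _ p1 _ X l) (weakB_fat WS e0).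
  - exact: Ec.
  - exact: E1.
  - exact: QE.
have cvxpart l : cvx (@part l @^-1` fat (E l) d).
  by move=> t u v t01 fu fv; exact: (cvx_fat (Ec l) t01 fu fv).
have := q_all (s := enum L) qU qA QT cvxpart (fun l _ => Qpart l).
move=> /(qA _ _ norms_cvx (cvx_all cvxpart) QN) QS.
have -> : @weakB R k V = push fstZ FZ by [].
rewrite Q_push; apply: qU QS => -[x cx] [[c [c0 /= cxE] c1] fx] /=.
(* The weight supplied by [fat] equals the second component at l, so the single family c serves all
   coordinates. *)
have Hf l : exists2 e, E l e & rnorm (x l - (c l)%:K *: e) <= d.
  have [c' [_ /= ]] := fx l (mem_enum _ _).
  by rewrite cxE => /(can_inj (@of_realK R k)) <- [_ [e Ee ->] xe]; exists e.
apply: (H x c (fun l => projT1 (cid2 (Hf l)))) => // l; by case: cid2.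
Qed.

End Q_lp_sum.

(** * Upper estimate for the direct sum *)

Section upper.
Variables (R : realType) (k : scalar_kind) (p : \bar R) (p1 : (1 <= p)%E) (L : finType).
Variable X : L -> completeNormedModType (scalars R k).
Variable xi : ord.
Local Notation K := (scalars R k).
Local Notation "r %:K" := (@of_real R k r) (at level 1, format "r %:K").
Local Notation V := (lp_sum p1 X).
Implicit Types (cs : seq K) (ds : seq R).

Fixpoint scenarios (grid : seq R) n : seq (seq R) :=
  if n is m.+1 then [seq d :: ds | d <- grid, ds <- scenarios grid m] else [:: [::]].

Lemma mem_scenarios grid n ds : (ds \in scenarios grid n) =
  (size ds == n) && all [in grid] ds.
Proof.
elim: n ds => [|n IH] [|d ds] //=.
  by apply/idP => /allpairsP[[? ?]] /= [].
rewrite eqSS; apply/allpairsP/idP => [[[d' ds'] [/= dg dsn [-> ->]]]|].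
  by move: dsn; rewrite IH => /andP[-> ->]; rewrite dg.
move=> /andP[sz /andP[dg dsg]]; exists (d, ds); split=> //=.
by rewrite IH sz dsg.
Qed.

Definition scale_coefs cs ds : seq K := [seq cd.1 * cd.2%:K | cd <- zip cs ds].

(** The player does not control the weights [gs], so the vectors [es] have to be good for every
    scenario of grid values in their place. Finitely many convex targets can be forced together,
    which carries the induction on [cs]. *)
Lemma chain_scenarios (grid : seq R) d cs (P : seq R -> forall l, set (X l))
    (Pi : set V) (w : V) : 0 < d ->
  (forall ds l, cvx (P ds l)) ->
  (forall ds l, ds \in scenarios grid (size cs) ->
     chain (Q (@weakB R k (X l)) xi) (scale_coefs cs ds) (P ds l) 0) ->
  (forall (es : nat -> V) (gs : nat -> L -> R) (w' : V),
     (forall i l, (i < size cs)%N -> rnorm (es i l) <= 1) ->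
     (forall i l, (i < size cs)%N -> 0 <= gs i l) ->
     (forall i, (i < size cs)%N -> lp_norm p (gs i) <= 1) ->
     (forall ds l, ds \in scenarios grid (size cs) ->
        P ds l (\sum_(i < size cs) (cs`_i * (ds`_i)%:K) *: es i l)) ->
     (forall l, rnorm (w' l - (w l + \sum_(i < size cs) (cs`_i * (gs i l)%:K) *: es i l)) <=
        d * \sum_(i < size cs) rnorm (cs`_i : K)) -> Pi w') ->
  chain (Q (@weakB R k V) xi) cs Pi w.
Proof.
move=> d0; elim: cs P Pi w => [|c cs IH] P Pi w Pc Pch H.
  apply: (H (fun=> 0) (fun _ _ => 0)) => // [ds l|l].
    rewrite inE => /eqP ->; rewrite big_ord0.
    by have := Pch [::] l (mem_head _ _).
  by rewrite !big_ord0 addr0 subrr rnorm0 mulr0.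
have qu l := @Q_up _ _ _ _ (@weakB_up R k (X l)) xi.
have qa l := @Q_and _ _ _ _ (@weakB_up R k (X l)) (@weakB_proper R k (X l)) (@weakB_and R k (X l)) xi.
have qB l : Q (@weakB R k (X l)) xi [set e | rnorm e <= 1].
  by apply: Q_F; [exact: weakB_up|exact: weakB_unit].
have qT l : Q (@weakB R k (X l)) xi setT by apply: qu (qB l).
(* Good for the first weight [d0] and later weights [ds]: from this vector on, the remaining scaled
   coefficients can still be forced. *)
pose E0 l d0 ds := [set e : X l | chain (Q (@weakB R k (X l)) xi) (scale_coefs cs ds)
   (P (d0 :: ds) l) (0 + (c * d0%:K) *: e)].
have E0c l d1 ds : cvx (E0 l d1 ds) by exact: cvx_affine (chain_cvx (qu l) (qa l) (Pc _ _)).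
pose E1 l d1 := [set e : X l | forall ds, ds \in scenarios grid (size cs) -> E0 l d1 ds e].
have E1c l d1 : cvx (E1 l d1) by exact: cvx_all (E0c l d1).
pose E l := [set e : X l | forall d1, d1 \in grid -> E1 l d1 e] `&` [set e | rnorm e <= 1].
apply: (@Q_lp_sum R k p p1 L X xi E d) => //.
- by move=> l; apply: cvxI; [exact: cvx_all (E1c l)|exact: cvx_ball].
- by move=> l e [].
- move=> l; apply: (qa l); [exact: cvx_all (E1c l)|exact: cvx_ball| |exact: qB].
  apply: (q_all (qu l) (qa l) (qT l) (E1c l)) => d1 dg.
  apply: (q_all (qu l) (qa l) (qT l) (E0c l d1)) => ds dsn.
  apply: (Pch (d1 :: ds) l); rewrite mem_scenarios /= dg eqSS.
  by move: dsn; rewrite mem_scenarios.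
move=> x g e g0 g1 Ee xe /=.
(* Targets for the remaining coefficients once the first vector e is fixed; its weight still ranges
   over the grid. *)
pose P' ds l := [set v : X l | forall d1, d1 \in grid -> P (d1 :: ds) l ((c * d1%:K) *: e l + v)].
apply: (IH P') => [ds l|ds l dsn|es gs w' es1 gs0 gs1 esP w'E].
- apply: (@cvx_all _ _ _ _ grid (fun d1 => [set v | P (d1 :: ds) l ((c * d1%:K) *: e l + v)])).
  move=> d1 t u v t01 Pu Pv /=; have := Pc (d1 :: ds) l t _ _ t01 Pu Pv.
  by rewrite !scalerDr addrACA cvx_comb.
- apply: (@chain_all _ _ _ _ (qu l) (qa l) (qT l) _ grid
    (fun d1 => [set v | P (d1 :: ds) l ((c * d1%:K) *: e l + v)])).
    move=> d1 t u v t01 Pu Pv /=; have := Pc (d1 :: ds) l t _ _ t01 Pu Pv.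
    by rewrite !scalerDr addrACA cvx_comb.
  move=> d1 dg; rewrite -chain_shift addrC; exact: (Ee l).1 d1 dg ds dsn.
pose es' i := if i is j.+1 then es j else e.
pose gs' i := if i is j.+1 then gs j else g.
apply: (H es' gs').
- by move=> [|i] l //= ilt; [exact: (Ee l).2|exact: es1].
- by move=> [|i] l //= ilt; exact: gs0.
- by move=> [|i] //= ilt; exact: gs1.
- move=> ds l; rewrite mem_scenarios; case: ds => // d1 ds /andP[]; rewrite eqSS => sz /= /andP[dg dsg].
  rewrite big_ord_recl /=; apply: (esP ds l) => //.
  by rewrite mem_scenarios sz.
move=> l; rewrite !big_ord_recl /= mulrDr.
have := w'E l; set S := \sum_(i < size cs) _; set T := \sum_(i < size cs) _ => h.
have -> : w' l - (w l + ((c * (g l)%:K) *: e l + S)) =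
    (w' l - ((w + c *: x) l + S)) + c *: (x l - (g l)%:K *: e l).
  rewrite -[(w + c *: x) l]/(w l + c *: x l) scalerBr scalerA.
  move: (c *: x l) (_ *: e l) => y z; rewrite [z + S]addrC addrA [w l + y + S]addrAC.
  by rewrite !opprD !addrA subrK.
apply: le_trans (rnormD _ _) _; rewrite addrC; apply: lerD => //.
by rewrite rnormZ mulrC; apply: ler_wpM2r; [exact: rnorm_ge0|exact: xe].
Qed.

End upper.

Section upper_alpha.
Variables (R : realType) (k : scalar_kind) (p : \bar R) (p1 : (1 <= p)%E) (L : finType).
Variables (X Y : L -> completeNormedModType (scalars R k)).
Variables (A : forall l, {linear X l -> Y l}) (r : \bar R) (xi : ord).
Hypothesis Ac : forall l, continuous (A l).
Hypothesis r1 : (1 <= r)%E.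
Local Notation K := (scalars R k).
Local Notation "r %:K" := (@of_real R k r) (at level 1, format "r %:K").
Local Notation V := (lp_sum p1 X).
Local Notation DA := (lp_diag p1 A : {linear lp_sum p1 X -> lp_sum p1 Y}).

Lemma rnorm_sum (W : normedModType K) n (F : 'I_n -> W) :
  rnorm (\sum_(i < n) F i) <= \sum_(i < n) rnorm (F i).
Proof.
elim: n F => [|n IH] F; first by rewrite !big_ord0 rnorm0.
by rewrite !big_ord_recl; apply: le_trans (rnormD _ _) _; rewrite lerD2l.
Qed.


Lemma cvx_lt_norm (W W' : normedModType K) (T : {linear W -> W'}) (M : R) :
  cvx [set w | rnorm (T w) < M].
Proof.
move=> t u v /andP[t0 t1] /= uM vM; have s0 : 0 <= 1 - t by rewrite subr_ge0.
rewrite linearD !linearZ/=; apply: le_lt_trans (rnormD _ _) _; rewrite !rnorm_scale//.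
have [t00|tn0] := eqVneq t 0; first by rewrite t00 subr0 mul0r add0r mul1r.
have {tn0 t0}t0 : 0 < t by rewrite lt_neqAle eq_sym tn0.
have -> : M = t * M + (1 - t) * M by ring.
by apply: ltr_leD; [rewrite ltr_pM2l|exact/ler_wpM2l/ltW].
Qed.

(** The relation between p and r enters only through the numerical inequality assumed for moduli t_i
    of coefficients and weights g_i in the unit ball of l_p. The slack is spent in each coordinate
    on three errors of eta/3: approximation of the blocks, rounding of the weights, and the excess
    [eps] of the forced bound. *)
Lemma alpha_diag_upper (al : L -> R) a : 0 <= a -> (forall l, 0 <= al l) ->
  (forall l, (alpha xi r (A l) <= (al l)%:E)%E) ->
  (forall n (t : 'I_n -> R) (g : 'I_n -> L -> R), (forall i, 0 <= t i) ->
     (forall i l, 0 <= g i l) -> (forall i, lp_norm p (g i) <= 1) ->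
     lp_norm p (fun l => al l * lp_norm r (fun i => t i * g i l)) <= a * lp_norm r t) ->
  (alpha xi r DA <= a%:E)%E.
Proof.
move=> a0 al0 Aal Hineq; apply/(alpha_leP _ _ r1 a0) => cs b ab.
pose n := size cs; pose t (i : 'I_n) := rnorm (cs`_i : K).
pose Lam := lp_norm p (fun _ : L => 1 : R).
have Lam0 : 0 <= Lam by exact: lp_norm_ge0.
have Lam1 : 0 < Lam + 1 by rewrite ltr_wpDl.
(* An error eta in every coordinate costs eta Lam in the l_p norm; the added 1 makes the final
   inequality strict. *)
pose eta := (b - a * snorm r cs) / (Lam + 1).
have eta0 : 0 < eta by rewrite divr_gt0// subr_gt0.
have etaE : a * snorm r cs + eta * Lam < b.
  have : eta * (Lam + 1) = b - a * snorm r cs by rewrite mulfVK// gt_eqF.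
  by rewrite mulrDr mulr1; lra.
pose Cl l := projT1 (cid2 (rnorm_bounded (@Ac l))).
have Cl0 l : 0 <= Cl l by rewrite /Cl; case: cid2.
have ClP l x : rnorm (A l x) <= Cl l * rnorm x by rewrite /Cl; case: cid2.
pose C := \sum_l Cl l.
have ClC l : Cl l <= C by rewrite /C (bigD1 l)//= lerDl sumr_ge0.
have C0 : 0 <= C by rewrite sumr_ge0.
pose S := \sum_(i < n) t i.
have t0 i : 0 <= t i by exact: rnorm_ge0.
have S0 : 0 <= S by rewrite sumr_ge0.
(* [C] bounds the norms of all [A l] and [S] is the sum of the moduli of the coefficients, so an
   error d per block costs at most C d S <= eta/3. *)
pose d := eta / (3 * (C + 1) * (S + 1)).
have den0 : 0 < 3 * (C + 1) * (S + 1) by rewrite !mulr_gt0// ltr_wpDl.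
have d0 : 0 < d by rewrite divr_gt0.
have dE : C * (d * S) <= eta / 3.
  have -> : eta / 3 = (C + 1) * (d * (S + 1)).
    by rewrite /d; field; rewrite !gt_eqF// ltr_wpDl.
  have dS : d * S <= d * (S + 1) by rewrite ler_pM2l// lerDl.
  have dS0 : 0 <= d * S by rewrite mulr_ge0// ltW.
  apply: (@le_trans _ _ ((C + 1) * (d * S))); first by rewrite ler_wpM2r// lerDl.
  by rewrite ler_wpM2l// addr_ge0.
pose m := (Num.truncn d^-1).+1.
have m0 : 0 < m%:R :> R by rewrite ltr0n.
have md : m%:R^-1 <= d.
  by rewrite -[leRHS]invrK lef_pV2 ?posrE ?invr_gt0// ltW// truncnS_gt.
pose grid := [seq i%:R / m%:R : R | i <- iota 0 m.+1].
(* Weights are rounded down, so that the norm of the scaled coefficients can only decrease. *)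
pose fl (x : R) : R := (Num.truncn (m%:R * x))%:R / m%:R.
have flP x : 0 <= x -> x <= 1 -> [/\ fl x \in grid, 0 <= fl x, fl x <= x & x - fl x <= d].
  move=> x0 x1; have mx0 : 0 <= m%:R * x by rewrite mulr_ge0// ltW.
  have /andP[fl1 fl2] := truncn_itv mx0.
  split.
  - apply/mapP; exists (Num.truncn (m%:R * x)) => //; rewrite mem_iota add0n ltnS /=.
    rewrite -(ler_nat R); apply: le_trans fl1 _.
    by rewrite ler_piMr// ltW.
  - by rewrite divr_ge0.
  - by rewrite /fl ler_pdivrMr// [x * _]mulrC.
  - apply: le_trans md; rewrite lerBlDl -[X in _ + X]mul1r /fl -mulrDl ler_pdivlMr//.
    by rewrite natr1 [x * _]mulrC ltW.
pose eps := eta / 3.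
have eps0 : 0 < eps by rewrite divr_gt0.
apply: (@chain_scenarios R k p p1 L X xi grid d cs
  (fun ds l => [set v | rnorm (A l v) < al l * snorm r (scale_coefs cs ds) + eps])) => //.
- by move=> ds l; exact: cvx_lt_norm.
- move=> ds l _; apply: ((alpha_leP xi (A l) r1 (al0 l)).1 (Aal l)).
  by rewrite ltrDl.
move=> es gs w' es1 gs0 gs1 esP w'E /=; rewrite rnorm_lp_sum.
apply: le_lt_trans etaE.
pose u l := al l * lp_norm r (fun i : 'I_n => t i * gs i l).
have u0 l : 0 <= u l by rewrite mulr_ge0// lp_norm_ge0.
apply: (@le_trans _ _ (lp_norm p (fun l => u l + eta * 1))); last first.
  apply: le_trans (lp_normD p1 _ _) _; rewrite lp_normZ ?(ltW eta0)// lerD2r.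
  by apply: (Hineq n t (fun i => gs i)) => // i *; [exact: gs0|exact: gs1].
apply: lp_norm_le => // l; rewrite ger0_norm ?rnorm_ge0// ger0_norm; last first.
  by rewrite mulr1 addr_ge0// ltW.
pose ds := mkseq (fun i => fl (gs i l)) n.
have gs01 i : (i < n)%N -> 0 <= gs i l /\ gs i l <= 1.
  move=> ilt; split; first exact: gs0.
  apply: le_trans (gs1 i ilt); rewrite -[leLHS]ger0_norm; last exact: gs0.
  exact: lp_norm_coord.
have dsE (i : 'I_n) : ds`_i = fl (gs i l) by rewrite nth_mkseq.
have dsin : ds \in scenarios grid (size cs).
  rewrite mem_scenarios size_mkseq eqxx /=; apply/(all_nthP 0) => i.
  rewrite size_mkseq => ilt; rewrite nth_mkseq//.
  by have [g0 g1] := gs01 i ilt; case: (flP _ g0 g1).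
have := esP ds l dsin; set S2 := \sum_(i < _) _ => /= S2P.
have := w'E l; set S1 := \sum_(i < _) _.
rewrite -[(0 : V) l]/(0 : X l) add0r => w'S1.
have S12 : rnorm (S1 - S2) <= d * S.
  rewrite /S1 /S2 -sumrB; apply: le_trans (rnorm_sum _) _; rewrite mulr_sumr.
  apply: ler_sum => i _; rewrite -scalerBl -mulrBr -of_realB dsE.
  have [g0 g1] := gs01 i (ltn_ord i); have [_ _ f1 f2] := flP _ g0 g1.
  have f0 : 0 <= gs i l - fl (gs i l) by rewrite subr_ge0.
  rewrite -scalerA rnormZ rnorm_scale// mulrC ler_wpM2r ?rnorm_ge0//.
  apply: le_trans f2; rewrite ler_piMr//; exact: es1.
have snu : snorm r (scale_coefs cs ds) <= lp_norm r (fun i : 'I_n => t i * gs i l).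
  have szd : size (scale_coefs cs ds) = n by rewrite size_map size_zip size_mkseq minnn.
  rewrite (snorm_ord r szd); apply: lp_norm_le => // i.
  rewrite (nth_map (0, 0)) ?size_zip ?size_mkseq ?minnn// nth_zip ?size_mkseq//= dsE.
  have [g0 g1] := gs01 i (ltn_ord i); have [_ f0 f1 _] := flP _ g0 g1.
  have -> : rnorm (cs`_i * (fl (gs i l))%:K : K) = t i * fl (gs i l).
    apply: (can_inj (@of_realK R k)).
    by rewrite of_realM !of_real_rnorm normrM -[`|_%:K|]of_real_rnorm rnorm_of_real.
  by rewrite !ger0_norm ?mulr_ge0// ler_wpM2l.
rewrite -[X in X <= _]/(rnorm (A l (w' l))).
have -> : w' l = (w' l - S1) + (S1 - S2) + S2 by rewrite [w' l - S1 + _]addrA !subrK.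
have CdS : Cl l * (d * S) <= eta / 3.
  by apply: le_trans dE; rewrite ler_wpM2r// mulr_ge0// ltW.
have b1 : rnorm (A l (w' l - S1)) <= eta / 3.
  by apply: le_trans (ClP _ _) _; apply: le_trans CdS; rewrite ler_wpM2l.
have b2 : rnorm (A l (S1 - S2)) <= eta / 3.
  by apply: le_trans (ClP _ _) _; apply: le_trans CdS; rewrite ler_wpM2l.
have b3 : rnorm (A l S2) <= u l + eta / 3.
  by apply: le_trans (ltW S2P) _; rewrite lerD2r ler_wpM2l.
move: (w' l - S1) (S1 - S2) b1 b2 => x1 x2 b1 b2; rewrite !linearD/=.
apply: le_trans (rnormD _ _) _; apply: le_trans (lerD (rnormD _ _) (lexx _)) _.
have -> : u l + eta * 1 = eta / 3 + eta / 3 + (u l + eta / 3) by field.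
exact: lerD (lerD b1 b2) b3.
Qed.

End upper_alpha.

(** * Norm inequalities and the theorem *)

Section lp_inequalities.
Variables (R : realType).
Implicit Types (I L : finType).

Lemma sumr_powR_ge0 I (v : I -> R) q : 0 <= \sum_i `|v i| `^ q.
Proof. by rewrite sumr_ge0// => i _; exact: powR_ge0. Qed.

Lemma lp_norm_pow I (v : I -> R) q : q != 0 ->
  lp_norm q%:E v `^ q = \sum_i `|v i| `^ q.
Proof. by move=> q0; rewrite /lp_norm -powRrM mulVf// powRr1// sumr_powR_ge0. Qed.

Lemma powR1r (q : R) : 1 `^ q = 1 :> R.
Proof. by rewrite powR1. Qed.

Lemma powR_mono (q x y : R) : 0 < q -> 0 <= x -> 0 <= y -> (x `^ q <= y `^ q) = (x <= y).
Proof.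
move=> q0 x0 y0; apply/idP/idP => [|xy]; last by apply: ge0_ler_powR => //; exact: ltW.
by apply: contraTT; rewrite -!ltNge => yx; apply: gt0_ltr_powR.
Qed.

Lemma lp_norm_leP I (v : I -> R) q c : 0 < q -> 0 <= c ->
  (lp_norm q%:E v <= c) = (\sum_i `|v i| `^ q <= c `^ q).
Proof.
move=> q0 c0; rewrite -lp_norm_pow ?gt_eqF// powR_mono//.
exact: powR_ge0.
Qed.

Lemma lp_norm_sum I L (p : \bar R) (u : I -> L -> R) : (1 <= p)%E ->
  lp_norm p (fun l => \sum_i u i l) <= \sum_i lp_norm p (u i).
Proof.
move=> p1; have N0 : lp_norm p (fun _ : L => 0 : R) = 0.
  rewrite -[RHS](mul0r (lp_norm p (fun _ : L => 0 : R))) -lp_normZ//.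
  by congr lp_norm; apply/funext => l; rewrite mul0r.
elim: (index_enum I) => [|i s IH].
  rewrite big_nil; under eq_fun do rewrite big_nil.
  by rewrite N0.
rewrite big_cons; under eq_fun do rewrite big_cons.
by apply: le_trans (lp_normD p1 _ _) _; rewrite lerD2l.
Qed.

(** All entries have modulus at most 1, and on [0,1] the power with the larger exponent is the
    smaller one. *)
Lemma lp_norm_unit_mono L (p r : \bar R) (g : L -> R) : (1 <= p)%E -> (p <= r)%E ->
  lp_norm p g <= 1 -> lp_norm r g <= 1.
Proof.
move=> p1 pr g1; have r1 := le_trans p1 pr.
have gl l : `|g l| <= 1 by exact: le_trans (lp_norm_coord p1 g l) g1.
case: r pr r1 => [rho| |] pr r1; [|clear pr r1|by rewrite leeNy_eq in r1]; last first.
  rewrite /lp_norm; apply/bigmax_leP; split=> [|l _]; [exact: ler01|exact: gl].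
case: p p1 pr g1 => [q| |] p1 pr g1;
  [|by rewrite leye_eq in pr|by rewrite leeNy_eq in p1].
rewrite !lee_fin in p1 pr r1.
have [q1 qr] := (p1, pr).
have q0 : 0 < q by exact: lt_le_trans q1.
have r0 : 0 < rho by exact: lt_le_trans qr.
rewrite (lp_norm_leP g r0 ler01) powR1r.
rewrite (lp_norm_leP g q0 ler01) powR1r in g1.
apply: le_trans g1; apply: ler_sum => l _.
have [->|gl0] := eqVneq `|g l| 0; first by rewrite !powR0 ?gt_eqF.
by apply: ger_powR => //; rewrite lt_neqAle eq_sym gl0 normr_ge0 gl.
Qed.

(** For finite p, raising to the power r turns this into Minkowski's inequality in l_{p/r} for the
    functions (t_i g_i)^r, whose norms there are at most t_i^r. For p = oo each g_i is bounded
    pointwise by 1. *)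
Lemma mixed_norm_le L n (p r : \bar R) (t : 'I_n -> R) (g : 'I_n -> L -> R) :
  (1 <= r)%E -> (r <= p)%E -> (forall i, 0 <= t i) -> (forall i l, 0 <= g i l) ->
  (forall i, lp_norm p (g i) <= 1) ->
  lp_norm p (fun l => lp_norm r (fun i => t i * g i l)) <= lp_norm r t.
Proof.
move=> r1 rp t0 g0 g1; have p1 := le_trans r1 rp.
case: p p1 rp g1 => [q| |] p1 rp g1; [| |by rewrite leeNy_eq in p1]; last first.
  rewrite /(lp_norm +oo%E); apply/bigmax_leP; split=> [|l _]; first exact: lp_norm_ge0.
  rewrite ger0_norm ?lp_norm_ge0//; apply: lp_norm_le => // i.
  rewrite normrM ler_piMr//; apply: le_trans (g1 i).
  exact: (lp_norm_coord p1).
case: r r1 rp => [rho| |] r1 rq; [|by rewrite leye_eq in rq|by rewrite leeNy_eq in r1].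
rewrite !lee_fin in p1 r1 rq.
have r0 : 0 < rho by exact: lt_le_trans r1.
have q0 : 0 < q by exact: lt_le_trans rq.
have s1 : (1 <= (q / rho)%:E)%E by rewrite lee_fin ler_pdivlMr// mul1r.
have s0 : 0 < q / rho by exact: divr_gt0.
rewrite (lp_norm_leP _ q0 (lp_norm_ge0 rho%:E t)).
pose u i l := (t i * g i l) `^ rho.
have tg0 i l : 0 <= t i * g i l by exact: mulr_ge0.
have -> : \sum_l `|lp_norm rho%:E (fun i => t i * g i l)| `^ q =
    lp_norm (q / rho)%:E (fun l => \sum_i u i l) `^ (q / rho).
  rewrite lp_norm_pow ?gt_eqF//; apply: eq_bigr => l _.
  rewrite ger0_norm; last exact: powR_ge0.
  have -> : q = rho * (q / rho) by rewrite mulrCA divff ?mulr1// gt_eqF.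
  rewrite powRrM lp_norm_pow ?gt_eqF// -[rho * _]mulrC divfK ?gt_eqF//; congr (_ `^ _).
  rewrite ger0_norm; last by rewrite sumr_ge0// => i _; exact: powR_ge0.
  by apply: eq_bigr => i _; rewrite ger0_norm.
have qE : q = rho * (q / rho) by rewrite mulrCA divff ?mulr1// gt_eqF.
have tq : lp_norm rho%:E t `^ (rho * (q / rho)) = (\sum_i `|t i| `^ rho) `^ (q / rho).
  by rewrite powRrM; congr (_ `^ _); exact: lp_norm_pow (lt0r_neq0 r0).
rewrite -qE in tq; rewrite tq.
have nn0 := lp_norm_ge0 (q / rho)%:E (fun l => \sum_i u i l).
rewrite (powR_mono s0 nn0 (sumr_powR_ge0 t rho)).
apply: le_trans (lp_norm_sum u s1) _; apply: ler_sum => i _.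
rewrite (ger0_norm (t0 i)) (lp_norm_leP (u i) s0 (powR_ge0 (t i) rho)).
rewrite -powRrM [rho * _]mulrC divfK ?gt_eqF//.
have := g1 i; rewrite (lp_norm_leP (g i) q0 ler01) powR1r => gi1.
rewrite -[leRHS]mulr1; apply: le_trans (ler_wpM2l (powR_ge0 _ _) gi1).
rewrite mulr_sumr; apply: ler_sum => l _.
rewrite /u ger0_norm ?powR_ge0// -powRrM mulrCA divff ?mulr1 ?gt_eqF//.
by rewrite powRM// ger0_norm.
Qed.

(** Young's inequality with the conjugate exponents s/q and r/q is applied to the q-th powers of the
    normalized functions. The case r = oo, where s = q, and the case of a vanishing norm are
    apart. *)
Lemma lp_holder L (q s : R) (r : \bar R) (u v : L -> R) :
  0 < q -> 0 < s -> (1 <= r)%E -> (r^-1 + (s^-1)%:E = (q^-1)%:E)%E ->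
  (forall l, 0 <= u l) -> (forall l, 0 <= v l) ->
  lp_norm q%:E (fun l => u l * v l) <= lp_norm s%:E u * lp_norm r v.
Proof.
move=> q0 s0 r1 rsq u0 v0.
have N0 : 0 <= lp_norm s%:E u by exact: powR_ge0.
have M0 := lp_norm_ge0 r v.
rewrite (lp_norm_leP (fun l => u l * v l) q0 (mulr_ge0 N0 M0)).
case: r r1 rsq M0 => [rho| |] r1 rsq M0; [| |by rewrite leeNy_eq in r1]; last first.
  have qs : q = s.
    by move: rsq; rewrite invey add0e => -[] /invr_inj.
  rewrite powRM// -qs lp_norm_pow ?gt_eqF// mulr_suml; apply: ler_sum => l _.
  rewrite normrM powRM// ler_wpM2l ?powR_ge0// powR_mono//.
  exact: (lp_norm_coord (p := +oo%E)).
have r0 : 0 < rho by apply: lt_le_trans (r1 : (1 <= rho)%R).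
have {}rsq : rho^-1 + s^-1 = q^-1.
  by move: rsq; rewrite inver gt_eqF// -EFinD => -[].
have [N00|Nn0] := eqVneq (lp_norm s%:E u) 0.
  have u00 l : u l = 0.
    have : \sum_l `|u l| `^ s = 0 by rewrite -lp_norm_pow ?gt_eqF// N00 powR0// gt_eqF.
    move=> /psumr_eq0P => /(_ (fun i _ => powR_ge0 _ _)) /(_ l isT) /eqP.
    by rewrite powR_eq0 normr_eq0 => /andP[/eqP].
  rewrite big1 ?powR_ge0// => l _; rewrite u00 mul0r normr0 powR0// gt_eqF//.
have [M00|Mn0] := eqVneq (lp_norm rho%:E v) 0.
  rewrite big1 ?powR_ge0// => l _; rewrite (lp_norm_eq0 r1 M00) mulr0 normr0 powR0// gt_eqF//.
have uE := esym (lp_norm_pow u (lt0r_neq0 s0)).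
have vE := esym (lp_norm_pow v (lt0r_neq0 r0)).
move: (lp_norm s%:E u) (lp_norm rho%:E v) N0 M0 Nn0 Mn0 uE vE => N M N0 M0 Nn0 Mn0 uE vE.
have {}N0 : 0 < N by rewrite lt_neqAle eq_sym Nn0.
have {}M0 : 0 < M by rewrite lt_neqAle eq_sym Mn0.
have qsr : (s / q)^-1 + (rho / q)^-1 = 1.
  by rewrite !invf_div -mulrDr addrC rsq divff// gt_eqF.
have step l : `|u l * v l| `^ q <= (N * M) `^ q *
    ((s / q)^-1 * ((`|u l| / N) `^ s) + (rho / q)^-1 * ((`|v l| / M) `^ rho)).
  have x0 : 0 <= `|u l| / N by rewrite divr_ge0// ltW.
  have y0 : 0 <= `|v l| / M by rewrite divr_ge0// ltW.
  have := @conjugate_powR R ((`|u l| / N) `^ q) ((`|v l| / M) `^ q) (s / q) (rho / q)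
    (powR_ge0 _ _) (powR_ge0 _ _) (divr_gt0 s0 q0) (divr_gt0 r0 q0) qsr.
  rewrite -!powRrM ![q * (_ / q)]mulrCA divff ?gt_eqF// !mulr1 -powRM// => h.
  rewrite [(s / q)^-1 * _]mulrC [(rho / q)^-1 * _]mulrC.
  apply: le_trans (ler_wpM2l (powR_ge0 _ _) h).
  have NM0 := mulr_ge0 (ltW N0) (ltW M0); have xy0 := mulr_ge0 x0 y0.
  rewrite -(powRM _ NM0 xy0) (powR_mono q0 (normr_ge0 _) (mulr_ge0 NM0 xy0)) normrM.
  have -> // : N * M * (`|u l| / N * (`|v l| / M)) = `|u l| * `|v l|.
  by field; rewrite Nn0 Mn0.
apply: le_trans (ler_sum _ (fun l _ => step l)) _.
rewrite -mulr_sumr ler_piMr ?powR_ge0// big_split/= -!mulr_sumr.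
have sum1 (w : L -> R) (c e : R) : 0 < c -> 0 < e ->
    \sum_l `|w l| `^ e = c `^ e -> \sum_l (`|w l| / c) `^ e = 1.
  move=> c0 e0 wc; have ce : c `^ e != 0 by rewrite gt_eqF// powR_gt0.
  apply: (mulfI ce); rewrite mulr1 -[RHS]wc mulr_sumr.
  apply: eq_bigr => l _; rewrite -powRM ?divr_ge0// ?ltW//.
  by rewrite mulrCA divff ?mulr1// gt_eqF.
by rewrite !sum1// !mulr1 qsr.
Qed.

End lp_inequalities.

Lemma ereal_le_real (R : realType) (x y : \bar R) : (0 <= x)%E ->
  (forall a, 0 <= a -> (x <= a%:E)%E -> (y <= a%:E)%E) -> (y <= x)%E.
Proof.
case: x => [a a0 h|_ _|//]; last exact: leey.
by apply: h; rewrite -?lee_fin.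
Qed.

(** * The relation between the exponents and the two formulas *)

Section exponents.
Variables (R : realType) (q s : R) (r : \bar R).
Hypotheses (q1 : 1 <= q) (r1 : (1 <= r)%E) (qr : (q%:E < r)%E).
Hypothesis rsq : (r^-1 + s%:E^-1 = q%:E^-1)%E.

(** 1/s = 1/q - 1/r > 0. The value s = 0 is impossible, since the extended inverse of 0 is infinite
    while 1/q is finite. *)
Lemma exponent_gt0 : 0 < s.
Proof.
have q0 : 0 < q by exact: lt_le_trans q1.
move: rsq; rewrite (inver q) gt_eqF// inver; case: eqVneq => [_|s0].
  by case: r r1 => [rho| |//] _; rewrite ?invey ?inver; [case: ifP|].
case: r r1 qr => [rho| |//] r1' qr'; last by rewrite invey add0e => -[] /invr_inj ->.
rewrite lte_fin in qr'; have rho0 := lt_trans q0 qr'.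
rewrite inver (gt_eqF rho0) -EFinD => -[] e.
rewrite -invr_gt0; have -> : s^-1 = q^-1 - rho^-1 by rewrite -e [rho^-1 + _]addrC addrK.
by rewrite subr_gt0 ltf_pV2.
Qed.

Lemma exponent_finite : (r^-1 + (s^-1)%:E = (q^-1)%:E)%E.
Proof.
have q0 : 0 < q by exact: lt_le_trans q1.
by move: rsq; rewrite (inver q) gt_eqF// (inver s) gt_eqF ?exponent_gt0.
Qed.

End exponents.

Section diagonal.
Variables (R : realType) (k : scalar_kind) (p : \bar R) (p1 : (1 <= p)%E) (L : finType).
Variables (X Y : L -> completeNormedModType (scalars R k)).
Variables (A : forall l, {linear X l -> Y l}) (r : \bar R) (xi : ord).
Hypothesis Ac : forall l, continuous (A l).
Hypothesis r1 : (1 <= r)%E.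
Local Notation DA := (lp_diag p1 A : {linear lp_sum p1 X -> lp_sum p1 Y}).

Lemma alpha_coord l : (alpha xi r (A l) <= alpha xi r DA)%E.
Proof. by apply: ereal_le_real (alpha_ge0 _ _ _) _ => a a0; exact: alpha_coord_le. Qed.

(** With all alpha(A_l) bounded by the same a, the inequality required by [alpha_diag_upper] is a
    times [mixed_norm_le]; the other estimate is [alpha_coord]. *)
Lemma alpha_diag_max : (0 < #|L|)%N -> (r <= p)%E ->
  alpha xi r DA = \big[maxe/-oo%E]_(l : L) alpha xi r (A l).
Proof.
move=> /card_gt0P[l0 _] rp; apply/eqP; rewrite eq_le; apply/andP; split; last first.
  by apply/bigmax_leP; split=> [|l _]; [exact: leNye|exact: alpha_coord].
have leM l : (alpha xi r (A l) <= \big[maxe/-oo%E]_(l : L) alpha xi r (A l))%E.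
  exact: (le_bigmax _ (fun l => alpha xi r (A l))).
apply: ereal_le_real => [|a a0 Ma]; first exact: le_trans (alpha_ge0 _ _ _) (leM l0).
apply: (alpha_diag_upper p1 Ac r1 (al := fun=> a)) => //.
  by move=> l; exact: le_trans (leM l) Ma.
move=> n t g t0 g0 g1; rewrite lp_normZ//; apply: ler_wpM2l => //.
exact: mixed_norm_le.
Qed.

End diagonal.

Section diagonal_sum.
Variables (R : realType) (k : scalar_kind) (q : R) (q1 : (1 <= q%:E)%E) (L : finType).
Variables (X Y : L -> completeNormedModType (scalars R k)).
Variables (A : forall l, {linear X l -> Y l}) (r : \bar R) (xi : ord) (s : R).
Hypothesis Ac : forall l, continuous (A l).
Hypothesis r1 : (1 <= r)%E.
Hypothesis qr : (q%:E < r)%E.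
Hypothesis s0 : 0 < s.
Hypothesis rsq : (r^-1 + (s^-1)%:E = (q^-1)%:E)%E.
Local Notation DA := (lp_diag q1 A : {linear lp_sum q1 X -> lp_sum q1 Y}).

Let q0 : 0 < q.
Proof. by apply: (lt_le_trans ltr01); rewrite -lee_fin. Qed.

(** Hoelder's inequality separates [al] from the weights. The g_i lie in the unit ball of l_p, hence
    in that of l_r, and [mixed_norm_le] applies with both exponents equal to r. *)
Lemma alpha_diag_holder (al : L -> R) : (forall l, 0 <= al l) ->
  (forall l, (alpha xi r (A l) <= (al l)%:E)%E) ->
  (alpha xi r DA <= (lp_norm s%:E al)%:E)%E.
Proof.
move=> al0 Aal; apply: (alpha_diag_upper q1 Ac r1 (al := al)) => //; first exact: lp_norm_ge0.
move=> n t g t0 g0 g1.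
have v0 l : 0 <= lp_norm r (fun i => t i * g i l) by exact: lp_norm_ge0.
apply: le_trans (lp_holder q0 s0 r1 rsq al0 v0) _.
apply: ler_wpM2l; first exact: lp_norm_ge0.
apply: mixed_norm_le => // i; apply: lp_norm_unit_mono q1 (ltW qr) (g1 i).
Qed.

(* Equality in Hoelder's inequality: test with the weights [th `^ (s / r)]. *)
Lemma alpha_diag_weights a (th : L -> R) : 0 <= a -> (alpha xi r DA <= a%:E)%E ->
  (forall l, 0 <= th l) -> (forall l, th l = 0 \/ ((th l)%:E < alpha xi r (A l))%E) ->
  lp_norm s%:E th <= a.
Proof.
move=> a0 Da th0 thA.
have H be be0 := alpha_diag_lower (be := be) r1 a0 Da th0 be0 thA.
case: r r1 qr rsq H => [rho| |] r1' qr' rsq' H; [| |by rewrite leeNy_eq in r1']; last first.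
  have qs : q = s by move: rsq'; rewrite invey add0e => -[] /invr_inj.
  (* For r = oo the test weights are constantly 1, and s = q. *)
  have := H (fun=> 1) (fun=> ler01); rewrite qs.
  have -> : (fun l => 1 * th l) = th by apply/funext => l; rewrite mul1r.
  move/le_trans; apply; rewrite -[leRHS]mulr1; apply: ler_wpM2l => //.
  rewrite /(lp_norm +oo%E); apply/bigmax_leP; split=> [|l _]; first exact: ler01.
  by rewrite normr1.
have r0 : 0 < rho by apply: (lt_le_trans ltr01); rewrite -lee_fin.
have e : rho^-1 + s^-1 = q^-1 by move: rsq'; rewrite inver gt_eqF// -EFinD => -[].
set T := \sum_l `|th l| `^ s.
have T0 : 0 <= T by exact: sumr_powR_ge0.
have := H (fun l => th l `^ (s / rho)) (fun l => powR_ge0 _ _).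
have -> : lp_norm q%:E (fun l => th l `^ (s / rho) * th l) = T `^ q^-1.
  rewrite /(lp_norm q%:E); congr (_ `^ _); apply: eq_bigr => l _.
  rewrite !ger0_norm ?mulr_ge0 ?powR_ge0//.
  have [->|t0] := eqVneq (th l) 0; first by rewrite mulr0 !powR0 ?gt_eqF.
  rewrite -{2}(powRr1 (th0 l)) -powRD ?t0 ?implybT// -powRrM; congr (_ `^ _).
  have -> : s / rho + 1 = s * q^-1 by rewrite -e mulrDr mulfV ?gt_eqF.
  by rewrite mulfVK ?gt_eqF.
have -> : lp_norm rho%:E (fun l => th l `^ (s / rho)) = T `^ rho^-1.
  rewrite /(lp_norm rho%:E); congr (_ `^ _); apply: eq_bigr => l _.
  by rewrite !ger0_norm ?powR_ge0// -powRrM mulfVK ?gt_eqF.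
(* The estimate now reads T^(1/q) <= a T^(1/rho); as 1/q = 1/rho + 1/s, division by T^(1/rho) leaves
   T^(1/s) <= a unless T = 0. *)
have [T00 _|Tn0] := eqVneq T 0.
  by rewrite /(lp_norm s%:E) -/T T00 powR0// invr_eq0 gt_eqF.
have {}T0 : 0 < T by rewrite lt_neqAle eq_sym Tn0.
rewrite /(lp_norm s%:E) -/T -e powRD; last by rewrite Tn0 implybT.
by rewrite mulrC ler_pM2r// powR_gt0.
Qed.

Lemma alpha_diag_sum :
  (alpha xi r DA `^ s = \sum_(l : L) alpha xi r (A l) `^ s)%E.
Proof.
have Age l : (0 <= alpha xi r (A l))%E by exact: alpha_ge0.
have Dge : (0 <= alpha xi r DA)%E by exact: alpha_ge0.
have lpE (al : L -> R) : (forall l, 0 <= al l) ->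
    (\sum_l ((al l)%:E `^ s))%E = (lp_norm s%:E al `^ s)%:E.
  move=> al0; rewrite (lp_norm_pow al (lt0r_neq0 s0)) -sumEFin; apply: eq_bigr => l _.
  by rewrite poweR_EFin ger0_norm.
(* If some alpha(A_l) is infinite, [alpha_coord] makes the left side infinite as well. *)
have [[l0 Aoo]|fin] := pselect (exists l, alpha xi r (A l) = +oo%E).
  have := alpha_coord q1 A xi r1 l0; rewrite Aoo leye_eq => /eqP ->.
  have S0 : (0 <= \sum_(l | l != l0) alpha xi r (A l) `^ s)%E.
    by apply: sume_ge0 => l _; exact: poweR_ge0.
  rewrite (bigD1 l0)//= Aoo poweRyr ?gt_eqF//.
  by move: S0; case: (\sum_(l | l != l0) _)%E.
pose al l := fine (alpha xi r (A l)).
have AE l : alpha xi r (A l) = (al l)%:E.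
  rewrite /al fineK// ge0_fin_numE// ltey; apply/eqP => Aoo; apply: fin; by exists l.
have al0 l : 0 <= al l by rewrite -lee_fin -AE.
have DE : alpha xi r DA = (lp_norm s%:E al)%:E.
  apply/eqP; rewrite eq_le; apply/andP; split.
    by apply: alpha_diag_holder => // l; rewrite AE.
  apply: ereal_le_real => // a a0 Da; rewrite lee_fin leNgt; apply/negP => aN.
  pose N := lp_norm s%:E al.
  have N0 : 0 < N by exact: le_lt_trans aN.
  (* This t lies strictly between a/N and 1: each t al_l is 0 or strictly below alpha(A_l), so
     [alpha_diag_weights] gives t N <= a, a contradiction. *)
  pose t := (a / N + 1) / 2.
  have aN1 : a / N < 1 by rewrite ltr_pdivrMr// mul1r.
  have aN0 : 0 <= a / N by rewrite divr_ge0// ltW.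
  have t0 : 0 <= t by rewrite /t; lra.
  have t1 : t < 1 by rewrite /t; lra.
  (* Here q <= s because 1/s <= 1/q; the bound is needed for the homogeneity [lp_normZ]. *)
  have s1 : (1 <= s%:E)%E.
    apply: le_trans q1 _; rewrite lee_fin -[leLHS]invrK -[leRHS]invrK.
    rewrite lef_pV2 ?posrE ?invr_gt0// -lee_fin -rsq; apply: leeDr.
    by rewrite inve_ge0 (le_trans _ r1).
  have := @alpha_diag_weights a (fun l => t * al l) a0 Da.
  rewrite (lp_normZ s1)// -/N leNgt => H.
  have : ~~ (a < t * N).
    apply: H => l; first exact: mulr_ge0.
    have [->|al_n0] := eqVneq (al l) 0; first by left; rewrite mulr0.
    right; rewrite AE lte_fin -[ltRHS]mul1r ltr_pM2r// lt_neqAle eq_sym al_n0.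
    exact: al0.
  rewrite -leNgt -ler_pdivlMr// leNgt => /negP; apply.
  by rewrite /t; lra.
by rewrite DE poweR_EFin -lpE//; apply: eq_bigr => l _; rewrite AE.
Qed.

End diagonal_sum.

Theorem theorem1p5 (R : realType) (k : scalar_kind) (p : \bar R)
    (p1 : (1 <= p)%E) (L : finType) (L0 : (0 < #|L|)%N) (xi : ord)
    (X Y : L -> completeNormedModType (scalars R k))
    (A : forall l : L, {linear X l -> Y l})
    (Ac : forall l : L, continuous (A l))
    (r : \bar R) (r1 : (1 <= r)%E) :
  ((r <= p)%E ->
     alpha xi r (lp_diag p1 A : {linear lp_sum p1 X -> lp_sum p1 Y})
     = \big[maxe/-oo%E]_(l : L) alpha xi r (A l)) /\
  ((p < r)%E -> forall s : R, (r^-1 + s%:E^-1 = p^-1)%E ->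
     (alpha xi r (lp_diag p1 A : {linear lp_sum p1 X -> lp_sum p1 Y}) `^ s
      = \sum_(l : L) alpha xi r (A l) `^ s)%E).
Proof.
split=> [rp|pr s rsp]; first exact: alpha_diag_max.
case: p p1 pr rsp => [q| |] p1 pr rsp; [|by rewrite ltNge leey in pr|by have := p1; rewrite leeNy_eq].
have q1 : 1 <= q by rewrite -lee_fin.
have s0 := exponent_gt0 q1 r1 pr rsp.
exact: alpha_diag_sum (exponent_finite q1 r1 pr rsp).
Qed.
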